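(* Let $(W,S)$ be of type $B_{n+1}$, $S=\{0,1,\dots,n\}$, and let $w_{00}=0\,w_0$ and $u_{00}=010\,w_0$ (products of simple reflections with the longest element $w_0$), the two elements of ${}^0\mathcal H^0$. Then $$p_{e,w_{00}}+p_{e,u_{00}}=v^{\ell(w_0)-1}+v^{\ell(w_0)-3}+\cdots+v^{\ell(w_0)-2n-1}.$$ More specifically, if $n+1$ is odd, then $w_{00}$ is the Duflo element in ${}^0\mathcal H^0$ and $$p_{e,w_{00}}=v^{\ell(w_0)-1}+v^{\ell(w_0)-5}+\cdots+v^{\ell(w_0)-2n-1},\qquad p_{e,u_{00}}=v^{\ell(w_0)-3}+v^{\ell(w_0)-7}+\cdots+v^{\ell(w_0)-2n+1};$$ if $n+1$ is even, then $u_{00}$ is the Duflo element in ${}^0\mathcal H^0$ and $$p_{e,w_{00}}=v^{\ell(w_0)-1}+v^{\ell(w_0)-5}+\cdots+v^{\ell(w_0)-2n+1},\qquad p_{e,u_{00}}=v^{\ell(w_0)-3}+v^{\ell(w_0)-7}+\cdots+v^{\ell(w_0)-2n-1}.$$ (In the first displayed sum exponents decrease by $2$; in the others they decrease by $4$.)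
   Context: Type $B_{n+1}$, $n\geq1$: the simple reflections are labeled $0,1,\dots,n$ along the Coxeter diagram, a path $0-1-\cdots-n$ whose only multiple (double) edge joins $0$ and $1$. $\ell$ is the length function and $\ell(w_0)=(n+1)^2$. Penultimate cell: $\mathcal J=\{w_0u: u\in W\setminus\{e\}\text{ has a unique reduced expression}\}$ (a two-sided Kazhdan–Lusztig cell); ${}^0\mathcal H^0$ is the set of $y\in\mathcal J$ with left and right descent sets both equal to $S\setminus\{0\}$. Kazhdan–Lusztig polynomials: the Hecke algebra over $\mathbb Z[v,v^{-1}]$ is generated by $H_s$, $s\in S$, with the braid relations and $(H_s+v)(H_s-v^{-1})=0$; $H_w$ is the standard basis; the bar involution satisfies $\overline v=v^{-1}$, $\overline{H_s}=H_s^{-1}$. $\underline H_w$ is the unique bar-invariant element of the form $H_w+\sum_{y<w}p_{y,w}H_y$ with $p_{y,w}\in v\mathbb Z[v]$. Duflo elements: for a two-sided cell $\mathcal J'$, $\mathbf a(\mathcal J')$ (the value of Lusztig's $\mathbf a$-function) is the minimal exponent occurring in the polynomials $p_{e,w}$, $w\in\mathcal J'$; an element $w\in\mathcal J'$ is a Duflo element (distinguished involution) if $v^{\mathbf a(\mathcal J')}$ occurs in $p_{e,w}$. *)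

(* Defs.v *)
From HB Require Import structures.
From mathcomp Require Import all_boot all_order all_algebra all_fingroup.
From mathcomp Require boolp.

Set Implicit Arguments.
Unset Strict Implicit.
Unset Printing Implicit Defensive.

Import GRing.Theory.

Section Laurent.
Local Open Scope ring_scope.

(* Z[v, v^-1] is realized as the subring of Frac(Z['X]) = Q(v) whose elements
   are the fractions p / 'X^k with p in Z['X]; v is 'X. *)

Definition laurent_pred : {pred {fraction {poly int}}} := fun x =>
  boolp.asbool (exists (p : {poly int}) (k : nat),
    x = tofrac p / tofrac 'X ^+ k).

Lemma fracX_neq0 k : tofrac ('X : {poly int}) ^+ k != 0.
Proof. by rewrite expf_neq0 // tofrac_eq0 polyX_eq0. Qed.

Lemma laurent_subring : subring_closed laurent_pred.
Proof.
split.
- by apply/boolp.asboolP; exists 1, 0%N; rewrite expr0 divr1 tofrac1.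
- move=> x y /boolp.asboolP[p [k ->]] /boolp.asboolP[q [l ->]].
  apply/boolp.asboolP; exists (p * 'X^l - q * 'X^k), (k + l)%N.
  rewrite tofracB !tofracM !tofracXn exprD.
  by rewrite -mulNr addf_div ?fracX_neq0 // mulNr.
- move=> x y /boolp.asboolP[p [k ->]] /boolp.asboolP[q [l ->]].
  apply/boolp.asboolP; exists (p * q), (k + l)%N.
  by rewrite tofracM exprD mulf_div.
Qed.

HB.instance Definition _ :=
  GRing.isSubringClosed.Build {fraction {poly int}} laurent_pred laurent_subring.

Record laurent := Laurent {
  laurent_val :> {fraction {poly int}};
  _ : laurent_val \in laurent_pred }.

HB.instance Definition _ := [isSub for laurent_val].
HB.instance Definition _ := [Choice of laurent by <:].
HB.instance Definition _ := [SubChoice_isSubComNzRing of laurent by <:].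

Lemma v_subproof : tofrac 'X \in laurent_pred.
Proof. by apply/boolp.asboolP; exists 'X, 0%N; rewrite expr0 divr1. Qed.

Lemma vV_subproof : (tofrac 'X)^-1 \in laurent_pred.
Proof. by apply/boolp.asboolP; exists 1, 1%N; rewrite expr1 tofrac1 div1r. Qed.

Definition v : laurent := Laurent v_subproof.
Definition vV : laurent := Laurent vV_subproof.

Lemma mulvV : v * vV = 1.
Proof.
by apply: val_inj; rewrite rmorphM rmorph1 /= divff // -[tofrac 'X]expr1 fracX_neq0.
Qed.

Definition at_v (q : {poly int}) : laurent := (map_poly intr q).[v].

End Laurent.

Section Coxeter.
Local Open Scope group_scope.

Section System.
Variables (I : finType) (m : I -> I -> nat).

Definition coxeter_relations (G : groupType) (t : I -> G) : Prop :=
  forall i j, (t i * t j) ^+ m i j = 1.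

(* (W, s) is the group presented by the generators I subject to
   (i j)^(m i j) = 1; here all m i j are finite. *)
Definition coxeter_system (W : finGroupType) (s : I -> W) : Prop :=
  [/\ <<[set s i | i : I]>> = [set: W],
      coxeter_relations s
    & forall (G : groupType) (t : I -> G), coxeter_relations t ->
        exists f : {multiplicative W -> G}, forall i, f (s i) = t i].

End System.

Section Combinatorics.
Variables (I : finType) (W : finGroupType) (s : I -> W).

Definition word_prod (t : seq I) : W := \prod_(i <- t) s i.

(* The least k such that w is a product of k simple reflections; when the s i
   generate W, such a k exists below #|W|. *)
Definition length (w : W) : nat :=
  find (fun k => [exists t : k.-tuple I, word_prod t == w]) (iota 0 #|W|).

Definition reduced_exprs (w : W) : {set (length w).-tuple I} :=
  [set t : (length w).-tuple I | word_prod t == w].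

Definition longest : W := [arg max_(w > 1) length w].

Definition left_descents (w : W) : {set I} :=
  [set i | (length (s i * w) < length w)%N].

Definition right_descents (w : W) : {set I} :=
  [set i | (length (w * s i) < length w)%N].

Definition reflection (t : W) : bool := [exists i, exists x, t == s i ^ x].

(* Bruhat order: the reflexive transitive closure of x -> y for y = t x with t
   a reflection and length x < length y. *)
Definition bruhat_le : rel W :=
  connect [rel x y | reflection (y * x^-1) && (length x < length y)%N].

Definition bruhat_lt : rel W := [rel x y | (x != y) && bruhat_le x y].

Definition penultimate_cell : {set W} :=
  [set longest * u | u in [set u : W | (u != 1) && (#|reduced_exprs u| == 1%N)]].

(* For a label i, the elements y of the penultimate cell with
   L(y) = R(y) = S \ {i}. *)
Definition penultimate_H (i : I) : {set W} :=
  [set y in penultimate_cell |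
     (left_descents y == [set~ i]) && (right_descents y == [set~ i])].

End Combinatorics.
End Coxeter.

(* Type B with labels 0, ..., n: the diagram is the path 0 - 1 - ... - n whose
   edge {0, 1} is double. *)
Definition coxeter_B (n : nat) (i j : 'I_n.+1) : nat :=
  if i == j then 1
  else if (i.+1 == j) || (j.+1 == i) then
    if minn i j == 0 then 4 else 3
  else 2.

Section Hecke.
Local Open Scope ring_scope.

(* x * y * x * ... with k factors *)
Definition alternating (A : nzRingType) (x y : A) (k : nat) : A :=
  \prod_(j < k) (if odd j then y else x).

Section Presentation.
Variables (I : finType) (m : I -> I -> nat).

Definition hecke_relations (A : algType laurent) (H : I -> A) : Prop :=
  (forall i j, alternating (H i) (H j) (m i j) = alternating (H j) (H i) (m i j))
  /\ (forall i, (H i + v%:A) * (H i - vV%:A) = 0).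

(* (A, H) is the Z[v, v^-1]-algebra presented by the generators I and
   the relations above. *)
Definition hecke_algebra (A : algType laurent) (H : I -> A) : Prop :=
  hecke_relations H /\
  forall (B : algType laurent) (K : I -> B), hecke_relations K ->
    exists2 f : {lrmorphism A -> B}, (forall i, f (H i) = K i)
      & forall g : {lrmorphism A -> B}, (forall i, g (H i) = K i) -> g =1 f.

End Presentation.

Section KazhdanLusztig.
Variables (I : finType) (W : finGroupType) (s : I -> W).
Variables (A : algType laurent) (H : I -> A).

Definition standard_basis (w : W) : A :=
  if [pick t in reduced_exprs s w] is Some t then \prod_(i <- t) H i else 1.

(* As A is generated over the integers by v, v^-1 and the H i, these conditions
   determine bar. *)
Definition bar_involution (bar : {rmorphism A -> A}) : Prop :=
  [/\ involutive bar,
      forall a : A, bar (v *: a) = vV *: bar a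
    & forall i, bar (H i) * H i = 1 /\ H i * bar (H i) = 1].

Definition kl_element (p : W -> W -> {poly int}) (w : W) : A :=
  standard_basis w +
  \sum_(y | bruhat_lt s y w) at_v (p y w) *: standard_basis y.

(* p y w is an element of Z[v]; the second clause says that it lies in v Z[v]
   for y < w. *)
Definition kl_polynomials (bar : {rmorphism A -> A})
    (p : W -> W -> {poly int}) : Prop :=
  forall w,
  [/\ p w w = 1,
      forall y, bruhat_lt s y w -> (p y w)`_0 = 0,
      forall y, ~~ bruhat_le s y w -> p y w = 0
    & bar (kl_element p w) = kl_element p w].

End KazhdanLusztig.

Section Duflo.
Variables (W : finGroupType) (p : W -> W -> {poly int}).

(* The value a(J) of the a-function on the two-sided cell J. *)
Definition a_value (J : {set W}) (a : nat) : Prop :=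
  (exists2 w, w \in J & (p 1%g w)`_a != 0) /\
  (forall w k, w \in J -> (p 1%g w)`_k != 0 -> (a <= k)%N).

Definition duflo (J : {set W}) (w : W) : Prop :=
  w \in J /\ exists2 a, a_value J a & (p 1%g w)`_a != 0.

End Duflo.
End Hecke.

(* Main.v *)
Require Import Defs.
From HB Require Import structures.
From mathcomp Require Import all_boot all_order all_algebra all_fingroup.
From mathcomp Require Import cyclic.
From mathcomp Require boolp.
From mathcomp Require Import ring zify.

(** Write m = n + 1, N for the length of w0, K_i = H_i + v for the
    Kazhdan-Lusztig element of s_i, and z_u for the coefficient of C_u in the
    expansion of H_w0 on the Kazhdan-Lusztig elements. As w0 is central,
    Kazhdan-Lusztig inversion (kl_inversion) gives
    p_(e, w0 u) = (-1)^(l(u) + N) z_u. So the theorem is about the coefficients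
    of H_w0 at the elements u with a unique reduced word.

    These coefficients form a small closed system: the coefficient of K_i a at
    a unique reduced word is a combination of the coefficients of a at the
    words obtained by deleting or adding a first letter (kapKw), and all words
    that occur are again unique. Let M be the matrix of multiplication by H_w0
    on the Kazhdan-Lusztig elements, with rows and columns restricted to the
    unique words. Since H_w0 commutes with every K_i, an entry of M vanishes
    unless every descent of its column is a descent of its row. Hence the
    column of s_0 has just two entries, a0 at 0 and b0 at 010, and the column of s_1 has the
    entries a1 at 1 and b1 at 101. Three facts determine them.
    - H_w0 is inverse to its bar, so a0 bar(a0) + b0 bar(b0) = 1. The constant
      term of the left side is a sum of squares of integers, so a0 or b0 is 0
      (bar_norm1, ab0); in the same way a1 or b1 is 0.
    - The difference of the coefficients at 0 and 010 transforms under the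
      character H_0 -> v^-1, H_i -> -v for i > 0. So a0 - b0 is
      v^(-l0) (-v)^(N - l0), where l0 is the number of letters 0 in a reduced
      word of w0 (xi_eq).
    - The coefficients of H_w0 along the words k ... 1 0, with z_0 + z_010 at
      the start, satisfy the recursion of the Chebyshev polynomials and vanish
      after k = n (chain_eq). Eliminating them gives
      a0 + b0 - (-v)^N = (-1)^n (v^m + v^-m) z_(n...0) (zeta_eq).
    The letters 0 of a reduced word carry distinct conjugates of s_0, so
    1 <= l0 <= m (count_zero). As z_(n...0) is a polynomial in v and a0 + b0 is
    plus or minus v^(N - 2 l0), a comparison of extreme terms leaves l0 = m and
    fixes the sign (w0_power_eqs). This determines z_0 + z_010 and
    z_0 - z_010 as quotients by v - v^-1 and v + v^-1, which are the geometric
    sums in the statement (kl_sum_eq, kl_diff_eq, closed_forms).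

    For the Duflo element it remains to see that no exponent below N - 2m + 1
    occurs in p_(e, w) for w in the cell. Comparing H_w0 with its bar
    expresses z_u through the products M_(u,x) bar(z_x) (z_bar). All columns
    of M except that of the identity consist of integral multiples of
    v^(N - 2m): this holds for the columns of s_0 and s_1 because a0 + b0 = a1 + b1 is such a multiple and
    one summand is 0, and it propagates along the Coxeter path and along unique
    words (int_column_s, int_column_word). The bars of the z_x, multiplied by
    v^N, lie in v Z[v] (barz_vZ). So z_u lies in v^(N - 2m + 1) Z[v]
    (kapZ_low). The exponent N - 2m + 1 does occur, in just one of the two
    polynomials of the closed formulas, and the parity of n decides in which. *)

Set Implicit Arguments.
Unset Strict Implicit.
Unset Printing Implicit Defensive.
Import GRing.Theory Num.Theory Order.TTheory.

(** * Laurent polynomials in v and their bar involution *)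

Section LaurentTheory.
Local Open Scope ring_scope.

Definition at_vV (q : {poly int}) : laurent := (map_poly intr q).[vV].

Lemma at_v_is_zmod : zmod_morphism at_v.
Proof. by move=> p q; rewrite /at_v rmorphB hornerD hornerN. Qed.
Lemma at_v_is_monoid : monoid_morphism at_v.
Proof. by split=> [|p q]; rewrite /at_v ?rmorph1 ?hornerC ?rmorphM ?hornerM. Qed.
HB.instance Definition _ := GRing.isZmodMorphism.Build _ _ at_v at_v_is_zmod.
HB.instance Definition _ := GRing.isMonoidMorphism.Build _ _ at_v at_v_is_monoid.

Lemma at_vV_is_zmod : zmod_morphism at_vV.
Proof. by move=> p q; rewrite /at_vV rmorphB hornerD hornerN. Qed.
Lemma at_vV_is_monoid : monoid_morphism at_vV.
Proof. by split=> [|p q]; rewrite /at_vV ?rmorph1 ?hornerC ?rmorphM ?hornerM. Qed.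
HB.instance Definition _ := GRing.isZmodMorphism.Build _ _ at_vV at_vV_is_zmod.
HB.instance Definition _ := GRing.isMonoidMorphism.Build _ _ at_vV at_vV_is_monoid.

Lemma at_vX : at_v 'X = v.
Proof. by rewrite /at_v map_polyX hornerX. Qed.
Lemma at_vVX : at_vV 'X = vV.
Proof. by rewrite /at_vV map_polyX hornerX. Qed.
Lemma at_vC c : at_v c%:P = c%:~R.
Proof. by rewrite /at_v map_polyC hornerC. Qed.
Lemma at_vVC c : at_vV c%:P = c%:~R.
Proof. by rewrite /at_vV map_polyC hornerC. Qed.
Lemma at_vXn k : at_v 'X^k = v ^+ k.
Proof. by rewrite rmorphXn /= at_vX. Qed.

Lemma laurent_valD (x y : laurent) :
  laurent_val (x + y) = laurent_val x + laurent_val y.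
Proof. exact: (rmorphD (val : laurent -> _)). Qed.
Lemma laurent_valM (x y : laurent) :
  laurent_val (x * y) = laurent_val x * laurent_val y.
Proof. exact: (rmorphM (val : laurent -> _)). Qed.
Lemma laurent_valX (x : laurent) k : laurent_val (x ^+ k) = laurent_val x ^+ k.
Proof. exact: (rmorphXn (val : laurent -> _)). Qed.
Lemma laurent_valz (n : int) : laurent_val n%:~R = n%:~R.
Proof. exact: (rmorph_int (val : laurent -> _)). Qed.

Lemma at_v_val q : laurent_val (at_v q) = tofrac q.
Proof.
elim/poly_ind: q => [|q c IH]; first by rewrite rmorph0 tofrac0.
have -> : at_v (q * 'X + c%:P) = at_v q * v + c%:~R.
  by rewrite rmorphD rmorphM /= at_vX at_vC.
rewrite laurent_valD laurent_valM laurent_valz IH tofracD tofracM; congr (_ + _).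
by rewrite -[c in RHS]intz !rmorph_int.
Qed.

Lemma at_v_inj : injective at_v.
Proof.
move=> p q /(congr1 laurent_val); rewrite !at_v_val => /eqP.
by rewrite tofrac_eq => /eqP.
Qed.

Lemma v_vV_pow k : v ^+ k * vV ^+ k = 1.
Proof. by rewrite -exprMn mulvV expr1n. Qed.

Lemma vV_v_pow k : vV ^+ k * v ^+ k = 1.
Proof. by rewrite mulrC v_vV_pow. Qed.

Lemma laurent_mulI (x y z : laurent) : x != 0 -> x * y = x * z -> y = z.
Proof.
move=> x0 /(congr1 laurent_val); rewrite !laurent_valM.
have xv : laurent_val x != 0.
  by apply: contra x0 => /eqP x0; apply/eqP; apply: val_inj; rewrite /= x0.
by move/(mulfI xv) => yz; apply: val_inj.
Qed.

Lemma vXn_neq0 k : v ^+ k != 0.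
Proof. by apply/eqP => v0; have := v_vV_pow k; rewrite v0 mul0r => /eqP; rewrite eq_sym oner_eq0. Qed.

(** This makes every computation in Z[v, v^-1] a computation with integer
    polynomials. *)
Lemma laurent_rep (x : laurent) : exists q k, x * v ^+ k = at_v q.
Proof.
case: x => x xP; case/boolp.asboolP: (xP) => p [k def_x].
exists p, k; apply: val_inj; change (laurent_val (Laurent xP * v ^+ k) = laurent_val (at_v p)).
rewrite at_v_val laurent_valM laurent_valX /= def_x.
by rewrite divfK // fracX_neq0.
Qed.

Definition barL_rep (x : laurent) : {qk : {poly int} * nat | x * v ^+ qk.2 = at_v qk.1}.
Proof.
by apply: boolp.cid; have [q [k xk]] := laurent_rep x; exists (q, k).
Qed.

(** The bar involution of Z[v, v^-1] on scalars, read off a chosen numerator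
    and exponent; barLE says that every other choice gives the same value. *)
Definition barL (x : laurent) : laurent :=
  let qk := sval (barL_rep x) in at_vV qk.1 * v ^+ qk.2.

Lemma barLE x q k : x * v ^+ k = at_v q -> barL x = at_vV q * v ^+ k.
Proof.
rewrite /barL; case: barL_rep => -[q' k'] /= xk' xk.
have eqq : q' * 'X^k = q * 'X^k'.
  apply: at_v_inj; rewrite !rmorphM /= !at_vXn -xk -xk'.
  by rewrite -!mulrA [v ^+ k' * _]mulrC.
have /(congr1 at_vV) := eqq; rewrite !rmorphM /= !rmorphXn /= at_vVX => e.
apply: (@laurent_mulI (vV ^+ k * vV ^+ k')).
  apply/eqP => z; have := v_vV_pow (k + k'); rewrite [vV ^+ _]exprD z mulr0.
  by move/eqP; rewrite eq_sym oner_eq0.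
transitivity (at_vV q' * vV ^+ k * (v ^+ k' * vV ^+ k')); first by ring.
rewrite e v_vV_pow -(v_vV_pow k); ring.
Qed.

Lemma barL_at q : barL (at_v q) = at_vV q.
Proof. by rewrite (@barLE _ q 0) ?expr0 ?mulr1. Qed.

Lemma barL_is_zmod : zmod_morphism barL.
Proof.
move=> x y; have [q [k xk]] := laurent_rep x; have [r [l yl]] := laurent_rep y.
rewrite (barLE xk) (barLE yl) (@barLE _ (q * 'X^l - r * 'X^k) (k + l)).
  rewrite rmorphB !rmorphM /= !rmorphXn /= at_vVX exprD.
  transitivity (at_vV q * v ^+ k * (vV ^+ l * v ^+ l)
     - at_vV r * v ^+ l * (vV ^+ k * v ^+ k)); first by ring.
  by rewrite !vV_v_pow !mulr1.
by rewrite rmorphB !rmorphM /= !at_vXn -xk -yl exprD; ring.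
Qed.

Lemma barL_is_monoid : monoid_morphism barL.
Proof.
split; first by have := barL_at 1; rewrite !rmorph1.
move=> x y; have [q [k xk]] := laurent_rep x; have [r [l yl]] := laurent_rep y.
rewrite (barLE xk) (barLE yl) (@barLE _ (q * r) (k + l)).
  by rewrite rmorphM /= exprD; ring.
by rewrite rmorphM /= -xk -yl exprD; ring.
Qed.

HB.instance Definition _ := GRing.isZmodMorphism.Build _ _ barL barL_is_zmod.
HB.instance Definition _ := GRing.isMonoidMorphism.Build _ _ barL barL_is_monoid.

Lemma barL_v : barL v = vV.
Proof. by rewrite -at_vX barL_at at_vVX. Qed.

Lemma barL_vV : barL vV = v.
Proof.
rewrite (@barLE vV 1 1) ?rmorph1 ?mul1r ?expr1 //.
by rewrite mulrC mulvV.
Qed.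

Definition rev_poly d (q : {poly int}) := \poly_(i < d.+1) q`_(d - i).

(** Up to a power of v, bar reverses the list of coefficients of a
    polynomial. *)
Lemma at_vV_rev d (q : {poly int}) : (size q <= d.+1)%N -> at_vV q * v ^+ d = at_v (rev_poly d q).
Proof.
move=> sq; rewrite /rev_poly poly_def rmorph_sum /= (reindex_inj rev_ord_inj) /=.
have -> : q = \sum_(i < d.+1) q`_i *: 'X^i.
  rewrite -[LHS]coefK poly_def (big_ord_widen d.+1 (fun i => q`_i *: 'X^i)) //.
  rewrite [in RHS](bigID (fun i : 'I_d.+1 => (i < size q)%N)) /=.
  rewrite [X in _ = _ + X]big1 ?addr0 // => i.
  by rewrite -leqNgt => ?; rewrite nth_default // scale0r.
rewrite rmorph_sum mulr_suml /=; apply: eq_bigr => i _.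
rewrite subSS subKn -1?ltnS // -!mul_polyC !rmorphM /= !rmorphXn /= at_vX at_vVX.
rewrite at_vC at_vVC.
have /eqP -> : (\sum_(i0 < d.+1) q`_i0 *: 'X^i0)`_i == q`_i.
  by rewrite -poly_def coef_poly ltn_ord.
rewrite -mulrA; congr (_ * _).
have -> : v ^+ d = v ^+ (d - i) * v ^+ i by rewrite -exprD subnK // -ltnS.
by rewrite mulrCA vV_v_pow mulr1.
Qed.

Definition vZ (x : laurent) := exists2 q : {poly int}, q`_0 = 0 & x = at_v q.

(** All exponents of x are positive and all exponents of its bar are
    negative. *)
Lemma vZ_bar x : vZ x -> barL x = x -> x = 0.
Proof.
case=> q q0 ->; rewrite barL_at => e.
have eq : rev_poly (size q) q = q * 'X^(size q).
  by apply: at_v_inj; rewrite rmorphM /= at_vXn -e at_vV_rev.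
suff -> : q = 0 by rewrite rmorph0.
apply/polyP=> i; rewrite coef0; case: (posnP i) => [->//|i0].
have := congr1 (fun r : {poly int} => r`_(i + size q)) eq.
rewrite coefMXn ltnNge leq_addl /= addnK => <-.
by rewrite coef_poly ltnS -{2}[size q]add0n leq_add2r leqNgt i0.
Qed.

(** The constant term of x times its bar is the sum of the squares of the
    coefficients of x. Two such sums of squares with total 1 leave room for a
    single nonzero coefficient. *)
Lemma bar_norm1 x y : x * barL x + y * barL y = 1 -> x = 0 \/ y = 0.
Proof.
have [q [k xk]] := laurent_rep x; have [r [l yl]] := laurent_rep y.
have N0 z p j : z * v ^+ j = at_v p -> z * barL z = at_v p * at_vV p.
  move=> zj; rewrite (barLE zj) -zj; ring.
rewrite (N0 _ _ _ xk) (N0 _ _ _ yl) => /(congr1 (fun t => t * v ^+ (maxn (size q) (size r)))).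
set d := maxn _ _; have sq : (size q <= d.+1)%N by rewrite ltnW // ltnS leq_maxl.
have sr : (size r <= d.+1)%N by rewrite ltnW // ltnS leq_maxr.
rewrite mulrDl -!mulrA !at_vV_rev // -!rmorphM -rmorphD mul1r -at_vXn => /at_v_inj e.
(* after multiplication by v ^+ d, the constant term is the coefficient of
   degree d *)
have : (q * rev_poly d q + r * rev_poly d r)`_d = \sum_(i < d.+1) (q`_i ^+ 2 + r`_i ^+ 2).
  rewrite coefD !coefM -big_split; apply: eq_bigr => i _ /=.
  by rewrite !coef_poly !ltnS leq_subr subKn -1?ltnS // !expr2.
rewrite e coefXn eqxx mulr1n => S1.
have nz (p : {poly int}) (P : p != 0) : (size p <= d)%N -> exists2 i : 'I_d.+1, p`_i != 0 & true.
  move=> sp; have ltp : ((size p).-1 < d.+1)%N by rewrite ltnS (leq_trans (leq_pred _)).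
  by exists (Ordinal ltp); rewrite //= -lead_coefE lead_coef_eq0.
have sq1 (c : int) : c != 0 -> 1 <= c ^+ 2 by nia.
have v0 z p j : z * v ^+ j = at_v p -> p = 0 -> z = 0.
  move=> zj p0; apply: (@laurent_mulI (v ^+ j)); first exact: vXn_neq0.
  by rewrite mulrC zj p0 rmorph0 mulr0.
have [/(v0 _ _ _ xk)|q0] := eqVneq q 0; first by left.
have [/(v0 _ _ _ yl)|r0] := eqVneq r 0; first by right.
have [i qi _] := nz q q0 (leq_maxl _ _); have [j rj _] := nz r r0 (leq_maxr _ _).
exfalso; suff : 1 + 1 <= 1 :> int by [].
rewrite [leRHS]S1 big_split /= lerD //.
  rewrite (bigD1 i) //= -[leLHS]addr0 lerD ?sq1 //.
  by apply: sumr_ge0 => ? _; rewrite sqr_ge0.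
rewrite (bigD1 j) //= -[leLHS]addr0 lerD ?sq1 //.
by apply: sumr_ge0 => ? _; rewrite sqr_ge0.
Qed.

Lemma vZ0 : vZ 0. Proof. by exists 0; rewrite ?coef0 ?rmorph0. Qed.
Lemma vZD x y : vZ x -> vZ y -> vZ (x + y).
Proof. by case=> q q0 -> [r r0 ->]; exists (q + r); rewrite ?coefD ?q0 ?r0 ?rmorphD. Qed.
Lemma vZB x y : vZ x -> vZ y -> vZ (x - y).
Proof. by case=> q q0 -> [r r0 ->]; exists (q - r); rewrite ?coefB ?q0 ?r0 ?rmorphB. Qed.
Lemma vZM x q : vZ x -> vZ (x * at_v q).
Proof. by case=> r r0 ->; exists (r * q); rewrite ?coef0M ?r0 ?mul0r ?rmorphM. Qed.
Lemma vZ_v : vZ v. Proof. by exists 'X; rewrite ?coefX ?at_vX. Qed.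
Lemma vZ_sum (J : finType) (P : pred J) (F : J -> laurent) :
  (forall i, P i -> vZ (F i)) -> vZ (\sum_(i | P i) F i).
Proof. by move=> H; elim/big_ind: _ => //; [exact: vZ0 | exact: vZD]. Qed.

Lemma two_neq0 : (v + vV) != 0.
Proof.
apply/eqP => /(congr1 (fun t => t * v)); rewrite mul0r mulrDl [vV * _]mulrC mulvV.
rewrite -at_vX -[1](rmorph1 at_v) -rmorphM -rmorphD -[0](rmorph0 at_v) => /at_v_inj.
by move/(congr1 (fun q : {poly int} => q`_0)); rewrite coefD coefMX !coefC.
Qed.

End LaurentTheory.

(** * Words, reflections and the exchange condition *)

Section CoxeterTheory.
Local Open Scope group_scope.
Variables (I : finType) (m : I -> I -> nat) (W : finGroupType) (s : I -> W).
Hypothesis hW : coxeter_system m s.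
Hypothesis m_diag : forall i, m i i = 1%N.

Local Notation len := (length s).
Local Notation wp := (word_prod s).

Lemma s_sqr i : s i * s i = 1.
Proof. by case: hW => _ h _; have := h i i; rewrite m_diag expg1. Qed.

Lemma s_inv i : (s i)^-1 = s i.
Proof. by apply/eqP; rewrite eq_invg_mul s_sqr. Qed.

Lemma s_conj i : s i ^ s i = s i.
Proof. by rewrite conjgE mulgA mulVg mul1g. Qed.

Lemma mulKs i w : s i * (s i * w) = w.
Proof. by rewrite mulgA s_sqr mul1g. Qed.

Lemma mulsK i w : w * s i * s i = w.
Proof. by rewrite -mulgA s_sqr mulg1. Qed.

Lemma wp_nil : wp [::] = 1.
Proof. by rewrite /word_prod big_nil. Qed.
Lemma wp_cons i t : wp (i :: t) = s i * wp t.
Proof. by rewrite /word_prod big_cons. Qed.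
Lemma wp_cat t u : wp (t ++ u) = wp t * wp u.
Proof. by rewrite /word_prod big_cat. Qed.
Lemma wp_rcons t i : wp (rcons t i) = wp t * s i.
Proof. by rewrite -cats1 wp_cat wp_cons wp_nil mulg1. Qed.
Lemma wp1 i : wp [:: i] = s i.
Proof. by rewrite wp_cons wp_nil mulg1. Qed.
Lemma wp_rev t : wp (rev t) = (wp t)^-1.
Proof.
by elim: t => [|i t IH]; rewrite ?wp_nil ?invg1 // rev_cons wp_rcons wp_cons invMg IH s_inv.
Qed.

Lemma ex_word w : exists t, wp t = w.
Proof.
have [gen _ _] := hW; have : w \in <<[set s i | i : I]>> by rewrite gen inE.
case/gen_prodgP => k [c hc ->].
elim: k c hc => [|k IH] c hc; first by exists [::]; rewrite wp_nil big_ord0.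
rewrite big_ord_recl.
have [t ht] := IH (fun i => c (lift ord0 i)) (fun i => hc (lift ord0 i)).
have /imsetP[i _ ci] := hc ord0; exists (i :: t).
by rewrite wp_cons ht ci.
Qed.

(** A word of length at least the order of W has two equal prefixes, and the
    letters between them can be cut out. So the bounded search in the
    definition of length succeeds. *)
Lemma wp_short t : exists t', [/\ wp t' = wp t, (size t' <= size t)%N & (size t' < #|W|)%N].
Proof.
have [k] := ubnP (size t); elim: k t => // k IH t; rewrite ltnS => refl0.
have [lt|ge] := ltnP (size t) #|W|; first by exists t.
have : ~~ injectiveb (fun i : 'I_(size t).+1 => wp (take i t)).
  by apply/injectiveP => /leq_card; rewrite card_ord ltnNge ge.
case/injectivePn => i [j ij eij].
wlog ltij : i j ij eij / (i < j)%N.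
  move=> H; have [|?|] := ltngtP i j; first exact: H ij eij.
    by apply: (H j i) => //; rewrite eq_sym.
  by move/val_inj => e; rewrite e eqxx in ij.
have := ltn_ord j; rewrite ltnS => jt.
have [|t' [e1 e2 e3]] := IH (take i t ++ drop j t).
  rewrite size_cat size_takel ?size_drop; lia.
exists t'; split=> //; last first.
  apply: leq_trans e2 _; rewrite size_cat size_takel ?size_drop; lia.
by rewrite e1 wp_cat eij -wp_cat cat_take_drop.
Qed.

Lemma length_lt w : (len w < #|W|)%N.
Proof.
have [t ht] := ex_word w; have [t' [e1 _ e3]] := wp_short t.
rewrite /length; set p := fun k => _.
have hp : has p (iota 0 #|W|).
  apply/hasP; exists (size t'); first by rewrite mem_iota.
  by apply/existsP; exists (in_tuple t'); rewrite /= e1 ht.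
by move: hp; rewrite has_find size_iota.
Qed.

Lemma ex_reduced w : exists2 t, wp t = w & size t = len w.
Proof.
have h := length_lt w; have : has (fun k => [exists t : k.-tuple I, wp t == w]) (iota 0 #|W|).
  by rewrite has_find size_iota.
move/(nth_find 0); rewrite -/(length s w) nth_iota // add0n.
by case/existsP => t /eqP ht; exists t => //; rewrite size_tuple.
Qed.

Lemma length_min t : (len (wp t) <= size t)%N.
Proof.
have [t' [e1 e2 e3]] := wp_short t; apply: leq_trans e2.
rewrite leqNgt; apply/negP => lt.
have := @before_find _ 0%N (fun k => [exists u : k.-tuple I, wp u == wp t]) (iota 0 #|W|) (size t') lt.
rewrite nth_iota // add0n => /existsP; apply.
by exists (in_tuple t'); rewrite /= e1.
Qed.

Lemma length1 : len 1 = 0%N.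
Proof. by apply/eqP; rewrite -leqn0 -wp_nil length_min. Qed.

Lemma length0 w : len w = 0%N -> w = 1.
Proof. by have [t <- <-] := ex_reduced w; case: t => // _; rewrite wp_nil. Qed.

Lemma length_inv w : len w^-1 = len w.
Proof.
have h x : (len x^-1 <= len x)%N.
  by have [t <- <-] := ex_reduced x; rewrite -wp_rev -(size_rev t) length_min.
by apply/eqP; rewrite eqn_leq h -{1}[w]invgK h.
Qed.

Lemma length_sle i w : (len (s i * w) <= (len w).+1)%N.
Proof. by have [t <- <-] := ex_reduced w; rewrite -wp_cons (length_min (i :: t)). Qed.

(** The action of a simple reflection by conjugation, with a sign that changes
    exactly at s i. Its extension to W records the inversions of an
    element. *)
Definition refl_fun i (xb : W * bool) := (xb.1 ^ s i, xb.2 (+) (xb.1 == s i)).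

Lemma refl_funK i : involutive (refl_fun i).
Proof.
case=> x b; rewrite /refl_fun /= -conjgM s_sqr conjg1; congr (_, _).
have -> : (x ^ s i == s i) = (x == s i).
  by rewrite -{2}(s_conj i) (inj_eq (conjg_inj (s i))).
rewrite -addbA.
by rewrite addbb addbF.
Qed.

Definition refl_perm i : {perm W * bool} := perm (can_inj (refl_funK i)).

(** The sign counts how often x occurs in the list of the 2k reflections (s i
    * s j) ^+ l * s i of the dihedral group. *)
Lemma refl_permM i j k x b :
  ((refl_perm i * refl_perm j) ^+ k) (x, b) =
  (x ^ ((s i * s j) ^+ k),
   b (+) odd (\sum_(l < 2 * k) (x == ((s i * s j) ^+ l * s i)%g))).
Proof.
set u := s i * s j.
elim: k x b => [|k IH] x b; first by rewrite muln0 big_ord0 addbF expg0 perm1 conjg1.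
rewrite expgSr permM IH permM !permE /refl_fun /= -!conjgM expgSr. congr (_, _).
rewrite mulnS addnC addn2 !big_ord_recr /= -!addbA; congr (_ (+) _).
rewrite !oddD -!addbA; congr (_ (+) _).
have uV : u^-1 = s j * s i by rewrite invMg !s_inv.
have usi : s i * u = u^-1 * s i by rewrite uV /u mulgA s_sqr mul1g mulsK.
have us l : s i * u ^+ l = u ^- l * s i.
  elim: l => [|l IHl]; first by rewrite expg0 invg1 mulg1 mul1g.
  by rewrite expgSr mulgA IHl -mulgA usi mulgA -invMg -expgS expgSr.
have usV l : s i * u ^- l = u ^+ l * s i.
  by rewrite -[u ^- l](mulsK i) -us !mulgA s_sqr mul1g.
have c1 (a b' c : W) : (a ^ b' == c) = (a == b' * c * b'^-1).
  by rewrite -(inj_eq (conjg_inj b'^-1)) conjgK conjgE invgK mulgA.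
have e1 : u ^+ k * s i * u ^- k = u ^+ (2 * k) * s i.
  rewrite mul2n -addnn expgD -!mulgA; congr (_ * _).
  exact: usV.
have e2 : u ^+ k * s i * s j * (u ^+ k * s i)^-1 = u ^+ (2 * k).+1 * s i.
  rewrite invMg s_inv mul2n -addnn -addSn expgD expgSr -!mulgA; congr (_ * _).
  by rewrite usV mulgA.
by rewrite !c1 ?oddb e1 e2.
Qed.

(** For k = m i j the list of 2k reflections runs twice through the same k
    reflections, so each sign is changed an even number of times. *)
Lemma refl_perm_rel : coxeter_relations m refl_perm.
Proof.
move=> i j; apply/permP => -[x b]; rewrite refl_permM perm1.
have [_ hr _] := hW; rewrite hr conjg1; congr (_, _).
rewrite mul2n -addnn big_split_ord /=.
under [X in (_ + X)%N]eq_bigr do rewrite expgD hr mul1g.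
by rewrite oddD addbb addbF.
Qed.

(** The signed action satisfies the Coxeter relations, hence extends to W; the
    cocycle is its sign part. *)
Lemma ex_cocycle : exists inversion : W -> W -> bool,
  (forall x, inversion 1 x = false) /\
  (forall i w x, inversion (s i * w) x = (x == s i) (+) inversion w (x ^ s i)).
Proof.
have [_ _ /(_ _ _ refl_perm_rel)[f hf]] := hW.
have f1 : f 1 = 1 by apply: (mulgI (f 1)); rewrite -gmulfM !mulg1.
have fE w x b : f w (x, b) = (x ^ w, b (+) (f w (x, false)).2).
  have [t <-] := ex_word w; elim: t x b => [|i t IH] x b.
    by rewrite wp_nil f1 !perm1 conjg1 addbF.
  rewrite wp_cons gmulfM !permM hf !permE /refl_fun /= IH (IH _ (x == s i)) /=.
  by rewrite conjgM addbA.
exists (fun w x => (f w (x, false)).2); split=> [x|i w x].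
  by rewrite f1 perm1.
by rewrite gmulfM permM hf permE /refl_fun /= fE /=.
Qed.

(** For a reflection x, the parity of the number of occurrences of x in the
    reflection sequence of any word of w. It does not depend on the word
    because it comes from an action of W. *)
Definition inversion : W -> W -> bool := sval (boolp.cid ex_cocycle).

Lemma inversion1 x : inversion 1 x = false.
Proof. by rewrite /inversion; case: boolp.cid => ? []. Qed.
Lemma inversion_cons i w x : inversion (s i * w) x = (x == s i) (+) inversion w (x ^ s i).
Proof. by rewrite /inversion; case: boolp.cid => ? []. Qed.

Lemma inversionM w w' x : inversion (w * w') x = inversion w x (+) inversion w' (x ^ w).
Proof.
have [t <-] := ex_word w; elim: t x => [|i t IH] x.
  by rewrite wp_nil mul1g inversion1 conjg1.
by rewrite wp_cons -mulgA !inversion_cons IH conjgM addbA.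
Qed.

(** The reflections s_1 ... s_(k-1) s_k s_(k-1) ... s_1 attached to the
    letters of a word. *)
Fixpoint refl_seq t := if t is i :: t' then s i :: [seq r ^ s i | r <- refl_seq t'] else [::].

Lemma size_refl_seq t : size (refl_seq t) = size t.
Proof. by elim: t => //= i t IH; rewrite size_map IH. Qed.

Lemma inversion_count t x : inversion (wp t) x = odd (count_mem x (refl_seq t)).
Proof.
elim: t x => [|i t IH] x; first by rewrite wp_nil inversion1.
rewrite wp_cons inversion_cons IH /= oddD oddb count_map eq_sym; congr (_ (+) odd _).
apply: eq_count => r /=.
by rewrite -(inj_eq (conjg_inj (s i))) -conjgM s_sqr conjg1.
Qed.

(** Multiplication by the reflection attached to a letter deletes this
    letter. *)
Lemma refl_seq_del t r : r \in refl_seq t ->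
  exists t1 i t2, t = t1 ++ i :: t2 /\ r * wp t = wp (t1 ++ t2).
Proof.
elim: t r => [|i t IH] r //=; rewrite inE => /orP[/eqP->|].
  by exists [::], i, t; rewrite wp_cons mulKs.
case/mapP => r' r't ->; have [t1 [j [t2 [-> e]]]] := IH _ r't.
exists (i :: t1), j, t2; split=> //; rewrite !wp_cons -e conjgE s_inv.
by rewrite -!mulgA mulKs.
Qed.

(** If two letters had the same reflection, multiplying twice by it would
    delete both letters and leave the element unchanged. *)
Lemma refl_seq_uniq t : len (wp t) = size t -> uniq (refl_seq t).
Proof.
elim: t => [|i t IH] //= e; have le := length_min t.
have lt := length_sle i (wp t).
have et : len (wp t) = size t by move: lt; rewrite -wp_cons e /=; lia.
rewrite (map_inj_uniq (conjg_inj _)) IH // andbT; apply/mapP => -[r rt er].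
have : s i \in refl_seq t.
  by rewrite -[s i](s_conj i) {1}er -conjgM s_sqr conjg1.
case/refl_seq_del => t1 [j [t2 [et2 e2]]].
have := length_min (t1 ++ t2); rewrite -e2 -wp_cons e et2 !size_cat /=; lia.
Qed.

Lemma inversion_mem t x : len (wp t) = size t -> inversion (wp t) x = (x \in refl_seq t).
Proof.
by move=> e; rewrite inversion_count count_uniq_mem ?refl_seq_uniq // oddb.
Qed.

(** An inversion occurs in the reflection sequence of a reduced word, so
    multiplication by it deletes a letter. *)
Lemma strong_exchange w r : inversion w r -> (len (r * w) < len w)%N.
Proof.
have [t <- st] := ex_reduced w; rewrite inversion_mem // => /refl_seq_del[t1 [i [t2 [e e2]]]].
rewrite e2; apply: leq_ltn_trans (length_min _) _.
by rewrite -st e !size_cat /=; lia.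
Qed.

Definition left_descent i w := (len (s i * w) < len w)%N.
Local Notation ldesc := left_descent.

Lemma ldescE i w : ldesc i w = inversion w (s i).
Proof.
rewrite /ldesc; case e: (inversion w (s i)); first by rewrite strong_exchange.
have : inversion (s i * w) (s i) by rewrite inversion_cons eqxx s_conj e.
move/strong_exchange; rewrite mulKs; lia.
Qed.

Lemma ldesc_s i w : ldesc i (s i * w) = ~~ ldesc i w.
Proof. by rewrite !ldescE inversion_cons eqxx s_conj. Qed.

Lemma length_up i w : ~~ ldesc i w -> len (s i * w) = (len w).+1.
Proof.
rewrite -ldesc_s /ldesc mulKs => h; have := length_sle i w; lia.
Qed.

Lemma length_down i w : ldesc i w -> len w = (len (s i * w)).+1.
Proof.
by rewrite -{1}[w](mulKs i) ldesc_s => /length_up; rewrite mulKs.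
Qed.

(** The parity of inversions detects a letter to delete in an arbitrary word,
    reduced or not. *)
Lemma exchange i t : ldesc i (wp t) ->
  exists t1 j t2, t = t1 ++ j :: t2 /\ s i * wp t = wp (t1 ++ t2).
Proof.
rewrite ldescE inversion_count => h; apply: refl_seq_del.
by rewrite -has_pred1 has_count; case: (count _ _) h.
Qed.

Definition right_descent i w := (len (w * s i) < len w)%N.
Local Notation rdesc := right_descent.

Lemma rdescE i w : rdesc i w = ldesc i w^-1.
Proof. by rewrite /rdesc /ldesc length_inv -length_inv invMg s_inv. Qed.

(** The exchange condition for a reduced word of w followed by j: a letter
    deleted inside w would make i a descent of w, so the deleted letter is
    j. *)
Lemma folding i j w : ~~ ldesc i w -> ldesc i (w * s j) -> s i * w = w * s j.
Proof.
have [t <- st] := ex_reduced w; rewrite -wp_rcons => nd.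
case/exchange => t1 [k [t2]]; case/lastP: t2 => [|t2 k'].
  rewrite cats1 cats0 => -[/rcons_inj[-> ->]] e.
  by rewrite -e mulKs.
rewrite -rcons_cons -!rcons_cat => -[/rcons_inj[et ->]] e.
case/negP: nd; rewrite /ldesc; move: e; rewrite !wp_rcons mulgA => /mulIg ->.
by apply: leq_ltn_trans (length_min _) _; rewrite -st et !size_cat /=; lia.
Qed.

(** The reflection sequence of a reduced word of the same element lists the
    same inversions, so both sequences have the same size. *)
Lemma size_red_uniq t : uniq (refl_seq t) -> len (wp t) = size t.
Proof.
move=> ut; have [t' et st] := ex_reduced (wp t).
rewrite -st -!size_refl_seq; apply: perm_size; apply: uniq_perm => //.
  by apply: refl_seq_uniq; rewrite et st.
by move=> x; rewrite -inversion_mem et ?st // inversion_count count_uniq_mem // oddb.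
Qed.

Lemma ldesc1 i : ldesc i 1 = false.
Proof. by rewrite ldescE inversion1. Qed.

Lemma ex_ldesc w : w != 1 -> exists i, ldesc i w.
Proof.
have [[|i t] <- st] := ex_reduced w; first by rewrite wp_nil eqxx.
move=> _; exists i; rewrite /ldesc -st wp_cons mulKs; exact: length_min.
Qed.

Lemma length_s i : len (s i) = 1%N.
Proof. by have := @length_up i 1; rewrite mulg1 length1; apply; rewrite ldesc1. Qed.

(** * Alternating words and the theorem of Matsumoto *)

Fixpoint alt_word (i j : I) k := if k is k'.+1 then i :: alt_word j i k' else [::].

Lemma size_alt_word i j k : size (alt_word i j k) = k.
Proof. by elim: k i j => //= k IH i j; rewrite IH. Qed.

Hypothesis ord_st : forall i j, #[s i * s j] = m i j.

Lemma coxeter_m_sym i j : m i j = m j i.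
Proof. by rewrite -!ord_st -orderV invMg !s_inv. Qed.

Lemma refl_seq_alt i j k : refl_seq (alt_word i j k) = [seq (s i * s j) ^+ l * s i | l <- iota 0 k].
Proof.
elim: k i j => //= k IH i j; rewrite expg0 mul1g; congr (_ :: _).
have e l : s i * ((s j * s i) ^+ l * s j) = (s i * s j) ^+ l.+1.
  elim: l => [|l IHl]; first by rewrite expg0 mul1g expg1.
  by rewrite expgS -!mulgA IHl mulgA -expgS.
rewrite IH -map_comp (iotaDl 1 0) -map_comp; apply: eq_map => l /=.
by rewrite add1n conjgE s_inv !mulgA -(mulgA (s i)) e.
Qed.

(** The reflections of the word are (s i * s j) ^+ l * s i with l < k,
    distinct because s i * s j has order m i j. *)
Lemma alt_reduced i j k : (k <= m i j)%N -> len (wp (alt_word i j k)) = k.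
Proof.
move=> km; rewrite size_red_uniq ?size_alt_word // refl_seq_alt.
rewrite map_inj_in_uniq ?iota_uniq // => a b; rewrite !mem_iota add0n => /= ak bk.
move/mulIg/eqP; rewrite eq_expg_mod_order ord_st !modn_small; last 2 first.
- exact: leq_trans km.
- exact: leq_trans km.
by move/eqP.
Qed.

Lemma wp_alt_even i j k : wp (alt_word i j k.*2) = (s i * s j) ^+ k.
Proof.
by elim: k => [|k IH]; rewrite ?wp_nil // doubleS /= !wp_cons IH mulgA expgS.
Qed.

Lemma alt_add i j k l :
  alt_word i j (k + l) = alt_word i j k ++ (if odd k then alt_word j i l else alt_word i j l).
Proof. by elim: k i j => //= k IH i j; rewrite IH; case: odd. Qed.

Lemma alt_rcons i j k : alt_word i j k.+1 = rcons (alt_word i j k) (if odd k then j else i).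
Proof. by rewrite -addn1 alt_add /= -cats1; case: odd. Qed.

(** The parity of k decides which of the two letters comes last. *)
Lemma rev_alt_word i j k : rev (alt_word i j k) = if odd k then alt_word i j k else alt_word j i k.
Proof.
elim: k i j => //= k IH i j; rewrite rev_cons IH.
by case o: (odd k); [have := alt_rcons j i k | have := alt_rcons i j k]; rewrite o => <-.
Qed.

(** The braid relation: one alternating word followed by the reverse of the
    other is (s i * s j) ^+ m i j. *)
Lemma wp_alt_braid i j : wp (alt_word i j (m i j)) = wp (alt_word j i (m i j)).
Proof.
have: wp (alt_word i j (m i j + m i j)) = 1.
  by rewrite addnn wp_alt_even -ord_st expg_order.
rewrite alt_add wp_cat.
have -> : (if odd (m i j) then alt_word j i (m i j) else alt_word i j (m i j)) = rev (alt_word j i (m i j)).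
  by rewrite rev_alt_word.
by rewrite wp_rev => /eqP; rewrite -eq_mulgV1 => /eqP.
Qed.

(** Induction on k. Prefix i to a reduced word of x starting with the
    alternating word of length k - 1 that begins with j, and exchange. A
    letter deleted after this prefix gives the longer prefix. A letter deleted
    inside it would shorten an alternating word of length at most m i j, which
    is reduced. *)
Lemma dihedral i j x k : i != j -> ldesc i x -> ldesc j x -> (k <= m i j)%N ->
  exists y, x = wp (alt_word i j k) * y /\ len x = (k + len y)%N.
Proof.
elim: k i j => [|k IH] i j ij dix djx km; first by exists x; rewrite wp_nil mul1g.
have [||y [ex lx]] := IH j i _ djx dix; rewrite 1?eq_sym // 1?coxeter_m_sym 1?ltnW //.
have [t ty st] := ex_reduced y.
have : ldesc i (wp (alt_word j i k ++ t)) by rewrite wp_cat ty -ex.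
case/exchange => t1 [h [t2 [et e]]].
have [lt|ge] := ltnP (size t1) k; last first.
  have e1 : t1 = alt_word j i k ++ drop k t1.
    have := congr1 (take k) et; rewrite take_size_cat ?size_alt_word // takel_cat // => ->.
    by rewrite cat_take_drop.
  move: et e; rewrite e1 -catA => /eqP; rewrite eqseq_cat // eqxx /= => /eqP et.
  rewrite wp_cat ty -ex -catA wp_cat; set y' := wp (drop k t1 ++ t2) => e.
  have exy : x = wp (alt_word i j k.+1) * y' by rewrite /= wp_cons -mulgA -e mulKs.
  exists y'; split=> //; apply/eqP; rewrite eqn_leq; apply/andP; split.
    rewrite {1}exy; have [t' <- <-] := ex_reduced y'; rewrite -wp_cat.
    by apply: leq_trans (length_min _) _; rewrite size_cat size_alt_word.
  rewrite lx addSnnS leq_add2l -st et; apply: leq_ltn_trans (length_min _) _.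
  by rewrite !size_cat /=; lia.
have : (len (wp (alt_word i j k.+1)) <= k.-1)%N.
  have e1 : alt_word j i k = t1 ++ h :: take (k - (size t1).+1) t2.
    have := congr1 (take k) et; rewrite take_size_cat ?size_alt_word // => ->.
    rewrite take_cat ltnNge ltnW //=; congr (_ ++ _).
    by rewrite -(prednK (_ : 0 < k - size t1)%N) ?subn_gt0 //= subnS.
  have e2 : t2 = take (k - (size t1).+1) t2 ++ t.
    move: et; rewrite e1 -catA /= => /eqP; rewrite eqseq_cat // eqxx /=.
    by move=> /eqP [] ->.
  have /mulIg e4 : s i * wp (alt_word j i k) * wp t = wp (t1 ++ take (k - (size t1).+1) t2) * wp t.
    by rewrite -mulgA -!wp_cat -catA -e2.
  rewrite /= wp_cons e4; apply: leq_trans (length_min _) _.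
  have := congr1 size e1; rewrite size_alt_word !size_cat /=; lia.
by rewrite alt_reduced //; lia.
Qed.

Lemma alt_alternating (A : nzRingType) (h : I -> A) i j k :
  (\prod_(c <- alt_word i j k) h c = alternating (h i) (h j) k)%R.
Proof.
elim: k i j => [|k IH] i j; first by rewrite big_nil /alternating big_ord0.
rewrite /= big_cons IH /alternating big_ord_recl; congr (_ * _)%R.
by apply: eq_bigr => l _ /=; case: odd.
Qed.

(** Let x have reduced words with first letters i and j. Words with equal
    first letters are settled by induction on the length; otherwise i and j
    are left descents of x, so x has reduced words beginning with either
    alternating word of length m i j. These two words differ by one braid
    relation, and each shares its first letter with one of the given
    words. *)
Lemma matsumoto (A : nzRingType) (h : I -> A) :
  (forall i j, alternating (h i) (h j) (m i j) = alternating (h j) (h i) (m i j)) ->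
  forall t t', len (wp t) = size t -> len (wp t') = size t' -> wp t = wp t' ->
  (\prod_(c <- t) h c = \prod_(c <- t') h c)%R.
Proof.
move=> br.
move=> t; have [k] := ubnP (size t); elim: k t => // k IH [|i t] st t' rt rt' e.
  by move: rt'; rewrite -e rt; case: t' {e}.
have tl i0 t0 : len (wp (i0 :: t0)) = size (i0 :: t0) -> len (wp t0) = size t0.
  have := length_min t0; have := length_sle i0 (wp t0); rewrite wp_cons /=; lia.
have same i0 t0 t0' : (size t0 < k)%N -> len (wp (i0 :: t0)) = size (i0 :: t0) ->
   len (wp (i0 :: t0')) = size (i0 :: t0') -> wp (i0 :: t0) = wp (i0 :: t0') ->
   (\prod_(c <- i0 :: t0) h c = \prod_(c <- i0 :: t0') h c)%R.
  move=> lt0 r0 r0' e0; rewrite !big_cons; congr (_ * _)%R; apply: IH => //.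
  - exact: tl r0.
  - exact: tl r0'.
  by move: e0; rewrite !wp_cons => /mulgI.
case: t' rt' e => [|j t'] rt' e; first by move: rt; rewrite e rt'.
have szt : size t = size t' by move: rt; rewrite e rt' => -[].
have [ij|ij] := eqVneq i j; first by rewrite -ij in rt' e *; apply: same.
set x := wp (i :: t); have di : ldesc i x.
  by rewrite /ldesc {1}/x wp_cons mulKs rt; apply: length_min.
have dj : ldesc j x.
  by rewrite /ldesc /x e {1}wp_cons mulKs rt'; apply: length_min.
have [y [ex lx]] := dihedral ij di dj (leqnn _).
have [ty ety sty] := ex_reduced y.
have mp : exists k', m i j = k'.+1.
  by exists (m i j).-1; rewrite prednK // -ord_st order_gt0.
case: mp => k' ek'.
have s1 : size (alt_word i j (m i j) ++ ty) = (size t).+1.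
  by rewrite size_cat size_alt_word sty -lx /x rt.
have s2 : size (alt_word j i (m i j) ++ ty) = (size t).+1.
  by rewrite size_cat size_alt_word sty -lx /x rt.
have w1 : wp (alt_word i j (m i j) ++ ty) = x by rewrite wp_cat ety -ex.
have w2 : wp (alt_word j i (m i j) ++ ty) = x by rewrite wp_cat ety -wp_alt_braid -ex.
transitivity (\prod_(c <- alt_word i j (m i j) ++ ty) h c)%R.
  by move: s1 w1; rewrite ek' /= => s1 w1; apply: same; rewrite ?w1 /= ?s1.
transitivity (\prod_(c <- alt_word j i (m i j) ++ ty) h c)%R.
  by rewrite !big_cat /= !alt_alternating br.
move: s2 w2; rewrite ek' /= => s2 w2; symmetry; apply: same => //.
- by rewrite -szt.
- by rewrite w2 /= s2; exact: rt.
by rewrite w2 /x e.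
Qed.

(** * The longest element *)

Local Notation w0 := (longest s).

Lemma length_w0 w : (len w <= len w0)%N.
Proof. by rewrite /longest; case: arg_maxnP => // w' _ h; apply: h. Qed.

(** The value of the cocycle is unchanged when a reflection and its argument
    are conjugated together, which reduces to the case of s i. *)
Lemma inversion_self i x : inversion (s i ^ x) (s i ^ x).
Proof.
have h : inversion x^-1 (s i ^ x) = inversion x (s i).
  by have := inversionM x^-1 x (s i ^ x); rewrite mulVg inversion1 conjgK; do 2 case: inversion.
by rewrite {1}conjgE inversionM h conjgK inversion_cons eqxx s_conj; case: inversion.
Qed.

(** Otherwise the reflection would be an inversion of its product with w0, and
    multiplication by it would make that product shorter, although w0 is
    longest. *)
Lemma inversion_w0 i x : inversion w0 (s i ^ x).
Proof.
apply: contraT => h; have : inversion (s i ^ x * w0) (s i ^ x).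
  by rewrite inversionM inversion_self conjgE mulKg; move: h; rewrite conjgE; case: inversion.
move/strong_exchange; have r2 : s i ^ x * s i ^ x = 1 by rewrite -conjMg s_sqr conj1g.
by rewrite mulgA r2 mul1g ltnNge length_w0.
Qed.

(** Every generator is a left descent of w0, and inversions of w and of w * w0
    are complementary. So each left descent of w raises the length of w *
    w0. *)
Lemma length_w0M x : (len (x * w0) + len x = len w0)%N.
Proof.
move: x => w; have [k] := ubnP (len w); elim: k w => // k IH w; rewrite ltnS => wk.
have [->|/ex_ldesc[i di]] := eqVneq w 1; first by rewrite mul1g length1 addn0.
have lw := length_down di.
have := IH (s i * w); rewrite -lw => /(_ wk) <-.
have nd : ldesc i (s i * w * w0).
  rewrite ldescE inversionM inversion_w0.
  have : ~~ ldesc i (s i * w) by rewrite ldesc_s negbK.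
  by rewrite ldescE; case: inversion.
by have := length_down nd; rewrite -!mulgA mulKs lw => ->; rewrite addnS addSn.
Qed.

Lemma w0w0 : w0 * w0 = 1.
Proof.
by apply: length0; have /eqP := length_w0M w0; rewrite -[X in _ == X]add0n eqn_add2r => /eqP.
Qed.

Lemma length_Mw0 x : (len (w0 * x) + len x = len w0)%N.
Proof.
have w0V : w0^-1 = w0 by apply/eqP; rewrite eq_invg_mul w0w0.
by have := length_w0M x^-1; rewrite -length_inv invMg invgK w0V length_inv.
Qed.

Lemma refl_seq_class t k c : (k < size t)%N -> nth 1 (refl_seq t) k \in s (nth c t k) ^: [set: W].
Proof.
elim: t k => //= i t IH [|k] /=; first by rewrite class_refl.
rewrite ltnS => kt; rewrite (nth_map 1) ?size_refl_seq //.
by case/imsetP: (IH k kt) => g _ ->; rewrite -conjgM memJ_class ?inE.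
Qed.

(** In a reduced word the positions of the letter c carry distinct
    reflections, all conjugate to s c. *)
Lemma count_letter c t : len (wp t) = size t -> (count_mem c t <= #|s c ^: [set: W]|)%N.
Proof.
move=> /refl_seq_uniq ut.
pose u := [seq p.2 | p <- zip t (refl_seq t) & p.1 == c].
have su : size u = count_mem c t.
  rewrite size_map size_filter -[t in RHS](@unzip1_zip _ _ t (refl_seq t)) ?size_refl_seq //.
  by rewrite /unzip1 count_map.
have uu : uniq u.
  apply: subseq_uniq ut; rewrite -[X in subseq _ X](@unzip2_zip _ _ t (refl_seq t)) ?size_refl_seq //.
  exact/map_subseq/filter_subseq.
rewrite -su -(card_uniqP uu); apply/subset_leq_card/subsetP => r.
case/mapP => -[c' r'] /=; rewrite mem_filter => /andP[/= /eqP -> zr] ->.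
case/(nthP (c, 1)): zr => k; rewrite size_zip size_refl_seq minnn => kt.
rewrite nth_zip ?size_refl_seq // => -[<- <-]; exact: refl_seq_class.
Qed.

End CoxeterTheory.

(** * Freeness of the standard basis *)

Section Regular.
Local Open Scope ring_scope.
Variables (I : finType) (m : I -> I -> nat) (W : finGroupType) (s : I -> W).
Hypothesis hW : coxeter_system m s.
Hypothesis m_diag : forall i, m i i = 1%N.
Hypothesis ord_st : forall i j, #[s i * s j]%g = m i j.

Local Notation len := (length s).
Local Notation wp := (word_prod s).
Local Notation ldesc := (left_descent s).
Local Notation rdesc := (right_descent s).

Let nW := #|W|.-1.
Lemma card_W : #|W| = nW.+1.
Proof. by rewrite /nW prednK //; apply/card_gt0P; exists 1%g. Qed.

Definition windex (w : W) : 'I_nW.+1 := cast_ord card_W (enum_rank w).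
Definition wval (i : 'I_nW.+1) : W := enum_val (cast_ord (esym card_W) i).
Lemma windexK : cancel windex wval.
Proof. by move=> w; rewrite /wval /windex cast_ordK enum_rankK. Qed.
Lemma wvalK : cancel wval windex.
Proof. by move=> i; rewrite /wval /windex enum_valK cast_ordKV. Qed.

Definition E w : 'cV[laurent]_nW.+1 := delta_mx (windex w) 0.
Definition mx_of_columns (F : W -> 'cV[laurent]_nW.+1) : 'M[laurent]_nW.+1 :=
  \matrix_(a, b) F (wval b) a 0.

Lemma mx_ofE F w : mx_of_columns F *m E w = F w.
Proof. by apply/colP => a; rewrite -colE !mxE windexK. Qed.

Lemma mx_ext (A B : 'M[laurent]_nW.+1) : (forall w, A *m E w = B *m E w) -> A = B.
Proof.
move=> h; apply/matrixP => a b; have := h (wval b).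
by rewrite /E wvalK -!colE => /colP/(_ a); rewrite !mxE.
Qed.

(** Left multiplication by H_i on the standard basis, the basis vectors being
    columns indexed by W. *)
Definition Lop i := mx_of_columns (fun w => E (s i * w)%g + (if ldesc i w then (vV - v) *: E w else 0)).
Definition Rop i := mx_of_columns (fun w => E (w * s i)%g + (if rdesc i w then (vV - v) *: E w else 0)).

Lemma rdesc_s i w : rdesc i (w * s i)%g = ~~ rdesc i w.
Proof. by rewrite !(rdescE hW m_diag) invMg (s_inv hW m_diag) (ldesc_s hW m_diag). Qed.

Lemma folding_r i j w : ~~ rdesc j w -> rdesc j (s i * w)%g -> (w * s j = s i * w)%g.
Proof.
rewrite !(rdescE hW m_diag) invMg (s_inv hW m_diag) => a b.
have /(congr1 invg) := folding hW m_diag a b.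
by rewrite !invMg invgK !(s_inv hW m_diag).
Qed.

(** Folding: multiplication by s j on the right changes a left descent i of w
    only if both multiplications agree on w. *)
Lemma ldesc_rdesc i j w :
  ldesc i (w * s j)%g = ldesc i w /\ rdesc j (s i * w)%g = rdesc j w \/
  (s i * w = w * s j)%g.
Proof.
have [e|ne] := eqVneq (s i * w)%g (w * s j)%g; [by right | left].
split.
  case: (boolP (ldesc i w)) => d; last first.
    by apply: contraNF ne => d'; rewrite (folding hW m_diag d d').
  case: (boolP (ldesc i (w * s j)%g)) => // d'.
  have := folding (j := j) hW m_diag d'; rewrite (mulsK hW m_diag) => /(_ d) e.
  by case/eqP: ne; rewrite -{1}e (mulKs hW m_diag).
case: (boolP (rdesc j w)) => d; last first.
  by apply: contraNF ne => d'; rewrite (folding_r d d').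
case: (boolP (rdesc j (s i * w)%g)) => // d'.
have := folding_r (i := i) d'; rewrite (mulKs hW m_diag) => /(_ d) e.
by case/eqP: ne; rewrite -{2}e (mulsK hW m_diag).
Qed.

(** Both operators are given on basis vectors by descents, so only the folded
    case needs a computation. *)
Lemma Lop_Rop i j : Lop i *m Rop j = Rop j *m Lop i.
Proof.
apply: mx_ext => w; rewrite -!mulmxA !mx_ofE !mulmxDr !mx_ofE !mulgA.
have ifs (b : bool) (M : 'M[laurent]_nW.+1) x :
   M *m (if b then (vV - v) *: E x else 0) = if b then (vV - v) *: (M *m E x) else 0.
  by case: b; rewrite ?mulmx0 // scalemxAr.
rewrite !ifs !mx_ofE.
have [[-> ->]|e] := ldesc_rdesc i j w.
  by case: ldesc; case: rdesc; rewrite ?addr0 //; apply/colP => a; rewrite !mxE; ring.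
have e2 : (s i * w * s j = w)%g by rewrite e (mulsK hW m_diag).
rewrite -e (ldesc_s hW m_diag) e rdesc_s -e e2.
have de : ldesc i w = rdesc j w by rewrite /ldesc /rdesc e.
by rewrite de.
Qed.

Lemma Lop_quad i : (Lop i + v%:A) * (Lop i - vV%:A) = 0.
Proof.
apply: mx_ext => w; rewrite mul0mx.
rewrite -[(_ * _)]/(_ *m _) -mulmxA mulmxBl mulmxDl mulmxBr.
have sc (x : laurent) (u : 'cV[laurent]_nW.+1) : (x%:A : 'M_nW.+1) *m u = x *: u.
  by rewrite -scalemxAl mul1mx.
rewrite !sc !mx_ofE mulmxDr !mx_ofE (mulKs hW m_diag) (ldesc_s hW m_diag) -scalemxAr mx_ofE.
case: (boolP (ldesc i w)) => d /=; rewrite ?mulmx0 ?addr0 -?scalemxAr ?mx_ofE ?d.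
  apply/colP => a; rewrite !mxE.
  transitivity ((1 - v * vV) * ((a == windex w) && (0 == 0 :> 'I_1))%:R); first by ring.
  by rewrite mulvV subrr mul0r.
apply/colP => a; rewrite !mxE.
transitivity ((1 - v * vV) * ((a == windex w) && (0 == 0 :> 'I_1))%:R); first by ring.
by rewrite mulvV subrr mul0r.
Qed.

Lemma LopE_up i w : ~~ ldesc i w -> Lop i *m E w = E (s i * w)%g.
Proof. by move=> d; rewrite mx_ofE (negbTE d) addr0. Qed.

Lemma RopE_up i w : ~~ rdesc i w -> Rop i *m E w = E (w * s i)%g.
Proof. by move=> d; rewrite mx_ofE (negbTE d) addr0. Qed.

Lemma Lword t : len (wp t) = size t -> (\prod_(i <- t) Lop i) *m E 1%g = E (wp t).
Proof.
elim: t => [|i t IH] /= e; first by rewrite big_nil mul1mx wp_nil.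
have le := length_min s t; have lt := length_sle hW i (wp t).
have et : len (wp t) = size t by move: lt; rewrite -wp_cons e; lia.
rewrite big_cons -[(_ * _)]/(_ *m _) -mulmxA IH // LopE_up ?wp_cons //.
by rewrite /ldesc -wp_cons e et -leqNgt.
Qed.

Lemma length_sre i w : (len (w * s i)%g <= (len w).+1)%N.
Proof.
rewrite -(length_inv hW m_diag) invMg (s_inv hW m_diag) -[len w](length_inv hW m_diag).
exact: (length_sle hW).
Qed.

(** The right multiplications commute with the left ones, so an operator
    identity between left multiplications can be tested on the vector of the
    identity. *)
Lemma ex_R w : exists2 R : 'M[laurent]_nW.+1, E w = R *m E 1%g &
  forall i, Lop i *m R = R *m Lop i.
Proof.
have [t] := ex_reduced hW w; elim/last_ind: t w => [|t i IH] w <- e.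
  by exists 1%:M => [|i]; rewrite ?mul1mx ?mulmx1 ?wp_nil.
rewrite size_rcons in e.
have le := length_min s t; have lt := length_sre i (wp t).
rewrite -wp_rcons in lt.
have et : size t = len (wp t) by lia.
have [R RE Rc] := IH _ erefl et; exists (Rop i *m R) => [|j].
  rewrite -mulmxA -RE RopE_up ?wp_rcons //.
  by rewrite /rdesc -wp_rcons -e et -leqNgt.
by rewrite mulmxA Lop_Rop -!mulmxA Rc.
Qed.

(** On the vector of the identity both sides give the vector of the longest
    element of the dihedral group, as alternating words are reduced. *)
Lemma Lop_braid i j :
  alternating (Lop i) (Lop j) (m i j) = alternating (Lop j) (Lop i) (m i j).
Proof.
rewrite -!alt_alternating; apply: mx_ext => w; have [R -> Rc] := ex_R w.
have Rt t : (\prod_(c <- t) Lop c) *m R = R *m (\prod_(c <- t) Lop c).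
  elim: t => [|c t IH]; first by rewrite big_nil mul1mx mulmx1.
  by rewrite big_cons -[(_ * _)]/(_ *m _) -mulmxA IH mulmxA Rc mulmxA.
rewrite !mulmxA !Rt -!mulmxA !Lword.
- by rewrite (wp_alt_braid hW m_diag ord_st).
- by rewrite size_alt_word (alt_reduced hW m_diag ord_st) // (coxeter_m_sym hW m_diag ord_st).
- by rewrite size_alt_word (alt_reduced hW m_diag ord_st).
Qed.

Lemma Lop_hecke : hecke_relations m Lop.
Proof. by split; [exact: Lop_braid | exact: Lop_quad]. Qed.

Variables (A : algType laurent) (H : I -> A).
Hypothesis hA : hecke_algebra m H.
Local Notation Hw := (standard_basis s H).

(** The algebra presented by the Hecke relations acts on columns through the
    left multiplications, and the basis element of y sends the vector of the
    identity to the vector of y. *)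
Lemma ex_coord : exists crd : W -> A -> laurent,
  [/\ forall x a b, crd x (a + b) = crd x a + crd x b,
      forall x (c : laurent) a, crd x (c *: a) = c * crd x a
    & forall x y, crd x (Hw y) = (x == y)%:R].
Proof.
have [_ /(_ _ _ Lop_hecke)[f fH _]] := hA.
exists (fun x a => (f a *m E 1%g) (windex x) 0); split=> [x a b|x c a|x y].
- by rewrite rmorphD mulmxDl mxE.
- by rewrite linearZ -scalemxAl mxE.
rewrite /standard_basis; case: pickP => [t|no]; last first.
  have [t et st] := ex_reduced hW y.
  have := no (tcast st (in_tuple t)); rewrite inE.
  by rewrite val_tcast /= et eqxx.
rewrite inE => /eqP et; rewrite rmorph_prod.
rewrite (eq_bigr Lop) => [|i _]; last exact: fH.
rewrite Lword et ?size_tuple // mxE eqxx andbT (inj_eq (can_inj windexK)) //.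
Qed.
End Regular.

(** * Hecke algebra and bar involution *)

Section HeckeTheory.
Local Open Scope ring_scope.
Variables (I : finType) (m : I -> I -> nat) (W : finGroupType) (s : I -> W).
Hypothesis hW : coxeter_system m s.
Hypothesis m_diag : forall i, m i i = 1%N.
Hypothesis ord_st : forall i j, #[s i * s j]%g = m i j.
Variables (A : algType laurent) (H : I -> A).
Hypothesis hA : hecke_algebra m H.

Local Notation len := (length s).
Local Notation wp := (word_prod s).
Local Notation ldesc := (left_descent s).
Local Notation rdesc := (right_descent s).
Local Notation Hw := (standard_basis s H).
Local Notation s_inv := (s_inv hW m_diag).
Local Notation mulKs := (mulKs hW m_diag).
Local Notation mulsK := (mulsK hW m_diag).
Local Notation ldesc_s := (ldesc_s hW m_diag).
Local Notation rdesc_s := (rdesc_s hW m_diag).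
Local Notation rdescE := (rdescE hW m_diag).

Definition std_coef : W -> A -> laurent :=
  sval (boolp.cid (ex_coord hW m_diag ord_st hA)).
Local Notation crd := std_coef.

Lemma crdD x a b : crd x (a + b) = crd x a + crd x b.
Proof. by rewrite /crd; case: boolp.cid => ? []. Qed.
Lemma crdZ x c a : crd x (c *: a) = c * crd x a.
Proof. by rewrite /crd; case: boolp.cid => ? []. Qed.
Lemma crd_Hw x y : crd x (Hw y) = (x == y)%:R.
Proof. by rewrite /crd; case: boolp.cid => ? []. Qed.
Lemma crd0 x : crd x 0 = 0.
Proof. by rewrite -(scale0r 0) crdZ mul0r. Qed.
Lemma crdN x a : crd x (- a) = - crd x a.
Proof. by rewrite -scaleN1r crdZ mulN1r. Qed.
Lemma crdB x a b : crd x (a - b) = crd x a - crd x b.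
Proof. by rewrite crdD crdN. Qed.
Lemma crd_sum x (J : finType) (P : pred J) (F : J -> A) :
  crd x (\sum_(i | P i) F i) = \sum_(i | P i) crd x (F i).
Proof. by apply: (big_morph (crd x)) => [a b|]; [exact: crdD | exact: crd0]. Qed.
Lemma crd_comb x (c : W -> laurent) : crd x (\sum_w c w *: Hw w) = c x.
Proof.
rewrite crd_sum (bigD1 x) //= crdZ crd_Hw eqxx mulr1 big1 ?addr0 // => w wx.
by rewrite crdZ crd_Hw eq_sym (negbTE wx) mulr0.
Qed.

(** Membership in the span of the standard basis, where the coordinates
    determine an element. *)
Definition in_span (a : A) := a = \sum_w crd w a *: Hw w.
Local Notation sp := in_span.

Lemma sp_comb (c : W -> laurent) : sp (\sum_w c w *: Hw w).
Proof. by rewrite /sp; apply: eq_bigr => w _; rewrite crd_comb. Qed.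
Lemma spD a b : sp a -> sp b -> sp (a + b).
Proof.
rewrite /sp => {1}-> {1}->; rewrite -big_split; apply: eq_bigr => w _.
by rewrite /= -scalerDl crdD.
Qed.
Lemma spZ c a : sp a -> sp (c *: a).
Proof.
by rewrite /sp => {1}->; rewrite scaler_sumr; apply: eq_bigr => w _; rewrite scalerA crdZ.
Qed.
Lemma sp0 : sp 0.
Proof. by rewrite /sp big1 // => w _; rewrite crd0 scale0r. Qed.
Lemma spB a b : sp a -> sp b -> sp (a - b).
Proof. by move=> sa sb; rewrite -scaleN1r; apply/spD/spZ. Qed.
Lemma sp_sum (J : finType) (P : pred J) (F : J -> A) :
  (forall i, P i -> sp (F i)) -> sp (\sum_(i | P i) F i).
Proof. by move=> h; elim/big_ind: _ => //; [exact: sp0 | exact: spD]. Qed.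
Lemma sp_Hw w : sp (Hw w).
Proof.
rewrite /sp (bigD1 w) //= crd_Hw eqxx scale1r big1 ?addr0 // => x xw.
by rewrite crd_Hw (negbTE xw) scale0r.
Qed.
Lemma sp_eq a b : sp a -> sp b -> (forall x, crd x a = crd x b) -> a = b.
Proof.
by rewrite /sp => ea eb h; rewrite ea eb; apply: eq_bigr => w _; rewrite h.
Qed.

Lemma H_sq i : H i * H i = 1 + (vV - v) *: H i.
Proof.
have [[_ hq] _] := hA; move: (hq i).
rewrite mulrDl !mulrBr -!scalerAl -!scalerAr !mul1r !mulr1 scalerA mulvV scale1r => /eqP.
rewrite addr_eq0 => /eqP e.
by rewrite -[LHS](subrK (vV *: H i)) e scalerBl opprB; rewrite addrAC addrA.
Qed.

(** The standard basis element does not depend on the reduced word, by the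
    theorem of Matsumoto. *)
Lemma HwE t : len (wp t) = size t -> Hw (wp t) = \prod_(i <- t) H i.
Proof.
move=> e; rewrite /standard_basis; case: pickP => [u|no]; last first.
  by have := no (tcast (esym e) (in_tuple t)); rewrite inE val_tcast eqxx.
rewrite inE => /eqP eu.
have [[br _] _] := hA.
by apply: (matsumoto hW m_diag ord_st br) => //; rewrite eu ?size_tuple.
Qed.

Lemma Hw1 : Hw 1%g = 1.
Proof. by rewrite -(wp_nil s) HwE ?big_nil // wp_nil length1. Qed.
Lemma H_up i w : ~~ ldesc i w -> H i * Hw w = Hw (s i * w)%g.
Proof.
move=> d; have [t et st] := ex_reduced hW w.
have e : len (wp (i :: t)) = (size t).+1.
  by rewrite wp_cons et (length_up hW m_diag d) st.
by rewrite -et -wp_cons !HwE // ?big_cons // et st.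
Qed.

Lemma H_upr i w : ~~ rdesc i w -> Hw w * H i = Hw (w * s i)%g.
Proof.
move=> d; have [t et st] := ex_reduced hW w.
have e : len (wp (rcons t i)) = size (rcons t i).
  rewrite wp_rcons et size_rcons st -(length_inv hW m_diag) invMg s_inv.
  by rewrite (length_up hW m_diag) ?(length_inv hW m_diag) // -rdescE.
by rewrite -et -wp_rcons !HwE // -?cats1 ?big_cat ?big_seq1 // et st.
Qed.

Lemma HlE i w :
  H i * Hw w = Hw (s i * w)%g + (if ldesc i w then (vV - v) *: Hw w else 0).
Proof.
case: (boolP (ldesc i w)) => d; last by rewrite H_up // addr0.
have d' : ~~ ldesc i (s i * w)%g by rewrite ldesc_s d.
rewrite -{1}[w](mulKs i) -(H_up d') mulrA H_sq mulrDl mul1r -scalerAl H_up //.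
by rewrite mulKs.
Qed.

Lemma HrE i w :
  Hw w * H i = Hw (w * s i)%g + (if rdesc i w then (vV - v) *: Hw w else 0).
Proof.
case: (boolP (rdesc i w)) => d; last by rewrite H_upr // addr0.
have d' : ~~ rdesc i (w * s i)%g by rewrite rdesc_s d.
rewrite -{1}[w](mulsK i) -(H_upr d') -mulrA H_sq mulrDr mulr1 -scalerAr H_upr //.
by rewrite mulsK.
Qed.

Lemma sp_Hl i a : sp a -> sp (H i * a).
Proof.
move=> ->; rewrite mulr_sumr; apply: sp_sum => w _; rewrite -scalerAr HlE.
by apply/spZ/spD; [|case: ldesc]; do ?[exact: sp_Hw | apply: spZ | exact: sp0].
Qed.

Lemma crd_Hl i a x : sp a ->
  crd x (H i * a) = crd (s i * x)%g a + (if ldesc i x then (vV - v) * crd x a else 0).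
Proof.
move=> sa; rewrite {1}sa mulr_sumr crd_sum.
under eq_bigr do rewrite -scalerAr crdZ HlE crdD crd_Hw mulrDr.
rewrite big_split /=; congr (_ + _).
  rewrite (bigD1 (s i * x)%g) //= mulKs eqxx mulr1 big1 ?addr0 // => w wx.
  case: eqP => [e|]; last by rewrite mulr0.
  by rewrite e mulKs eqxx in wx.
rewrite (bigD1 x) //= big1 ?addr0 => [|w wx].
  by case: ldesc; rewrite ?crd0 ?mulr0 // crdZ crd_Hw eqxx mulr1 mulrC.
by case: ldesc; rewrite ?crd0 ?mulr0 // crdZ crd_Hw eq_sym (negbTE wx) !mulr0.
Qed.

(** The bar-invariant element H_i + v, which is the Kazhdan-Lusztig element of
    s i. *)
Definition kl_gen i : A := H i + v%:A.
Local Notation K := kl_gen.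

Lemma KlE i a : K i * a = H i * a + v *: a.
Proof. by rewrite mulrDl -scalerAl mul1r. Qed.
Lemma sp_Kl i a : sp a -> sp (K i * a).
Proof. by move=> sa; rewrite KlE; apply/spD/spZ => //; apply: sp_Hl. Qed.
Lemma crd_Kl i a x : sp a ->
  crd x (K i * a) = crd (s i * x)%g a + (if ldesc i x then vV else v) * crd x a.
Proof.
move=> sa; rewrite KlE crdD crdZ crd_Hl //.
by case: ldesc; ring.
Qed.

(** The anti-involution sending H_w to H_(w^-1); it turns statements about
    left descents into statements about right descents. *)
Definition flat (a : A) := \sum_w crd w a *: Hw w^-1%g.
Local Notation fl := flat.

Lemma fl_sp a : sp (fl a).
Proof. by apply: sp_sum => w _; apply/spZ/sp_Hw. Qed.
Lemma crd_fl x a : crd x (fl a) = crd x^-1%g a.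
Proof.
rewrite crd_sum (bigD1 x^-1%g) //= crdZ crd_Hw invgK eqxx mulr1 big1 ?addr0 // => w wx.
rewrite crdZ crd_Hw; case: eqP => [e|]; last by rewrite mulr0.
by rewrite e invgK eqxx in wx.
Qed.
Lemma flD a b : fl (a + b) = fl a + fl b.
Proof. by rewrite /fl -big_split; apply: eq_bigr => w _; rewrite crdD scalerDl. Qed.
Lemma flZ c a : fl (c *: a) = c *: fl a.
Proof. by rewrite /fl scaler_sumr; apply: eq_bigr => w _; rewrite crdZ scalerA. Qed.
Lemma fl_sum (J : finType) (P : pred J) (F : J -> A) :
  fl (\sum_(i | P i) F i) = \sum_(i | P i) fl (F i).
Proof.
apply: (big_morph fl) => [a b|]; first exact: flD.
by rewrite /fl big1 // => w _; rewrite crd0 scale0r.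
Qed.
Lemma fl_Hw w : fl (Hw w) = Hw w^-1%g.
Proof.
apply: sp_eq => [||x]; [exact: fl_sp | exact: sp_Hw |].
by rewrite crd_fl !crd_Hw -(inj_eq invg_inj) invgK.
Qed.
Lemma fl_Hl i a : sp a -> fl (H i * a) = fl a * H i.
Proof.
move=> ->; rewrite mulr_sumr !fl_sum mulr_suml; apply: eq_bigr => w _.
rewrite -scalerAr !flZ -scalerAl HlE flD !fl_Hw HrE rdescE invgK invMg s_inv.
by case: ldesc; rewrite ?addr0 ?flZ ?fl_Hw // -[X in fl X](scale0r 0) flZ scale0r addr0.
Qed.
Variables (bar : {rmorphism A -> A}).
Hypothesis hbar : bar_involution H bar.

(** The compatibility of bar with v gives the compatibility with all scalars,
    as a Laurent polynomial times a power of v is a polynomial in v. *)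
Lemma barZ c a : bar (c *: a) = barL c *: bar a.
Proof.
have [_ bv _] := hbar.
have bvk k b : bar (v ^+ k *: b) = vV ^+ k *: bar b.
  by elim: k b => [|k IH] b; rewrite ?scale1r // !exprS -!scalerA bv IH.
have bi (n : int) b : bar (n%:~R *: b) = n%:~R *: bar b.
  by rewrite !scaler_int raddfMz.
have bat q b : bar (at_v q *: b) = at_vV q *: bar b.
  elim/poly_ind: q b => [|q n IH] b; first by rewrite !rmorph0 !scale0r rmorph0.
  rewrite !rmorphD !rmorphM /= at_vX at_vVX at_vC at_vVC !scalerDl rmorphD bi.
  by rewrite -!scalerA IH bv.
have [q [k ck]] := laurent_rep c.
have -> : c *: a = (c * v ^+ k) *: (vV ^+ k *: a).
  by rewrite scalerA -mulrA v_vV_pow mulr1.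
rewrite ck bat (barLE ck) -scalerA; congr (_ *: _).
have := bvk k (vV ^+ k *: a); rewrite scalerA v_vV_pow scale1r => ->.
by rewrite scalerA v_vV_pow scale1r.
Qed.

Lemma bar_H i : bar (H i) = H i + (v - vV)%:A.
Proof.
have [_ _ /(_ i) [b1 b2]] := hbar.
have h : H i * (H i + (v - vV)%:A) = 1.
  by rewrite mulrDr H_sq -scalerAr mulr1 -addrA -scalerDl addrA subrK subrr scale0r addr0.
by rewrite -[LHS]mulr1 -[X in _ * X = _]h mulrA b1 mul1r.
Qed.

Lemma bar_K i : bar (K i) = K i.
Proof.
rewrite /K rmorphD bar_H barZ rmorph1 barL_v -addrA -scalerDl.
by rewrite subrK.
Qed.

Lemma bar_Hl i a : bar (H i * a) = H i * bar a + (v - vV) *: bar a.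
Proof. by rewrite rmorphM bar_H mulrDl -scalerAl mul1r. Qed.

(** Unitriangularity of bar, by induction on the length along bar H_i = H_i +
    (v - v^-1). *)
Lemma bar_Hw w : sp (bar (Hw w)) /\
  (forall x, (len w <= len x)%N -> crd x (bar (Hw w)) = (x == w)%:R).
Proof.
have [k] := ubnP (len w); elim: k w => // k IH w; rewrite ltnS => wk.
have [->|/(ex_ldesc hW m_diag)[i di]] := eqVneq w 1%g.
  rewrite Hw1 rmorph1 -Hw1; split; first exact: sp_Hw.
  by move=> x _; rewrite crd_Hw.
have lw := length_down hW m_diag di; set w' := (s i * w)%g in lw.
have [|sw' cw'] := IH w'; first by rewrite -lw.
have d' : ~~ ldesc i w' by rewrite ldesc_s di.
have -> : w = (s i * w')%g by rewrite mulKs.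
rewrite -(H_up d') bar_Hl; split; first by apply/spD/spZ => //; apply: sp_Hl.
move=> x; rewrite mulKs lw => lx.
rewrite crdD crdZ crd_Hl //.
have zx : crd x (bar (Hw w')) = 0.
  rewrite cw' 1?ltnW //; case: eqP lx => // ->; by rewrite ltnn.
rewrite zx !mulr0 if_same !addr0 cw'.
  by rewrite /w' (inj_eq (mulgI (s i))).
by have := length_sle hW i (s i * x)%g; rewrite mulKs; lia.
Qed.

Lemma sp_bar a : sp a -> sp (bar a).
Proof.
move=> ->; rewrite rmorph_sum; apply: sp_sum => w _ /=.
by rewrite barZ; apply/spZ; have [] := bar_Hw w.
Qed.

(** At an element of maximal length in the support the coefficient is equal to
    its bar and lies in v Z[v]. *)
Lemma bar_inv_eq0 a : sp a -> bar a = a -> (forall x, vZ (crd x a)) -> a = 0.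
Proof.
move=> sa ba va; apply: sp_eq => // [|x]; first exact: sp0.
rewrite crd0; apply/eqP; apply: contraT => x0.
case: (arg_maxnP (fun x => len x) (x0 : [pred y | crd y a != 0] x)) => /= y y0 ymax.
case/eqP: y0; apply: vZ_bar => //.
rewrite -{2}ba {2}sa rmorph_sum crd_sum (bigD1 y) //= barZ crdZ.
have [_ ->] := bar_Hw y => //; rewrite eqxx mulr1 big1 ?addr0 // => z zy.
rewrite barZ crdZ; have [/eqP ->|z0] := boolP (crd z a == 0); first by rewrite rmorph0 mul0r.
have [_ ->] := bar_Hw z; first by rewrite eq_sym (negbTE zy) mulr0.
exact: ymax.
Qed.

Lemma fl_bar_Hw w : fl (bar (Hw w)) = bar (Hw w^-1%g).
Proof.
have [k] := ubnP (len w); elim: k w => // k IH w; rewrite ltnS => wk.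
have [->|/(ex_ldesc hW m_diag)[i di]] := eqVneq w 1%g.
  by rewrite invg1 Hw1 rmorph1 -Hw1 fl_Hw invg1.
have lw := length_down hW m_diag di; set w' := (s i * w)%g in lw.
have d' : ~~ ldesc i w' by rewrite ldesc_s di.
have [sw' _] := bar_Hw w'.
have -> : w = (s i * w')%g by rewrite mulKs.
rewrite -(H_up d') bar_Hl flD flZ fl_Hl // IH ?invMg ?s_inv -?lw //.
rewrite -[in RHS]H_upr; last by rewrite rdescE invMg invgK s_inv.
rewrite rmorphM /= bar_H mulrDr -scalerAr mulr1.
by [].
Qed.

Lemma fl_bar a : sp a -> fl (bar a) = bar (fl a).
Proof.
move=> ->; rewrite fl_sum !rmorph_sum fl_sum; apply: eq_bigr => w _ /=.
by rewrite barZ !flZ fl_bar_Hw fl_Hw barZ.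
Qed.

(** * Kazhdan-Lusztig elements *)

Variable (p : W -> W -> {poly int}).
Hypothesis hp : kl_polynomials s H bar p.
Local Notation C := (kl_element s H p).

Lemma bruhat_len x y : bruhat_le s x y -> x != y -> (len x < len y)%N.
Proof.
case/connectP => u; elim: u x => [|z u IH] x /=; first by move=> _ ->; rewrite eqxx.
case/andP => /andP[_ lxz] pu ey _; apply: (leq_trans lxz).
have [->|zy] := eqVneq z y => //; apply/ltnW; exact: IH.
Qed.

Definition kl_laurent x w := at_v (p x w).
Local Notation P := kl_laurent.

Lemma P1w w : P w w = 1.
Proof. by have [e _ _ _] := hp w; rewrite /P e rmorph1. Qed.

Lemma P_vZ x w : x != w -> vZ (P x w).
Proof.
move=> xw; have [_ e1 e2 _] := hp w; rewrite /P.
have [b|b] := boolP (bruhat_le s x w); last by rewrite e2 // rmorph0; exact: vZ0.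
by exists (p x w) => //; apply: e1; apply/andP.
Qed.

Lemma P_len x w : (len w <= len x)%N -> x != w -> P x w = 0.
Proof.
move=> l xw; have [_ _ e2 _] := hp w; rewrite /P e2 ?rmorph0 //.
by apply/negP => /bruhat_len/(_ xw); rewrite ltnNge l.
Qed.

Lemma CE w : C w = \sum_x P x w *: Hw x.
Proof.
rewrite /kl_element [RHS](bigD1 w) //= P1w scale1r; congr (_ + _).
have [_ _ e2 _] := hp w.
rewrite [RHS](bigID (fun x => bruhat_le s x w)) /= [X in _ = _ + X]big1 ?addr0 //.
by move=> x /andP[_ b]; rewrite /P e2 // rmorph0 scale0r.
Qed.

Lemma sp_C w : sp (C w). Proof. by rewrite CE; apply: sp_comb. Qed.
Lemma crd_C x w : crd x (C w) = P x w. Proof. by rewrite CE crd_comb. Qed.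
Lemma bar_C w : bar (C w) = C w. Proof. by have [] := hp w. Qed.

(** The difference with C w is bar-invariant with all coefficients in v
    Z[v]. *)
Lemma kl_unique a w : sp a -> bar a = a -> crd w a = 1 ->
  (forall x, x != w -> vZ (crd x a)) -> a = C w.
Proof.
move=> sa ba a1 av; apply/eqP; rewrite -subr_eq0; apply/eqP; apply: bar_inv_eq0.
- by apply: spB => //; apply: sp_C.
- by rewrite rmorphB ba bar_C.
move=> x; rewrite crdB crd_C; have [->|xw] := eqVneq x w.
  by rewrite a1 P1w subrr; exact: vZ0.
by apply: vZB; [apply: av | apply: P_vZ].
Qed.

Lemma fl_C w : fl (C w) = C w^-1%g.
Proof.
apply: kl_unique; first exact: fl_sp.
- by rewrite -fl_bar ?bar_C //; exact: sp_C.
- by rewrite crd_fl invgK crd_C P1w.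
move=> x xw; rewrite crd_fl crd_C; apply: P_vZ.
by apply: contra xw => /eqP <-; rewrite invgK.
Qed.

Lemma C1 : C 1%g = 1.
Proof.
symmetry; apply: kl_unique; rewrite -?Hw1 ?rmorph1 ?crd_Hw ?eqxx //.
- exact: sp_Hw.
- by rewrite Hw1 rmorph1.
by move=> x x1; rewrite crd_Hw (negbTE x1); exact: vZ0.
Qed.

(** The coefficient of v, the only part of p z w that K_i can turn into a
    constant term. *)
Definition kl_mu z w : int := (p z w)`_1.
Local Notation mu := kl_mu.

Lemma vPE z w : z != w -> vZ (vV * P z w - (mu z w)%:~R).
Proof.
move=> zw; have [q q0 e] := P_vZ zw; have := congr1 (fun t => t) e.
rewrite /P => /at_v_inj epq.
exists (drop_poly 1 q - (mu z w)%:P).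
  by rewrite coefB coefC eqxx coef_drop_poly /mu epq subrr.
have e' : q = drop_poly 1 q * 'X.
  rewrite -{1}(poly_take_drop 1 q) expr1; suff -> : take_poly 1 q = 0 by rewrite add0r.
  by apply/polyP => i; rewrite coef_take_poly coef0; case: i => [|i]; rewrite ?q0.
rewrite rmorphB /= at_vC /P epq {1}e' rmorphM /= at_vX mulrCA [vV * v]mulrC mulvV mulr1.
by [].
Qed.

Local Notation two := (v + vV).

Lemma K_sq i a : K i * (K i * a) = two *: (K i * a).
Proof.
rewrite mulrA scalerAl; congr (_ * a).
have -> : K i * K i = 1 + (vV - v) *: H i + (v *: H i + (v *: H i + (v * v)%:A)).
  rewrite /K mulrDr !mulrDl -!scalerAl -!scalerAr !mul1r !mulr1 H_sq scalerA.
  by rewrite -!addrA.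
rewrite /K scalerDr scalerA mulrDl [vV * v]mulrC mulvV !scalerDl scale1r scaleNr.
by rewrite !addrA subrK [RHS]addrC !addrA; congr (_ + _); rewrite addrAC.
Qed.

(** Kazhdan-Lusztig multiplication rule. If i is not a descent of w,
    subtracting the terms with mu from K_i C_w removes the constant terms of
    its coefficients, and uniqueness identifies the difference with C_(s_i w).
    If i is a descent of w, this expresses C_w through elements in the image
    of K_i, on which K_i acts by v + v^-1. *)
Lemma kl_left_mul w : (forall i, ldesc i w -> K i * C w = two *: C w) /\
 (forall i, ~~ ldesc i w -> K i * C w =
   C (s i * w)%g + \sum_(z | ldesc i z && (len z < len w)%N) (mu z w)%:~R *: C z).
Proof.
have [k] := ubnP (len w); elim: k w => // k IH w; rewrite ltnS => wk.
have sum2 i : K i * (\sum_(z | ldesc i z && (len z < len w)%N) (mu z w)%:~R *: C z) =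
   two *: (\sum_(z | ldesc i z && (len z < len w)%N) (mu z w)%:~R *: C z).
  rewrite mulr_sumr scaler_sumr; apply: eq_bigr => z /andP[dz lz].
  rewrite -scalerAr; have [h _] := IH z (leq_trans lz wk).
  by rewrite h // !scalerA mulrC.
have part2 i : ~~ ldesc i w -> K i * C w =
   C (s i * w)%g + \sum_(z | ldesc i z && (len z < len w)%N) (mu z w)%:~R *: C z.
  move=> d; apply/eqP; rewrite -subr_eq; apply/eqP; apply: kl_unique.
  - apply: spB; first by apply/sp_Kl/sp_C.
    by apply: sp_sum => z _; apply/spZ/sp_C.
  - rewrite rmorphB rmorphM bar_K bar_C rmorph_sum /=; congr (_ - _).
    by apply: eq_bigr => z _; rewrite barZ bar_C rmorph_int.
  - rewrite crdB crd_sum big1 => [|z /andP[dz lz]].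
      rewrite crd_Kl ?mulKs ?crd_C ?P1w; last exact: sp_C.
      rewrite P_len ?mulr0 ?addr0 ?subr0 //.
        by rewrite (length_up hW m_diag d).
      apply/eqP => e; have := length_up hW m_diag d; rewrite e; lia.
    rewrite crdZ crd_C P_len ?mulr0 //.
      by rewrite (length_up hW m_diag d) ltnW // ltnW.
    by apply: contraTneq lz => <-; rewrite (length_up hW m_diag d) -leqNgt ltnW.
  move=> x xsw; rewrite crdB crd_Kl ?crd_C ?crd_sum; last exact: sp_C.
  case: (boolP (ldesc i x)) => dx; last first.
    have -> : \sum_(z | ldesc i z && (len z < len w)%N) crd x ((mu z w)%:~R *: C z)
       = \sum_(z | ldesc i z && (len z < len w)%N) (P x z * at_v (mu z w)%:P).
      by apply: eq_bigr => z _; rewrite crdZ crd_C at_vC mulrC.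
    apply: vZB; last first.
      apply: vZ_sum => z /andP[dz _]; apply/vZM/P_vZ.
      by apply: contraNneq dx => ->.
    apply: vZD.
      by apply: P_vZ; apply: contraNneq xsw => <-; rewrite mulKs.
    exact/vZM/vZ_v.
  have swx : (s i * x != w)%g by apply: contraNneq xsw => <-; rewrite mulKs.
  have xw : x != w by apply: contraNneq d => <-.
  rewrite (bigID (pred1 x)) /= opprD addrA; apply: vZB; last first.
    apply: vZ_sum => z /andP[_ zx]; rewrite crdZ crd_C -at_vC mulrC.
    by apply/vZM/P_vZ; rewrite eq_sym.
  rewrite -addrA; apply: vZD; first exact: P_vZ.
  have [lx|lx] := ltnP (len x) (len w).
    rewrite (big_pred1 x) => [|z]; last first.
      by rewrite /=; case: eqP => [->|_]; rewrite ?andbF // andbT lx dx.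
    by rewrite crdZ crd_C P1w mulr1; apply: vPE.
  rewrite P_len // mulr0 add0r big_pred0 ?oppr0; first exact: vZ0.
  by move=> z; case: eqP => [->|]; rewrite ?andbF // ltnNge lx andbF.
split=> // i d.
have lw := length_down hW m_diag d.
have [|_ h2] := IH (s i * w)%g; first by rewrite -lw.
have d' : ~~ ldesc i (s i * w)%g by rewrite ldesc_s d.
have K2 : K i * (K i * C (s i * w)%g) = two *: (K i * C (s i * w)%g) := K_sq _ _.
have -> : C w = K i * C (s i * w)%g - \sum_(z | ldesc i z && (len z < len (s i * w)%g)%N)
   (mu z (s i * w)%g)%:~R *: C z.
  by rewrite (h2 i d') mulKs addrK.
rewrite mulrBr K2 scalerBr; congr (_ - _).
rewrite mulr_sumr scaler_sumr; apply: eq_bigr => z /andP[dz lz].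
rewrite -scalerAr; have [|h _] := IH z; first by apply: leq_trans lz _; rewrite ltnW // -lw.
by rewrite h // !scalerA mulrC.
Qed.
End HeckeTheory.

(** * Coefficients on the Kazhdan-Lusztig basis *)

Section KazhdanLusztigBasis.
Local Open Scope ring_scope.
Variables (I : finType) (m : I -> I -> nat) (W : finGroupType) (s : I -> W).
Hypothesis hW : coxeter_system m s.
Hypothesis m_diag : forall i, m i i = 1%N.
Hypothesis ord_st : forall i j, #[s i * s j]%g = m i j.
Hypothesis m_off : forall i j, i != j -> (1 < m i j)%N.
Variables (A : algType laurent) (H : I -> A).
Hypothesis hA : hecke_algebra m H.
Variables (bar : {rmorphism A -> A}).
Hypothesis hbar : bar_involution H bar.
Variable (p : W -> W -> {poly int}).
Hypothesis hp : kl_polynomials s H bar p.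

Local Notation len := (length s).
Local Notation ldesc := (left_descent s).
Local Notation Hw := (standard_basis s H).
Local Notation C := (kl_element s H p).
Local Notation K := (kl_gen H).
Local Notation P := (kl_laurent p).
Local Notation mu := (kl_mu p).
Local Notation two := (v + vV).
Local Notation mulKs := (mulKs hW m_diag).
Local Notation ldesc_s := (ldesc_s hW m_diag).
Local Notation crd := (std_coef hW m_diag ord_st hA).
Local Notation crd_C := (crd_C hW m_diag ord_st hA hp).
Local Notation sp := (in_span hW m_diag ord_st hA).
Local Notation fl := (flat hW m_diag ord_st hA).
Local Notation sp_C := (sp_C hW m_diag ord_st hA hp).
Local Notation sp_Hw := (sp_Hw hW m_diag ord_st hA).
Local Notation P1w := (P1w hp).
Local Notation P_vZ := (P_vZ hp).
Local Notation P_len := (P_len hp).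

Lemma gen_inj : injective s.
Proof.
move=> i j e; apply/eqP; apply: contraT => /m_off.
by rewrite -ord_st e (s_sqr hW m_diag) order1.
Qed.

(** At an element of maximal length in the support only one summand
    contributes to the coordinate. *)
Lemma C_free (c : W -> laurent) : \sum_z c z *: C z = 0 -> forall z, c z = 0.
Proof.
move=> c0 z; apply/eqP; apply: contraT => z0.
case: (arg_maxnP (fun x => len x) (z0 : [pred y | c y != 0] z)) => /= y y0 ymax.
case/eqP: y0; have := congr1 (crd y) c0; rewrite crd_sum crd0 => <-.
rewrite (bigD1 y) //= crdZ crd_C P1w mulr1 big1 ?addr0 // => x xy.
rewrite crdZ crd_C; have [->|x0] := eqVneq (c x) 0; first by rewrite mul0r.
by rewrite P_len ?mulr0 1?eq_sym // ymax.
Qed.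

Definition is_kl_expansion w (q : W -> laurent) :=
  [/\ Hw w = \sum_z q z *: C z, q w = 1,
      forall z, z != w -> vZ (q z)
    & forall z, (len w <= len z)%N -> z != w -> q z = 0].

(** Invert H_w = C_w minus shorter basis elements, by induction on the
    length. *)
Lemma ex_kl_expansion w : exists q, is_kl_expansion w q.
Proof.
have [k] := ubnP (len w); elim: k w => // k IH w; rewrite ltnS => wk.
have : forall x : W, exists q, (len x < k)%N -> is_kl_expansion x q.
  move=> x; have [lx|lx] := ltnP (len x) k; last by exists (fun=> 0).
  by have [q hq] := IH x lx; exists q.
case/boolp.choice => q hq.
pose q' z := (z == w)%:R - \sum_(x | (len x < len w)%N) P x w * q x z.
have hx x : (len x < len w)%N -> is_kl_expansion x (q x).
  by move=> lx; apply: hq; apply: leq_trans lx wk.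
exists q'; split.
- have : C w = Hw w + \sum_(x | (len x < len w)%N) P x w *: Hw x.
    rewrite (CE hp) (bigD1 w) //= P1w scale1r; congr (_ + _).
    rewrite (bigID (fun x => (len x < len w)%N)) /= [X in _ + X]big1 ?addr0.
      apply: eq_bigl => x; case: eqP => [->|]; rewrite ?ltnn ?andbF //.
    by move=> x /andP[xw]; rewrite -leqNgt => lx; rewrite P_len // scale0r.
  move=> eC; have -> : Hw w = C w - \sum_(x | (len x < len w)%N) P x w *: Hw x.
    by rewrite eC addrK.
  rewrite /q'; under [RHS]eq_bigr do rewrite scalerBl scaler_suml.
  rewrite sumrB; congr (_ - _).
    rewrite [RHS](bigD1 w) //= eqxx scale1r big1 ?addr0 // => z zw.
    by rewrite (negbTE zw) scale0r.
  rewrite exchange_big; apply: eq_bigr => x lx /=.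
  have [-> _ _ _] := hx x lx; rewrite scaler_sumr.
  by apply: eq_bigr => z _; rewrite scalerA.
- rewrite /q' eqxx; rewrite big1 ?subr0 // => x lx; have [_ _ _ ->] := hx x lx; rewrite ?mulr0 //.
    exact: ltnW.
  by apply: contraTneq lx => ->; rewrite ltnn.
- move=> z zw; rewrite /q' (negbTE zw) sub0r -sub0r; apply: vZB; first exact: vZ0.
  apply: vZ_sum => x lx; have xw : x != w by apply: contraTneq lx => ->; rewrite ltnn.
  have [r r0 ->] := P_vZ xw.
  have [->|zx] := eqVneq z x; first by have [_ -> _ _] := hx x lx; rewrite mulr1; exists r.
  by have [_ _ /(_ z zx)[r' r'0 ->] _] := hx x lx; rewrite mulrC; apply: vZM; exists r'.
move=> z lz zw; rewrite /q' (negbTE zw) sub0r big1 ?oppr0 // => x lx.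
have [_ _ _ ->] := hx x lx; rewrite ?mulr0 //; first exact: leq_trans (ltnW lx) lz.
by apply: contraTneq lz => ->; rewrite -ltnNge.
Qed.

Definition kl_expansion y z : laurent := projT1 (boolp.choice ex_kl_expansion) y z.
Local Notation q := kl_expansion.

Lemma kl_expansionP y : is_kl_expansion y (q y).
Proof. exact: (projT2 (boolp.choice ex_kl_expansion) y). Qed.

Lemma q1 y : q y y = 1. Proof. by have [] := kl_expansionP y. Qed.
Lemma q_vZ y z : z != y -> vZ (q y z). Proof. by have [_ _ h _] := kl_expansionP y; apply: h. Qed.

(** The coefficient of C_z in a. *)
Definition kl_coef z a := \sum_y crd y a * q y z.
Local Notation kap := kl_coef.

Lemma kapE a : sp a -> a = \sum_z kap z a *: C z.
Proof.
move=> sa; rewrite {1}sa; under eq_bigr => y _.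
  by have [-> _ _ _] := kl_expansionP y; rewrite scaler_sumr; over.
rewrite exchange_big; apply: eq_bigr => z _ /=; rewrite /kap scaler_suml.
by apply: eq_bigr => y _; rewrite scalerA.
Qed.

Lemma kapD z a b : kap z (a + b) = kap z a + kap z b.
Proof. by rewrite /kap -big_split; apply: eq_bigr => y _; rewrite crdD mulrDl. Qed.
Lemma kapZ z c a : kap z (c *: a) = c * kap z a.
Proof. by rewrite /kap mulr_sumr; apply: eq_bigr => y _; rewrite crdZ mulrA. Qed.
Lemma kap0 z : kap z 0 = 0.
Proof. by rewrite -(scale0r 0) kapZ mul0r. Qed.
Lemma kapB z a b : kap z (a - b) = kap z a - kap z b.
Proof. by rewrite kapD -scaleN1r kapZ mulN1r. Qed.
Lemma kap_sum z (J : finType) (Q : pred J) (F : J -> A) :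
  kap z (\sum_(i | Q i) F i) = \sum_(i | Q i) kap z (F i).
Proof. by apply: (big_morph (kap z)) => [a b|]; [exact: kapD | exact: kap0]. Qed.

Lemma kap_Hw z y : kap z (Hw y) = q y z.
Proof.
rewrite /kap (bigD1 y) //= crd_Hw eqxx mul1r big1 ?addr0 // => x xy.
by rewrite crd_Hw (negbTE xy) mul0r.
Qed.

Lemma kap_C z w : kap z (C w) = (z == w)%:R.
Proof.
apply/eqP; rewrite -subr_eq0; apply/eqP.
apply: (C_free (c := fun z => kap z (C w) - (z == w)%:R)).
under eq_bigr do rewrite scalerBl; rewrite sumrB -kapE; last exact: sp_C.
rewrite (bigD1 w) //= eqxx scale1r big1 ?addr0 ?subrr // => x xw.
by rewrite (negbTE xw) scale0r.
Qed.

Lemma kap_comb z (c : W -> laurent) : kap z (\sum_w c w *: C w) = c z.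
Proof.
rewrite kap_sum (bigD1 z) //= kapZ kap_C eqxx mulr1 big1 ?addr0 // => w wz.
by rewrite kapZ kap_C eq_sym (negbTE wz) mulr0.
Qed.

Lemma kap_fl z a : sp a -> kap z (fl a) = kap z^-1%g a.
Proof.
move=> sa; rewrite {1}(kapE sa) fl_sum kap_sum (bigD1 z^-1%g) //=.
rewrite flZ (fl_C hW m_diag ord_st hA hbar hp) kapZ kap_C invgK eqxx mulr1 big1 ?addr0 // => w wz.
rewrite flZ (fl_C hW m_diag ord_st hA hbar hp) kapZ kap_C; case: eqP => [e|]; last by rewrite mulr0.
by rewrite e invgK eqxx in wz.
Qed.

Lemma kap_bar z a : sp a -> kap z (bar a) = barL (kap z a).
Proof.
move=> sa; rewrite {1}(kapE sa) rmorph_sum /=.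
under eq_bigr do rewrite (barZ hbar) (bar_C hp).
by rewrite kap_comb.
Qed.

Lemma kap_KC z i u : kap z (K i * C u) =
  if ldesc i u then two * (z == u)%:R
  else (z == s i * u)%g%:R + (if ldesc i z && (len z < len u)%N then (mu z u)%:~R else 0).
Proof.
have [k1 k2] := kl_left_mul hW m_diag ord_st hA hbar hp u.
case: (boolP (ldesc i u)) => d; first by rewrite k1 // kapZ kap_C.
rewrite k2 // kapD kap_C kap_sum; congr (_ + _); rewrite big_mkcond /=.
rewrite (bigD1 z) //= kapZ kap_C eqxx mulr1 big1 ?addr0 // => x xz.
by case: ifP => // _; rewrite kapZ kap_C eq_sym (negbTE xz) mulr0.
Qed.

Lemma kap_K z i a : sp a -> kap z (K i * a) = \sum_u kap u a * kap z (K i * C u).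
Proof.
move=> sa; rewrite {1}(kapE sa) mulr_sumr kap_sum; apply: eq_bigr => u _.
by rewrite -scalerAr kapZ.
Qed.

Lemma kapK_no z i a : sp a -> ~~ ldesc i z -> kap z (K i * a) = 0.
Proof.
move=> sa d; rewrite kap_K // big1 // => u _; rewrite kap_KC (negbTE d) /= addr0.
case: ifP => [du|/negbT du].
  by case: eqP => [e|]; rewrite ?mulr0 //; rewrite e du in d.
case: eqP => [e|]; rewrite ?mulr0 //; by rewrite e ldesc_s du in d.
Qed.

(** Comparing the coefficients of H_z in K_t C_u = (v + v^-1) C_u gives
    p_(z,u) = v p_(tz,u), whose coefficient of v is the constant term of
    p_(tz,u). *)
Lemma mu_desc z u t : ldesc t u -> ~~ ldesc t z -> mu z u = (s t * z == u)%g%:R.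
Proof.
move=> du dz; have [k1 _] := kl_left_mul hW m_diag ord_st hA hbar hp u.
have := congr1 (crd z) (k1 t du); rewrite crd_Kl; last exact: sp_C.
rewrite (negbTE dz) crdZ !crd_C => e.
have e2 : P z u = v * P (s t * z)%g u.
  have -> : P (s t * z)%g u = vV * P z u.
    by apply: (addIr (v * P z u)); rewrite e; ring.
  by rewrite mulrA mulvV mul1r.
have e3 : p z u = 'X * p (s t * z)%g u.
  by apply: at_v_inj; rewrite rmorphM /= at_vX.
rewrite /kl_mu e3 coefXM /=; have [->|ne] := eqVneq (s t * z)%g u.
  by have [-> _ _ _] := hp u; rewrite coefC eqxx.
by have [r r0 /at_v_inj ->] := P_vZ ne.
Qed.

(** Transpose of the multiplication rule. The elements u contributing to the
    coefficient at z are z, s_i z, and the u without descent i such that mu(z,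
    u) is nonzero; as u has a descent other than i and z has not, mu_desc
    leaves only the neighbours s_t z. *)
Lemma kapK z i a : sp a -> ldesc i z -> (forall j, ldesc j z -> j = i) ->
  kap z (K i * a) = two * kap z a + kap (s i * z)%g a
    + \sum_(t | (t != i) && ~~ ldesc i (s t * z)%g) kap (s t * z)%g a.
Proof.
move=> sa dz uz; rewrite kap_K //.
(* the column u of the matrix of K i, entry by entry *)
have pw u : kap z (K i * C u) = two * (z == u)%:R + (u == s i * z)%g%:R
    + \sum_(t | (t != i) && ~~ ldesc i (s t * z)%g) (u == s t * z)%g%:R.
  rewrite kap_KC dz /=; case: (boolP (ldesc i u)) => du.
    rewrite [X in _ = _ + X]big1 ?addr0 => [|t /andP[_ dt]]; last first.
      by case: eqP => // e; rewrite e (negbTE dt) in du.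
    suff -> : (u == s i * z)%g = false by rewrite addr0.
    by apply: contraTF du => /eqP ->; rewrite ldesc_s dz.
  have -> : (z == u) = false by apply: contraNF du => /eqP <-.
  rewrite mulr0 add0r; congr (_%:R + _).
    by rewrite -(inj_eq (mulgI (s i))) mulKs eq_sym.
  case: (boolP [exists t, (t != i) && (u == s t * z)%g]) => [/existsP[t /andP[ti /eqP eu]]|no].
    have dtz : ~~ ldesc t z by apply: contra ti => /uz ->.
    have dtu : ldesc t u by rewrite eu ldesc_s.
    have lu : (len z < len u)%N by rewrite eu (length_up hW m_diag dtz).
    rewrite lu (mu_desc dtu dtz) eu eqxx (bigD1 t) /=; last by rewrite ti -eu.
    rewrite eqxx big1 ?addr0 // => t' /andP[_ t't].
    by case: eqP => // /mulIg/gen_inj e; rewrite e eqxx in t't.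
  rewrite [RHS]big1 => [|t /andP[ti _]]; last first.
    by case: eqP => // e; case/existsP: no; exists t; rewrite ti e eqxx.
  case: ifP => // lu; have u1 : u != 1%g.
    by apply: contraTneq lu => ->; rewrite length1.
  have [t dt] := ex_ldesc hW m_diag u1.
  have ti : t != i by apply: contraNneq du => <-.
  rewrite (mu_desc dt); last by apply: contra ti => /uz ->.
  by case: eqP => // e; case/existsP: no; exists t; rewrite ti e eqxx.
under eq_bigr do rewrite pw !mulrDr; rewrite !big_split /=; congr (_ + _ + _).
- rewrite (bigD1 z) //= eqxx mulr1 mulrC big1 ?addr0 // => u uz'.
  by rewrite eq_sym (negbTE uz') !mulr0.
- rewrite (bigD1 (s i * z)%g) //= eqxx mulr1 big1 ?addr0 // => u uz'.
  by rewrite (negbTE uz') !mulr0.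
under eq_bigr do rewrite mulr_sumr.
rewrite exchange_big; apply: eq_bigr => t _ /=.
rewrite (bigD1 (s t * z)%g) //= eqxx mulr1 big1 ?addr0 // => u uz'.
by rewrite (negbTE uz') !mulr0.
Qed.

(** * Kazhdan-Lusztig inversion *)

Local Notation w0 := (longest s).
Hypothesis w0c : forall i, (w0 * s i = s i * w0)%g.

(** Up to sign, this is the element C_(w0 u), written with the coefficients
    predicted by Kazhdan-Lusztig inversion. *)
Definition dual_kl u := \sum_x ((-1) ^+ len (w0 * x)%g * kap u (Hw (w0 * x)%g)) *: Hw x.
Local Notation inv := dual_kl.

Lemma ldesc_w0 i x : ldesc i (w0 * x)%g = ~~ ldesc i x.
Proof.
rewrite /left_descent mulgA -w0c -mulgA.
have h1 := length_Mw0 hW m_diag x.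
have h2 := length_Mw0 hW m_diag (s i * x)%g.
have h3 : len (s i * x)%g <> len x.
  move=> e; case: (boolP (ldesc i x)) => d.
    by have := length_down hW m_diag d; rewrite e; lia.
  by have := length_up hW m_diag d; rewrite e; lia.
move: h1 h2 h3; rewrite /left_descent -leqNgt.
move: (len (w0 * x)%g) (len (w0 * (s i * x))%g) (len (s i * x)%g) (len x) (len w0) => a b c d e.
by move=> h1 h2 h3; apply/idP/idP; lia.
Qed.

Lemma sgn_s i y : (-1) ^+ len (s i * y)%g = - (-1) ^+ len y :> laurent.
Proof.
case: (boolP (ldesc i y)) => d.
  by rewrite (length_down hW m_diag d) exprS mulN1r opprK.
by rewrite (length_up hW m_diag d) exprS mulN1r.
Qed.

Lemma sp_dual_kl u : sp (inv u). Proof. exact: sp_comb. Qed.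

Lemma crd_dual_kl x u :
  crd x (inv u) = (-1) ^+ len (w0 * x)%g * kap u (Hw (w0 * x)%g).
Proof. exact: crd_comb. Qed.

(** The generators act on these elements through v + v^-1 minus the transpose
    of their matrices on the Kazhdan-Lusztig elements, which is the effect of
    the sign and of multiplication by w0. *)
Lemma K_dual_kl i u : K i * inv u =
  \sum_u' (two * (u == u')%:R - kap u (K i * C u')) *: inv u'.
Proof.
apply: (sp_eq (hW := hW) (m_diag := m_diag) (ord_st := ord_st) (hA := hA)).
- exact/sp_Kl/sp_dual_kl.
- by apply: sp_sum => u' _; apply/spZ/sp_dual_kl.
move=> x; rewrite crd_Kl; last exact: sp_dual_kl.
rewrite [RHS]crd_sum.
under [RHS]eq_bigr do rewrite crdZ crd_dual_kl.
rewrite !crd_dual_kl; set y := (w0 * x)%g.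
have ey : (w0 * (s i * x) = s i * y)%g by rewrite mulgA w0c -mulgA.
rewrite ey sgn_s; have -> : ldesc i x = ~~ ldesc i y by rewrite ldesc_w0 negbK.
transitivity ((-1) ^+ len y * (two * kap u (Hw y) - kap u (K i * Hw y))); last first.
  rewrite [kap u (K i * _)]kap_K; last exact: sp_Hw.
  have -> : kap u (Hw y) = \sum_u' kap u' (Hw y) * (u == u')%:R.
    rewrite (bigD1 u) //= eqxx mulr1 big1 ?addr0 // => u' h.
    by rewrite eq_sym (negbTE h) mulr0.
  rewrite mulr_sumr -sumrB mulr_sumr; apply: eq_bigr => u' _; ring.
have -> : K i * Hw y = Hw (s i * y)%g + (if ldesc i y then vV else v) *: Hw y.
  rewrite KlE (HlE hW m_diag ord_st hA); case: (ldesc i y); last by rewrite addr0.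
  by rewrite -addrA -scalerDl subrK.
rewrite kapD kapZ; case: (ldesc i y) => /=; ring.
Qed.

Lemma crd_w0_dual_kl u : crd w0 (inv u) = (u == 1%g)%:R.
Proof.
by rewrite crd_dual_kl (w0w0 hW m_diag) length1 expr0 mul1r (Hw1 hW m_diag ord_st hA) -(C1 hW m_diag ord_st hA hbar hp) kap_C.
Qed.

Lemma kap_KC_bar z i u : barL (kap z (K i * C u)) = kap z (K i * C u).
Proof.
rewrite -kap_bar; last exact/sp_Kl/sp_C.
by rewrite rmorphM (bar_K hA hbar) (bar_C hp).
Qed.

Lemma bar_two : barL two = two.
Proof. by rewrite rmorphD /= barL_v barL_vV addrC. Qed.

Lemma crd_w0_bar a : sp a -> crd w0 (bar a) = barL (crd w0 a).
Proof.
move=> sa; rewrite {1}sa rmorph_sum crd_sum (bigD1 w0) //= (barZ hbar) crdZ.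
have [_ ->] := bar_Hw hW m_diag ord_st hA hbar w0 => //.
rewrite eqxx mulr1 big1 ?addr0 // => x xw; rewrite (barZ hbar) crdZ.
have [_ ->] := bar_Hw hW m_diag ord_st hA hbar x; first by rewrite eq_sym (negbTE xw) mulr0.
exact: length_w0.
Qed.

(** The differences between the bars and the elements span a space stable
    under every K_i, because the matrices of the K_i are bar-invariant. They
    have no coordinate at w0, and comparing coordinates at s_i x in the action
    of K_i deduces those at x from those at s_i x; so all coordinates vanish
    by induction on the length of w0 x. *)
Lemma bar_dual_kl u : bar (inv u) = inv u.
Proof.
pose d u := bar (inv u) - inv u.
have spd u' : sp (d u') by apply/spB/sp_dual_kl/(sp_bar hbar)/sp_dual_kl.
have Kd i u' : K i * d u' = \sum_u'' (two * (u' == u'')%:R - kap u' (K i * C u'')) *: d u''.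
  rewrite /d mulrBr -{1}(bar_K hA hbar i) -rmorphM K_dual_kl rmorph_sum -sumrB /=.
  apply: eq_bigr => u'' _; rewrite (barZ hbar) scalerBr; congr (_ *: _ - _).
  by rewrite rmorphB rmorphM /= bar_two rmorph_nat kap_KC_bar.
suff z : forall x u', crd x (d u') = 0.
  apply/eqP; rewrite -subr_eq0; apply/eqP.
  apply: (sp_eq (hW := hW) (m_diag := m_diag) (ord_st := ord_st) (hA := hA)).
  - exact: spd.
  - exact: sp0.
  by move=> x; rewrite z crd0.
move=> x; have [k] := ubnP (len (w0 * x)%g); elim: k x => // k IH x; rewrite ltnS => xk u'.
have [y1|y1] := eqVneq (w0 * x)%g 1%g.
  have -> : x = w0 by rewrite -[x]mul1g -(w0w0 hW m_diag) -mulgA y1 mulg1.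
  by rewrite crdB crd_w0_bar ?crd_w0_dual_kl ?rmorph_nat ?subrr //; exact: sp_dual_kl.
have [i di] := ex_ldesc hW m_diag y1.
have lt : (len (w0 * (s i * x))%g < k)%N.
  apply: leq_trans xk; rewrite (length_down hW m_diag di) ltnS.
  by rewrite !mulgA w0c.
have := congr1 (crd (s i * x)%g) (Kd i u'); rewrite crd_Kl; last exact: spd.
rewrite mulKs (IH _ lt) mulr0 addr0 => ->.
by rewrite crd_sum big1 // => u'' _; rewrite crdZ (IH _ lt) mulr0.
Qed.

(** The signed dual element has the properties that characterise C_(w0 u):
    bar-invariance and coefficients in v Z[v] away from its leading term. *)
Lemma kl_inversion x u :
  P x (w0 * u)%g = (-1) ^+ (len u + len (w0 * x)%g) * kap u (Hw (w0 * x)%g).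
Proof.
have w0K y : (w0 * (w0 * y) = y)%g by rewrite mulgA (w0w0 hW m_diag) mul1g.
have e : (-1) ^+ len u *: inv u = C (w0 * u)%g.
  apply: (kl_unique (hW := hW) (m_diag := m_diag) (ord_st := ord_st) (hA := hA) hbar hp).
  - exact/spZ/sp_dual_kl.
  - by rewrite (barZ hbar) bar_dual_kl rmorphXn rmorphN1.
  - by rewrite crdZ crd_dual_kl w0K kap_Hw q1 mulr1 -exprMn mulrNN mulr1 expr1n.
  move=> y yw; rewrite crdZ crd_dual_kl kap_Hw mulrA -exprD mulrC.
  rewrite (_ : (-1) ^+ _ = at_v ((-1) ^+ (len u + len (w0 * y)%g))); last by rewrite rmorphXn rmorphN1.
  apply/vZM/q_vZ; apply: contraNneq yw => ->; by rewrite w0K.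
by rewrite -crd_C -e crdZ crd_dual_kl mulrA -exprD.
Qed.
End KazhdanLusztigBasis.

(** * Elements with a unique reduced word *)

Section UniqueWords.
Local Open Scope group_scope.
Variables (I : finType) (m : I -> I -> nat) (W : finGroupType) (s : I -> W).
Hypothesis hW : coxeter_system m s.
Hypothesis m_diag : forall i, m i i = 1%N.
Hypothesis ord_st : forall i j, #[s i * s j]%g = m i j.
Hypothesis m_off : forall i j, i != j -> (1 < m i j)%N.

Local Notation len := (length s).
Local Notation wp := (word_prod s).
Local Notation ldesc := (left_descent s).
Local Notation mulKs := (mulKs hW m_diag).
Local Notation coxeter_m_sym := (coxeter_m_sym hW m_diag ord_st).

(** The empty word qualifies, so the identity counts as an element with a
    unique reduced word. *)
Definition unique_word t := len (wp t) = size t /\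
  forall t', wp t' = wp t -> size t' = size t -> t' = t.
Local Notation uniqw := unique_word.

Definition unique_elt z := exists2 t, uniqw t & z = wp t.
Local Notation inU := unique_elt.

Lemma uniqw_cons i t : uniqw (i :: t) -> uniqw t.
Proof.
case=> e u; split.
  by have := length_sle hW i (wp t); have := length_min s t; move: e; rewrite wp_cons /=; lia.
move=> t' et st; suff [] : i :: t' = i :: t by [].
by apply: u; rewrite ?wp_cons ?et //= st.
Qed.

Lemma uniqw_rev t : uniqw t -> uniqw (rev t).
Proof.
case=> e u; split; first by rewrite (wp_rev hW m_diag) (length_inv hW m_diag) size_rev.
move=> t' et st; rewrite -[t']revK; congr rev; apply: u; rewrite ?size_rev //.
  by rewrite (wp_rev hW m_diag) et (wp_rev hW m_diag) invgK.
by rewrite st size_rev.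
Qed.

Lemma inU_inv z : inU z -> inU z^-1.
Proof.
case=> t ut ->; exists (rev t); first exact: uniqw_rev.
by rewrite (wp_rev hW m_diag).
Qed.

Lemma ldesc_word i w : ldesc i w -> exists2 t, wp (i :: t) = w & len w = (size t).+1.
Proof.
move=> d; have [t et st] := ex_reduced hW (s i * w); exists t.
  by rewrite wp_cons et mulKs.
by rewrite (length_down hW m_diag d) st.
Qed.

(** A left descent would be the first letter of a reduced word. *)
Lemma ldesc_uniqw i j t : uniqw (j :: t) -> ldesc i (wp (j :: t)) = (i == j).
Proof.
move=> [e u]; apply/idP/eqP => [/ldesc_word[t' et st]|->].
  by have [] : i :: t' = j :: t by apply: u; rewrite //= -st.
by rewrite /left_descent {1}wp_cons mulKs e /= ltnS; have := length_min s t.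
Qed.

Lemma wp_uniqw_neq1 i t : uniqw (i :: t) -> wp (i :: t) != 1.
Proof. by case=> e _; apply/eqP => e1; move: e; rewrite e1 length1. Qed.

Lemma inU_cons z : inU z -> z != 1 -> exists i t, uniqw (i :: t) /\ z = wp (i :: t).
Proof.
case=> -[|i t] ut ->; first by rewrite wp_nil eqxx.
by exists i, t.
Qed.

(** A braid relation inside the word would produce a second word. *)
Lemma uniqw_braid i j t1 t2 : i != j -> ~ uniqw (t1 ++ alt_word i j (m i j) ++ t2).
Proof.
move=> ij [_ u]; have := u (t1 ++ alt_word j i (m i j) ++ t2).
rewrite !wp_cat !size_cat !size_alt_word (wp_alt_braid hW m_diag ord_st) => /(_ erefl erefl).
move/eqP; rewrite eqseq_cat // eqxx /= => /eqP.
have := ltnW (m_off ij); case: (m i j) => // k _ [ji]; by rewrite ji eqxx in ij.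
Qed.

(** With descents i and j, the element s_j z starts with the alternating word
    of length m i j beginning with j, so the unique word of z starts with the
    rest of it. *)
Lemma ldesc_prefix i j t : uniqw (i :: t) -> j != i ->
  ldesc i (s j * wp (i :: t)) = prefix (alt_word i j (m i j).-1) (i :: t).
Proof.
move=> ut ji; have mp := m_off ji; rewrite (coxeter_m_sym j i) in mp.
have nd : ~~ ldesc j (wp (i :: t)) by rewrite ldesc_uniqw.
have lz : len (wp (i :: t)) = size (i :: t) by case: ut.
have lx := length_up hW m_diag nd.
have [k ek] : exists k, m i j = k.+1 by exists (m i j).-1; lia.
have ek' : m j i = k.+1 by rewrite coxeter_m_sym.
rewrite ek succnK; apply/idP/prefixP => [d|[r er]].
  have dj : ldesc j (s j * wp (i :: t)) by rewrite (ldesc_s hW m_diag).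
  have [y [ey ly]] := dihedral hW m_diag ord_st ji dj d (leqnn _).
  have [u eu su] := ex_reduced hW y; exists u.
  case: ut => _ /(_ (alt_word i j k ++ u)) -> //.
    by rewrite wp_cat eu; apply: (mulgI (s j)); rewrite ey ek' /= wp_cons mulgA.
  by rewrite size_cat size_alt_word su; move: ly; rewrite lx lz ek' /=; lia.
have ex : s j * wp (i :: t) = wp (alt_word i j k.+1 ++ r).
  rewrite er [in LHS]wp_cat [LHS]mulgA -wp_cons -[j :: alt_word i j k]/(alt_word j i k.+1) -ek'.
  by rewrite (wp_alt_braid hW m_diag ord_st) -wp_cat.
rewrite /left_descent {1}ex /= {1}wp_cons mulKs lx lz er.
by apply: leq_ltn_trans (length_min _ _) _; rewrite !size_cat !size_alt_word.
Qed.

(** A second reduced word of s_j z starts with a letter h other than j. Then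
    s_j z starts with both alternating words in j and h, so h is a descent of
    z; hence h = i, but i is not a descent of s_j z. *)
Lemma uniqw_add i j t : uniqw (i :: t) -> j != i ->
  ~~ ldesc i (s j * wp (i :: t)) -> uniqw (j :: i :: t).
Proof.
move=> ut ji nd.
have ndj : ~~ ldesc j (wp (i :: t)) by rewrite ldesc_uniqw.
have lz : len (wp (i :: t)) = size (i :: t) by case: ut.
have lx := length_up hW m_diag ndj.
split; first by rewrite wp_cons lx lz.
move=> [//|h u] eu [su]; have [hj|hj] := eqVneq h j.
  congr (_ :: _); first exact: hj.
  have [_ u0] := ut; apply: u0 => //; apply: (mulgI (s j)).
  by rewrite -[RHS]wp_cons -eu wp_cons hj.
have dh : ldesc h (s j * wp (i :: t)).
  rewrite -wp_cons -eu /left_descent {1}wp_cons mulKs eu wp_cons lx lz /=.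
  by rewrite ltnS -[X in _ <= X]/(size t).+1 -su; exact: length_min.
have dj : ldesc j (s j * wp (i :: t)) by rewrite (ldesc_s hW m_diag).
have jh : j != h by rewrite eq_sym.
have [y [ey ly]] := dihedral hW m_diag ord_st jh dj dh (leqnn _).
suff : ldesc h (wp (i :: t)).
  by rewrite ldesc_uniqw // => /eqP hi; move: nd; rewrite -{1}hi dh.
have [k ek] : exists k, m j h = k.+2.
  by exists (m j h).-2; have := m_off jh; lia.
rewrite ek /= !wp_cons -!mulgA in ey.
have ez : wp (i :: t) = s h * (wp (alt_word j h k) * y) by apply: (mulgI (s j)); rewrite -ey wp_cons.
rewrite /left_descent {1}ez mulKs lz -ltnS -[X in _ < X.+1]lz -lx ly ek.
have [t' <- st'] := ex_reduced hW y; rewrite -wp_cat.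
have := length_min s (alt_word j h k ++ t'); rewrite size_cat size_alt_word -st'; lia.
Qed.
End UniqueWords.

(** * The Hecke algebra on the coefficients at unique reduced words *)

Section CellAction.
Local Open Scope ring_scope.
Variables (I : finType) (m : I -> I -> nat) (W : finGroupType) (s : I -> W).
Hypothesis hW : coxeter_system m s.
Hypothesis m_diag : forall i, m i i = 1%N.
Hypothesis ord_st : forall i j, #[s i * s j]%g = m i j.
Hypothesis m_off : forall i j, i != j -> (1 < m i j)%N.
Variables (A : algType laurent) (H : I -> A).
Hypothesis hA : hecke_algebra m H.
Variables (bar : {rmorphism A -> A}).
Hypothesis hbar : bar_involution H bar.
Variable (p : W -> W -> {poly int}).
Hypothesis hp : kl_polynomials s H bar p.

Local Notation len := (length s).
Local Notation wp := (word_prod s).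
Local Notation ldesc := (left_descent s).
Local Notation rdesc := (right_descent s).
Local Notation Hw := (standard_basis s H).
Local Notation C := (kl_element s H p).
Local Notation K := (kl_gen H).
Local Notation two := (v + vV).
Local Notation sp := (in_span hW m_diag ord_st hA).
Local Notation fl := (flat hW m_diag ord_st hA).
Local Notation kap := (kl_coef hW m_diag ord_st hA hp).
Local Notation inU := (unique_elt s).
Local Notation uniqw := (unique_word s).
Local Notation sp_C := (sp_C hW m_diag ord_st hA hp).
Local Notation sp_Hw := (sp_Hw hW m_diag ord_st hA).
Local Notation rdescE := (rdescE hW m_diag).
Local Notation kapD := (kapD hW m_diag ord_st hA hp).
Local Notation kapB := (kapB hW m_diag ord_st hA hp).
Local Notation kapZ := (kapZ hW m_diag ord_st hA hp).
Local Notation kap_C := (kap_C hW m_diag ord_st hA hp).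
Local Notation kapE := (kapE hp).
Local Notation kap_sum := (kap_sum hW m_diag ord_st hA hp).
Local Notation ldesc_uniqw := (ldesc_uniqw hW m_diag).
Local Notation kapK_no := (kapK_no hbar hp).

Lemma kapK1 i a : sp a -> kap 1%g (K i * a) = 0.
Proof. by move=> sa; apply: kapK_no => //; rewrite (ldesc1 hW m_diag). Qed.

(** In terms of words, left multiplication affects the coefficient at a unique
    reduced word through the words obtained by deleting or adding a first
    letter. The condition on the prefix makes the longer words again unique,
    so that these coefficients form a closed system. *)
Lemma kapKw i t a : sp a -> uniqw (i :: t) ->
  kap (wp (i :: t)) (K i * a) = two * kap (wp (i :: t)) a + kap (wp t) a
    + \sum_(j | (j != i) && ~~ prefix (alt_word i j (m i j).-1) (i :: t))
         kap (wp (j :: i :: t)) a.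
Proof.
move=> sa ut; rewrite (kapK m_off hbar) //; last 2 first.
- by rewrite ldesc_uniqw.
- by move=> j; rewrite ldesc_uniqw // => /eqP.
have -> : (s i * wp (i :: t) = wp t)%g by rewrite wp_cons (mulKs hW m_diag).
congr (_ + _).
apply: eq_big => [j|j _]; last by rewrite [in RHS]wp_cons.
case: (boolP (j == i)) => //= ji.
by rewrite (ldesc_prefix hW m_diag ord_st m_off).
Qed.

Lemma uniqw_addP i j t : uniqw (i :: t) -> j != i ->
  ~~ prefix (alt_word i j (m i j).-1) (i :: t) -> uniqw (j :: i :: t).
Proof.
move=> ut ji np; apply: (uniqw_add hW m_diag ord_st m_off) => //.
by rewrite (ldesc_prefix hW m_diag ord_st m_off).
Qed.

(** The coefficients at unique reduced words only depend on each other, so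
    their common kernel is a left ideal. *)
Lemma U_ideal i a : sp a -> (forall z, inU z -> kap z a = 0) ->
  forall z, inU z -> kap z (K i * a) = 0.
Proof.
move=> sa h _ [[|j t] ut ->].
  by rewrite wp_nil kapK1.
have [d|d] := boolP (ldesc i (wp (j :: t))); last exact: kapK_no.
move: d; rewrite ldesc_uniqw // => /eqP ->.
rewrite kapKw // h; last by exists (j :: t).
rewrite h; last by exists t => //; exact: (uniqw_cons hW ut).
rewrite mulr0 add0r big1 ?addr0 // => l /andP[lj np]; apply: h.
by exists (l :: j :: t) => //; apply: uniqw_addP.
Qed.

Definition Hword t := \prod_(i <- t) H i.

Lemma Hword_cons i t a : Hword (i :: t) * a = K i * (Hword t * a) - v *: (Hword t * a).
Proof. by rewrite /Hword big_cons -mulrA KlE addrK. Qed.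

Lemma sp_Hword t a : sp a -> sp (Hword t * a).
Proof.
move=> sa; elim: t => [|i t IH]; first by rewrite /Hword big_nil mul1r.
by rewrite /Hword big_cons -mulrA; apply: sp_Hl.
Qed.

Lemma U_ideal_word t a : sp a -> (forall z, inU z -> kap z a = 0) ->
  forall z, inU z -> kap z (Hword t * a) = 0.
Proof.
move=> sa h; elim: t => [|i t IH] z uz; first by rewrite /Hword big_nil mul1r h.
rewrite Hword_cons kapB kapZ IH // mulr0 subr0; apply: U_ideal => //.
exact: sp_Hword.
Qed.

(** The coefficient at the identity is the character H_i -> -v, as K_i kills
    it. *)
Lemma kap1_word t a : sp a -> kap 1%g (Hword t * a) = (- v) ^+ size t * kap 1%g a.
Proof.
move=> sa; elim: t => [|i t IH]; first by rewrite /Hword big_nil !mul1r.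
rewrite Hword_cons kapB kapZ kapK1; last exact: sp_Hword.
by rewrite sub0r IH exprS -mulNr mulrA.
Qed.

Lemma barHword_cons i t : bar (Hword (i :: t)) = K i * bar (Hword t) - vV *: bar (Hword t).
Proof.
rewrite /Hword big_cons rmorphM (bar_H hA hbar) /K !mulrDl.
by rewrite -!scalerAl !mul1r scalerBl addrA.
Qed.

Lemma sp_one : sp 1.
Proof. by rewrite -(Hw1 hW m_diag ord_st hA); exact: sp_Hw. Qed.

Lemma sp_Hword1 t : sp (Hword t).
Proof. by rewrite -[Hword t]mulr1; apply/sp_Hword/sp_one. Qed.

Lemma sp_barHword t : sp (bar (Hword t)).
Proof. exact/(sp_bar hbar)/sp_Hword1. Qed.

Lemma kap_one z : kap z 1 = (z == 1%g)%:R.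
Proof. by rewrite -(C1 hW m_diag ord_st hA hbar hp) kap_C. Qed.

Lemma kap1_barword t : v ^+ size t * kap 1%g (bar (Hword t)) = (-1) ^+ size t.
Proof.
elim: t => [|i t IH]; first by rewrite /Hword big_nil rmorph1 kap_one eqxx !mul1r.
rewrite barHword_cons kapB kapZ kapK1 ?sub0r; last exact: sp_barHword.
by rewrite /= !exprS -IH -!mulNr !mulrA; congr (_ * _); rewrite mulrN mulN1r mulrAC mulvV mul1r.
Qed.

(** Since bar H_i = K_i - v^-1, each letter costs at most a factor v^-1. The
    factor v + v^-1 of K_i on a coefficient with first letter i combines with
    - v^-1 to v, which is why the constant term stays zero away from the
    identity. *)
Lemma kap_barword t z : inU z -> z != 1%g ->
  vZ (v ^+ size t * kap z (bar (Hword t))).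
Proof.
elim: t z => [|i t IH] z uz z1.
  by rewrite /Hword big_nil rmorph1 kap_one (negbTE z1) mulr0; exact: vZ0.
have sb := sp_barHword t.
rewrite barHword_cons kapB kapZ /= exprS mulrBr.
have -> : v * v ^+ size t * (vV * kap z (bar (Hword t))) = v ^+ size t * kap z (bar (Hword t)).
  by rewrite mulrACA mulvV mul1r.
have [d|d] := boolP (ldesc i z); last first.
  rewrite kapK_no // mulr0; apply: vZB; [exact: vZ0 | exact: IH].
have [j [u [ut ez]]] := inU_cons uz z1.
move: d; rewrite ez ldesc_uniqw // => /eqP->.
have IHz w : inU w -> w != 1%g -> exists2 q : {poly int}, q`_0 = 0 & v ^+ size t * kap w (bar (Hword t)) = at_v q.
  exact: IH.
have any w : inU w -> exists q : {poly int}, v ^+ size t * kap w (bar (Hword t)) = at_v q.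
  move=> uw; have [->|w1] := eqVneq w 1%g; last by have [q _ e] := IHz w uw w1; exists q.
  by rewrite kap1_barword; exists ((-1) ^+ size t); rewrite rmorphXn rmorphN1.
have sh w : inU w -> vZ (v * v ^+ size t * kap w (bar (Hword t))).
  by move=> /any[q e]; rewrite -mulrA e; apply/vZM/vZ_v.
have uz' : inU (wp (j :: u)) by exists (j :: u).
rewrite kapKw //; set X := kap (wp (j :: u)) _; set S := \sum_(_ | _) _; set Y := kap (wp u) _.
have -> : v * v ^+ size t * (two * X + Y + S) - v ^+ size t * X =
   v ^+ size t * X * at_v ('X ^+ 2) + v * v ^+ size t * Y + v * v ^+ size t * S.
  rewrite rmorphXn /= at_vX; set Z := v ^+ size t.
  transitivity (v ^+ 2 * Z * X + (v * vV) * (Z * X) - Z * X + v * Z * Y + v * Z * S); first by ring.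
  by rewrite mulvV; ring.
apply: vZD; first apply: vZD.
- by apply/vZM/IH; rewrite // wp_uniqw_neq1.
- by apply: sh; exists u => //; exact: (uniqw_cons hW ut).
rewrite /S mulr_sumr; apply: vZ_sum => l /andP[lj np]; apply: sh.
by exists (l :: j :: u) => //; apply: uniqw_addP.
Qed.

(** * Multiplication by the longest element *)

Local Notation w0 := (longest s).
Hypothesis w0c : forall i, (w0 * s i = s i * w0)%g.
Local Notation Z := (Hw w0).

Lemma ex_w0word : exists t, [/\ wp t = w0, size t = len w0,
  Z = Hword t & Z = Hword (rev t)].
Proof.
have [t et st] := ex_reduced hW w0; exists t.
have er : wp (rev t) = w0.
  by rewrite (wp_rev hW m_diag) et; apply/eqP; rewrite eq_invg_mul (w0w0 hW m_diag).
split=> //; first by rewrite -et (HwE hW m_diag ord_st hA) // et st.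
by rewrite -{1}er (HwE hW m_diag ord_st hA) // er size_rev st.
Qed.

Lemma sp_Z a : sp a -> sp (Z * a).
Proof. by have [t [_ _ -> _]] := ex_w0word; apply: sp_Hword. Qed.

Lemma ZH i : Z * H i = H i * Z.
Proof.
rewrite (HrE hW m_diag ord_st hA) (HlE hW m_diag ord_st hA) w0c.
by rewrite /right_descent /left_descent w0c.
Qed.

Lemma ZK i a : Z * (K i * a) = K i * (Z * a).
Proof. by rewrite !KlE mulrDr -scalerAr !mulrA ZH. Qed.

(** bar H_i is the inverse of H_i, and H_w0 can be written with a reduced word
    or with its reverse. *)
Lemma barZZ a : Z * (bar Z * a) = a.
Proof.
have [t [_ _ eZ eZr]] := ex_w0word; rewrite {1}eZr eZ mulrA.
suff -> : Hword (rev t) * bar (Hword t) = 1 by rewrite mul1r.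
elim: (t) => [|i u IH]; first by rewrite /Hword big_nil rmorph1 mul1r.
rewrite rev_cons /Hword -cats1 big_cat big_seq1 big_cons rmorphM /=.
have [_ _ /(_ i) [_ h]] := hbar.
by rewrite mulrA -(mulrA _ (H i)) h mulr1 IH.
Qed.

(** The matrix of multiplication by H_w0 on the Kazhdan-Lusztig elements. *)
Definition w0_mx z u := kap z (Z * C u).
Local Notation M := w0_mx.

Lemma kap_Z z a : sp a -> kap z (Z * a) = \sum_u M z u * kap u a.
Proof.
move=> sa; rewrite {1}(kapE sa) mulr_sumr kap_sum; apply: eq_bigr => u _.
by rewrite -scalerAr kapZ mulrC.
Qed.

Lemma ZC_comm a : sp a -> a * Z = Z * a.
Proof.
move=> ->; rewrite mulr_suml mulr_sumr; apply: eq_bigr => x _.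
rewrite -scalerAl -scalerAr; congr (_ *: _).
have [u <- su] := ex_reduced hW x.
rewrite (HwE hW m_diag ord_st hA) ?su //.
elim: (u) => [|i u' IH]; first by rewrite big_nil mul1r mulr1.
by rewrite big_cons -mulrA IH !mulrA ZH.
Qed.

(** The anti-involution flat fixes H_w0, and H_w0 is central. *)
Lemma fl_Z a : sp a -> fl (Z * a) = Z * fl a.
Proof.
have [t [_ _ eZ eZr]] := ex_w0word => sa.
rewrite -[RHS]ZC_comm; last exact: fl_sp.
rewrite {1}eZ eZr; elim: (t) a sa => [|i u IH] a sa; first by rewrite /Hword big_nil mulr1 mul1r.
rewrite /Hword big_cons -mulrA fl_Hl; last exact: sp_Hword.
by rewrite IH // rev_cons -cats1 /Hword big_cat big_seq1 mulrA.
Qed.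

Lemma M_inv z u : M z^-1%g u^-1%g = M z u.
Proof.
rewrite /M -(fl_C hW m_diag ord_st hA hbar hp) -fl_Z; last exact: sp_C.
by rewrite (kap_fl hbar) ?invgK //; apply/sp_Z/sp_C.
Qed.

Lemma K1C i u : ldesc i u -> K i * C u = two *: C u.
Proof. by move=> d; have [h _] := kl_left_mul hW m_diag ord_st hA hbar hp u; apply: h. Qed.

(** K_i acts on C_u by the nonzero scalar v + v^-1, commutes with H_w0, and is
    killed by the coefficient at z. *)
Lemma M_ldesc z u i : ldesc i u -> ~~ ldesc i z -> M z u = 0.
Proof.
move=> du dz; apply: (laurent_mulI two_neq0); rewrite mulr0 /M -kapZ scalerAr.
by rewrite -(K1C du) // ZK kapK_no //; apply/sp_Z/sp_C.
Qed.

Lemma M_rdesc z u i : rdesc i u -> ~~ rdesc i z -> M z u = 0.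
Proof. by rewrite !rdescE -M_inv; apply: M_ldesc. Qed.

(** The element C_u lies in the left ideal where all coefficients at unique
    reduced words vanish. *)
Lemma M_U z u : inU z -> ~ inU u -> M z u = 0.
Proof.
move=> uz nu; rewrite /M; have [t [_ _ -> _]] := ex_w0word.
apply: U_ideal_word => // [|x ux]; first exact: sp_C.
by rewrite kap_C; case: eqP => // e; case: nu; rewrite -e.
Qed.

(** H_w0 times its bar is 1, and since the elements C_w are bar-invariant, bar
    acts on their coefficients alone. *)
Lemma M_bar z w : \sum_u M z u * barL (M u w) = (z == w)%:R.
Proof.
rewrite -kap_C -(barZZ (C w)) kap_Z; last first.
  by rewrite -[C w](bar_C hp) -rmorphM; apply/(sp_bar hbar)/sp_Z/sp_C.
apply: eq_bigr => u _; congr (_ * _).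
by rewrite /M -(kap_bar hbar) ?rmorphM /= ?(bar_C hp) //; apply/sp_Z/sp_C.
Qed.

(** Apply H_w0 to the expansion of K_i C_u. A summand C_x with x different
    from s_i u has the descent i. If it also has the descent t it has two
    descents, and the coefficient at z vanishes by M_U; otherwise mu_desc
    forces x = s_t u. *)
Lemma kap_step z u t i : inU z -> ldesc t u -> ~~ ldesc i u ->
  kap z (K i * (Z * C u)) =
  M z (s i * u)%g + (if ldesc i (s t * u)%g then M z (s t * u)%g else 0).
Proof.
move=> uz du di; rewrite -ZK.
have [_ k2] := kl_left_mul hW m_diag ord_st hA hbar hp u.
have ti : t != i by apply: contraNneq di => <-.
rewrite k2 // mulrDr kapD; congr (_ + _).
rewrite mulr_sumr kap_sum (bigID (fun x => ldesc t x)) /= big1 ?add0r; last first.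
  move=> x /andP[/andP[dx _] dt]; rewrite -scalerAr kapZ.
  rewrite -[kap z _]/(M z x) M_U ?mulr0 // => -[[|j r] ur ex].
    by rewrite ex wp_nil (ldesc1 hW m_diag) in dt.
  move: dx dt; rewrite ex !ldesc_uniqw // => /eqP ei /eqP et.
  by rewrite et ei eqxx in ti.
have eT (x : W) : ~~ ldesc t x -> kap z (Z * ((kl_mu p x u)%:~R *: C x)) = if (s t * x == u)%g then M z x else 0.
  move=> dx; rewrite (mu_desc hW m_diag ord_st hA hbar hp du dx) -scalerAr kapZ.
  by case: eqP => _; rewrite ?mul1r ?mul0r.
have lt := length_down hW m_diag du.
case: (boolP (ldesc i (s t * u)%g)) => d.
  rewrite (bigD1 (s t * u)%g) /=; last by rewrite d lt ltnS leqnn (ldesc_s hW m_diag) du.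
  rewrite eT ?(ldesc_s hW m_diag) ?du // (mulKs hW m_diag) eqxx big1 ?addr0 //.
  move=> x /andP[/andP[_ dx] xne]; rewrite eT //; case: eqP => // e.
  by rewrite -e (mulKs hW m_diag) eqxx in xne.
rewrite big1 // => x /andP[/andP[dix _] dx]; rewrite eT //; case: eqP => // e.
by rewrite -e (mulKs hW m_diag) dix in d.
Qed.

Lemma kapZ_bar z : kap z (bar Z) = barL (kap z Z).
Proof. by rewrite (kap_bar hbar) //; exact: sp_Hw. Qed.

Lemma M1 z : M z 1%g = kap z Z.
Proof. by rewrite /M (C1 hW m_diag ord_st hA hbar hp) mulr1. Qed.

Lemma kap1_Z : kap 1%g Z = (- v) ^+ len w0.
Proof.
have [t [_ <- -> _]] := ex_w0word; rewrite -[Hword t]mulr1 kap1_word ?kap_one ?eqxx ?mulr1 //.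
exact: sp_one.
Qed.

(** The column of the identity in the relation between the matrix of H_w0 and
    its bar, solved for the term coming from the identity. *)
Lemma z_bar z : inU z -> z != 1%g ->
  kap z Z = - (- v) ^+ len w0 * \sum_(u | u != 1%g) M z u * barL (kap u Z).
Proof.
move=> uz z1; have := M_bar z 1%g; rewrite (negbTE z1) (bigD1 1%g) //= !M1 kap1_Z.
rewrite rmorphXn rmorphN /= barL_v => /eqP; rewrite addr_eq0 => /eqP e.
have e1 : (- v) ^+ len w0 * (- vV) ^+ len w0 = 1.
  by rewrite -exprMn mulrNN mulvV expr1n.
rewrite -[LHS]mulr1 -e1 mulrCA e mulrN -mulNr; congr (_ * _).
by apply: eq_bigr => u _; rewrite M1.
Qed.

Lemma barz_vZ u : inU u -> u != 1%g -> vZ (v ^+ len w0 * barL (kap u Z)).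
Proof.
move=> uu u1; rewrite -kapZ_bar; have [t [_ <- -> _]] := ex_w0word; exact: kap_barword.
Qed.

End CellAction.

(** * Coxeter groups of type B *)

Section TypeB.
Local Open Scope group_scope.
Variables (n : nat) (hn : (1 <= n)%N) (W : finGroupType) (s : 'I_n.+1 -> W).
Hypothesis hW : coxeter_system (@coxeter_B n) s.
Local Notation m := (@coxeter_B n).
Local Notation I := 'I_n.+1.
Local Notation wp := (word_prod s).
Local Notation len := (length s).

Lemma coxeter_B_diag (i : I) : m i i = 1%N.
Proof. by rewrite /coxeter_B eqxx. Qed.

Lemma coxeter_B_off (i j : I) : i != j -> (1 < m i j)%N.
Proof. by rewrite /coxeter_B => /negbTE ->; case: ifP => // _; case: ifP. Qed.

Lemma coxeter_B_sym (i j : I) : m i j = m j i.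
Proof. by rewrite /coxeter_B eq_sym orbC minnC. Qed.

Local Notation X := (I * bool)%type.
Definition lift_fun (g : {perm I}) (x : X) : X := (g x.1, x.2).
Lemma lift_fun_inj g : injective (lift_fun g).
Proof. by case=> x b [y c] [/perm_inj -> ->]. Qed.
Definition liftp g : {perm X} := perm (@lift_fun_inj g).
Lemma liftpM g h : liftp (g * h) = liftp g * liftp h.
Proof. by apply/permP => -[x b]; rewrite permM !permE /lift_fun /= permM. Qed.
Lemma liftp1 : liftp 1 = 1.
Proof. by apply/permP => -[x b]; rewrite permE /lift_fun /= !perm1. Qed.

Definition flip_fun (k : I) (x : X) : X := (x.1, x.2 (+) (x.1 == k)).
Lemma flip_fun_inj k : injective (flip_fun k).
Proof. by apply: can_inj (flip_fun k) _ => -[x b]; rewrite /flip_fun /= -addbA addbb addbF. Qed.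
Definition flip k : {perm X} := perm (@flip_fun_inj k).
Lemma flipE k x b : flip k (x, b) = (x, b (+) (x == k)).
Proof. by rewrite permE. Qed.
Lemma liftpE g x b : liftp g (x, b) = (g x, b).
Proof. by rewrite permE. Qed.
Lemma flip_flip k : flip k * flip k = 1.
Proof. by apply/permP => -[x b]; rewrite permM !permE /flip_fun /= -addbA addbb addbF. Qed.
Lemma flip_comm j k : flip j * flip k = flip k * flip j.
Proof. by apply/permP => -[x b]; rewrite !permM !permE /flip_fun /= addbAC. Qed.
Lemma flip_lift k g : flip k * liftp g = liftp g * flip (g k).
Proof.
by apply/permP => -[x b]; rewrite !permM !permE /flip_fun /lift_fun /= (inj_eq perm_inj).
Qed.

Definition ord_prev (i : I) : I := inord i.-1.
(** The signed permutations: the generator 0 changes the sign of the first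
    coordinate and the generator i exchanges the coordinates i - 1 and i. This
    representation shows that the orders of the products s i * s j are not
    smaller than prescribed. *)
Definition signed_perm (i : I) : {perm X} :=
  if i == ord0 then flip ord0 else liftp (tperm (ord_prev i) i).

Lemma signed_perm_sqr i : signed_perm i * signed_perm i = 1.
Proof.
by rewrite /signed_perm; case: ifP => _; rewrite ?flip_flip // -liftpM tperm2 liftp1.
Qed.

Lemma comm_rel (G : groupType) (x y : G) : x * x = 1 -> y * y = 1 -> x * y = y * x -> (x * y) ^+ 2 = 1.
Proof. by move=> xx yy e; rewrite expgS expg1 {1}e mulgA -(mulgA y) xx mulg1 yy. Qed.

Lemma braid_rel (G : groupType) (x y : G) : x * x = 1 -> y * y = 1 ->
  x * y * x = y * x * y -> (x * y) ^+ 3 = 1.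
Proof.
move=> xx yy e; rewrite !expgS expg0 mulg1 !mulgA e.
by rewrite -!mulgA (mulgA y y) yy mul1g (mulgA x x) xx mul1g yy.
Qed.

(** By symmetry i < j, and the four cases of the Coxeter matrix become
    relations between a sign change and transpositions. *)
Lemma signed_perm_rel : coxeter_relations m signed_perm.
Proof.
move=> i j; wlog ij : i j / (i <= j)%N.
  move=> H; have [/H //|/ltnW/H] := leqP i j.
  rewrite coxeter_B_sym => e; apply: invg_inj; rewrite invg1 -e -expVgn invMg.
  by congr ((_ * _) ^+ _); apply/eqP; rewrite eq_invg_mul signed_perm_sqr.
have [->|ne] := eqVneq i j; first by rewrite coxeter_B_diag expg1 signed_perm_sqr.
have lt : (i < j)%N by rewrite ltn_neqAle ij andbT.
rewrite /coxeter_B (negbTE ne).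
have -> : (j.+1 == i) = false by apply/eqP; lia.
rewrite orbF; have j0 : (j == ord0) = false by apply/eqP => e; rewrite e in lt.
have prj : ord_prev j = j.-1 :> nat by rewrite /ord_prev inordK //; have := ltn_ord j; lia.
have [i0|i0] := eqVneq i ord0.
  rewrite {1 2}/signed_perm i0 eqxx j0; have -> : minn (@ord0 n) j = 0%N by rewrite min0n.
  rewrite eqxx; case: eqP => [j1|j1]; last first.
    apply: comm_rel; rewrite -?liftpM ?tperm2 ?liftp1 ?flip_flip // flip_lift.
    by rewrite tpermD // -val_eqE /= ?prj; apply/eqP; move: j1 lt; rewrite i0 /=; lia.
  rewrite -[4]/(2 * 2)%N expgM; set t := liftp _.
  have tt : t * t = 1 by rewrite /t -liftpM tperm2 liftp1.
  have -> : (flip ord0 * t) ^+ 2 = flip ord0 * flip j.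
    have ft : t * flip ord0 = flip j * t.
      rewrite /t flip_lift tpermR; congr (_ * flip _); apply: val_inj.
      by rewrite /= prj -j1.
    by rewrite expgS expg1 -!mulgA (mulgA t) ft -!mulgA tt mulg1.
  by apply: comm_rel; rewrite ?flip_flip // flip_comm.
rewrite {1 2}/signed_perm (negbTE i0) j0.
have pri : ord_prev i = i.-1 :> nat by rewrite /ord_prev inordK //; have := ltn_ord i; lia.
have i1 : (0 < i)%N by rewrite lt0n.
have -> : (minn i j == 0)%N = false by apply/eqP; lia.
case: eqP => [ji|ji].
  have ej : ord_prev j = i by apply: val_inj; rewrite /= prj; lia.
  apply: braid_rel; rewrite -?liftpM ?tperm2 ?liftp1 //; congr liftp.
  rewrite ej; have cj (x y : {perm I}) : x * x = 1 -> x * y * x = y ^ x.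
    by move=> xx; rewrite conjgE -mulgA; congr (_ * _); apply/eqP; rewrite eq_sym eq_invg_mul xx.
  rewrite !cj ?tperm2 // !tpermJ tpermL tpermR.
  rewrite tpermD ?[in RHS]tpermD //; rewrite -?val_eqE /= ?pri ?prj; apply/eqP; lia.
apply: comm_rel; rewrite -?liftpM ?tperm2 ?liftp1 //; congr liftp.
rewrite conjgC tpermJ !tpermD //; rewrite -?val_eqE /= ?pri ?prj; apply/eqP; lia.
Qed.

Lemma ex_signed_perm : exists f : {multiplicative W -> {perm X}}, forall i, f (s i) = signed_perm i.
Proof. by have [_ _ h] := hW; apply: h; exact: signed_perm_rel. Qed.

Lemma signed_perm_fix (i j : I) b : (i < j)%N -> signed_perm i (j, b) = (j, b).
Proof.
move=> lt; rewrite /signed_perm; case: eqP => [i0|i0].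
  have j0 : (j == ord0) = false by apply/eqP => e; rewrite e in lt.
  by rewrite permE /flip_fun /= j0 addbF.
have pri : ord_prev i = i.-1 :> nat by rewrite /ord_prev inordK //; have := ltn_ord i; lia.
rewrite permE /lift_fun /= tpermD // -val_eqE /= ?pri; apply/eqP; lia.
Qed.

(** The larger of the two generators moves its own coordinate, which the
    smaller one fixes. *)
Lemma sB_neq (i j : I) : i != j -> s i != s j.
Proof.
have [f hf] := ex_signed_perm; wlog lt : i j / (i < j)%N.
  move=> h ne; have := ne; rewrite -val_eqE neq_ltn => /orP[/h|/h h']; first exact.
  by rewrite eq_sym h' // eq_sym.
move=> _; apply/eqP => e; have := signed_perm_fix false lt; rewrite -hf e hf.
rewrite /signed_perm; case: eqP => [j0|_]; first by rewrite j0 in lt.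
rewrite permE /lift_fun /= tpermR => -[] /(congr1 val) /=.
by rewrite /ord_prev inordK; have := ltn_ord j; lia.
Qed.

(** The order divides m i j, which is at most 4; it is not 1 as generators are
    distinct, and for m i j = 4 it is not 2 because the square of the signed
    permutation is not the identity. *)
Lemma order_sB (i j : I) : #[s i * s j] = m i j.
Proof.
have [_ hr _] := hW; have dv : #[s i * s j] %| m i j by rewrite order_dvdn hr.
have s_sqr := s_sqr hW coxeter_B_diag.
have [e|ne] := eqVneq i j; first by rewrite e s_sqr order1 coxeter_B_diag.
have o1 : #[s i * s j] != 1%N.
  rewrite order_eq1; apply: contra (sB_neq ne) => /eqP e.
  by apply/eqP; rewrite -[s i]mulg1 -(s_sqr j) mulgA e mul1g.
have o2 : m i j = 4 -> #[s i * s j] != 2%N.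
  rewrite /coxeter_B (negbTE ne); case: ifP => // adj; case: ifP => // mn _.
  apply/eqP => o; have : (s i * s j) ^+ 2 = 1 by rewrite -o expg_order.
  have [f hf] := ex_signed_perm.
  have f1 : f 1 = 1 by apply: (mulgI (f 1)); rewrite -gmulfM !mulg1.
  rewrite expgS expg1 => /(congr1 f); rewrite !gmulfM !hf f1.
  wlog i0 : i j ne adj mn {o1 o dv} / i = ord0.
    move=> h; have [i0|j0] : i = ord0 \/ j = ord0.
      have /orP[] : (i == 0 :> nat) || (j == 0 :> nat) by move: mn adj; lia.
        by move=> ?; left; apply/eqP.
      by move=> ?; right; apply/eqP.
    - exact: h.
    move=> e; apply: (h j i) => //; [by rewrite eq_sym|by rewrite orbC|by rewrite minnC|].
    transitivity (signed_perm i * (signed_perm i * signed_perm j * (signed_perm i * signed_perm j)) * signed_perm i).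
      by rewrite !mulgA signed_perm_sqr mul1g.
    by rewrite e mulg1 signed_perm_sqr.
  have j1 : j = 1%N :> nat by move: adj; rewrite i0 /=; lia.
  move/permP/(_ (ord0, false)); rewrite !permM perm1 i0 /signed_perm eqxx.
  have -> : (j == ord0) = false by apply/eqP => /(congr1 val) /=; lia.
  have prj : ord_prev j = ord0 by apply: val_inj; rewrite /= /ord_prev inordK j1.
  rewrite prj !(flipE, liftpE) tpermL tpermR eqxx.
  by have -> : (j == ord0) = false by apply/eqP => /(congr1 val) /=; lia.
move: dv o1 o2; have := coxeter_B_off ne.
have : (m i j <= 4)%N by rewrite /coxeter_B; do 3 case: ifP => // _.
move: (m i j) #[s i * s j] => b a b4 b1 dv; have := dvdn_leq (ltnW b1) dv.
case: b b4 b1 dv => [|[|[|[|[|]]]]] // _ _; case: a => [|[|[|[|[|]]]]] // _ _ _ h.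
by have := h erefl.
Qed.

(** The parity of the number of letters 0. It respects the relations because m
    0 j is even for j different from 0. *)
Definition flip_parity (i : I) : {perm bool} := if i == ord0 then tperm true false else 1.
Lemma flip_parity_rel : coxeter_relations m flip_parity.
Proof.
move=> i j; rewrite /flip_parity; have [->|ne] := eqVneq i j.
  by rewrite coxeter_B_diag expg1; case: ifP; rewrite ?tperm2 ?mulg1.
have t2 : tperm true false ^+ 2 = 1 by rewrite expgS expg1 tperm2.
have ev k : ~~ odd k -> tperm true false ^+ k = 1.
  by move=> ok; rewrite -(odd_double_half k) (negbTE ok) add0n -muln2 mulnC expgM t2 expg1n.
case: eqP => [i0|_]; case: eqP => [j0|_]; rewrite ?mulg1 ?mul1g ?expg1n //.
- by move: ne; rewrite i0 j0 eqxx.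
- by apply: ev; rewrite /coxeter_B (negbTE ne) i0 min0n; case: ifP.
by apply: ev; rewrite /coxeter_B (negbTE ne) j0 minn0; case: ifP.
Qed.

(** Conjugate elements have the same image in the commutative group of
    parities. *)
Lemma class_s0 (i : I) x : s i = s ord0 ^ x -> i = ord0.
Proof.
have [_ _ /(_ _ _ flip_parity_rel)[f hf]] := hW => /(congr1 f).
have f1 : f 1 = 1 by apply: (mulgI (f 1)); rewrite -gmulfM !mulg1.
have fV : f x^-1 = (f x)^-1 by apply/eqP; rewrite eq_sym eq_invg_mul -gmulfM mulgV f1.
rewrite conjgE !gmulfM fV !hf /flip_parity eqxx; case: eqP => // _ e.
have : tperm true false = 1 :> {perm bool}.
  by apply: (mulgI (f x)^-1); apply: (mulIg (f x)); rewrite -mulgA -e mulg1 mulVg.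
by move/permP/(_ true); rewrite tpermL perm1.
Qed.

Local Notation w0 := (longest s).

(** Conjugation by w0 preserves lengths, so it permutes the simple reflections
    and preserves the Coxeter matrix. It fixes s 0, which is conjugate to no
    other generator, and then fixes the generators one after the other along
    the path. *)
Lemma w0B_central (i : I) : w0 * s i = s i * w0.
Proof.
have w02 := w0w0 hW coxeter_B_diag.
have th (k : I) : exists j, w0 * s k * w0 = s j.
  have e1 := length_Mw0 hW coxeter_B_diag (s k * w0).
  have e2 := length_w0M hW coxeter_B_diag (s k).
  have l1 : len (w0 * (s k * w0)) = 1%N.
    apply/eqP; rewrite -(eqn_add2r (len (s k * w0))) e1 -e2 (length_s hW coxeter_B_diag).
    by rewrite addnC.
  have [t et st] := ex_reduced hW (w0 * (s k * w0)).
  rewrite l1 in st; case: t et st => [|j [|]] //; rewrite wp1 => ej _.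
  by exists j; rewrite -mulgA ej.
suff h (k : nat) : (k <= n)%N -> w0 * s (inord k) * w0 = s (inord k).
  have := h i; rewrite inord_val -ltnS => /(_ (ltn_ord i)) e.
  by rewrite -{2}e -!mulgA w02 mulg1.
have mm (a b a' b' : I) : w0 * s a * w0 = s a' -> w0 * s b * w0 = s b' -> m a b = m a' b'.
  move=> ea eb; rewrite -!order_sB -ea -eb.
  have -> : w0 * s a * w0 * (w0 * s b * w0) = (s a * s b) ^ w0.
    rewrite conjgE (_ : w0^-1 = w0); last by apply/eqP; rewrite eq_invg_mul w02.
    by rewrite -!mulgA (mulgA w0 w0) w02 mul1g.
  by rewrite orderJ.
elim/ltn_ind: k => k IH kn; have [j ej] := th (inord k).
rewrite ej; congr s; apply: val_inj; rewrite /= inordK //.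
case: k kn IH ej => [|k] kn IH ej.
  suff -> : j = ord0 by [].
  apply: (@class_s0 j w0); rewrite -ej conjgE (_ : w0^-1 = w0).
    by rewrite mulgA (_ : inord 0 = ord0) //; apply: val_inj; rewrite /= inordK.
  by apply/eqP; rewrite eq_invg_mul w02.
have ek := IH k (ltnSn k) (ltnW kn).
have := mm _ _ _ _ ek ej; rewrite /coxeter_B.
have vk : @inord n k = k :> nat by rewrite inordK // ltnS ltnW.
have vk1 : @inord n k.+1 = k.+1 :> nat by rewrite inordK.
have -> : (@inord n k == inord k.+1) = false by apply/eqP => /(congr1 val) /=; rewrite vk vk1; lia.
rewrite vk vk1 eqxx /=; case: k kn IH ej ek vk vk1 => [|k] kn IH ej ek vk vk1.
  rewrite min0n /=; case: eqP => // _; case: ifP => //; lia.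
have -> : (minn k.+1 k.+2 == 0)%N = false by apply/eqP; lia.
case: eqP => // _; case: ifP => // /orP[/eqP <- //|/eqP jk] _.
have ek1 := IH k (ltnW (ltnSn _)) (ltnW (ltnW kn)).
have : s (inord k.+2) = s (inord k).
  apply: (mulgI w0); apply: (mulIg w0); rewrite ej ek1; congr s; apply: val_inj.
  by rewrite /= inordK; lia.
move/eqP; rewrite (negbTE (sB_neq _)) //; apply/eqP => /(congr1 val) /=.
by rewrite !inordK; lia.
Qed.

Local Notation s_sqr := (s_sqr hW coxeter_B_diag).
Local Notation s_inv := (s_inv hW coxeter_B_diag).
Local Notation mulKs := (mulKs hW coxeter_B_diag).

(** * The conjugates of the generator 0 *)

Lemma s_comm (i j : I) : i != j -> (i.+1 == j) || (j.+1 == i) = false -> s i * s j = s j * s i.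
Proof.
move=> ne na; have [_ hr _] := hW; have := hr i j.
rewrite /coxeter_B (negbTE ne) na expgS expg1 => /eqP.
by rewrite -eq_invg_mul invMg !s_inv => /eqP.
Qed.

Lemma s_braid (i j : I) : i.+1 = j :> nat -> i != ord0 -> s i * s j * s i = s j * s i * s j.
Proof.
move=> e i0; have [_ hr _] := hW; have := hr i j.
have ne : i != j by rewrite -val_eqE /= -e; lia.
have mi : (minn i j == 0)%N = false by rewrite -e; move: i0; rewrite -val_eqE /=; lia.
rewrite /coxeter_B (negbTE ne) e eqxx /= -e in mi *; rewrite e in mi *; rewrite mi.
rewrite !expgS expg0 mulg1 => h.
apply: (mulIg (s j * s i * s j)); rewrite !mulgA in h *; rewrite h.
by rewrite -!mulgA mulKs mulKs s_sqr.
Qed.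

Lemma s_braid4 (j : I) : j = 1%N :> nat ->
  s ord0 * s j * s ord0 * s j = s j * s ord0 * s j * s ord0.
Proof.
move=> e; have [_ hr _] := hW; have := hr ord0 j.
have ne : ord0 != j by rewrite -val_eqE /= e.
rewrite /coxeter_B (negbTE ne) e /= !expgS expg0 mulg1 => h.
apply: (mulIg (s ord0 * s j * s ord0 * s j)); rewrite !mulgA in h *; rewrite h.
by rewrite -!mulgA mulKs mulKs mulKs s_sqr.
Qed.

(** The sign change of the coordinate k. *)
Fixpoint refl0 (k : nat) : W := if k is k'.+1 then refl0 k' ^ s (inord k) else s ord0.

(** A generator exchanges two neighbouring sign changes and commutes with the
    other ones. *)
Lemma refl0_conj (k : nat) (i : I) : (k <= n)%N -> exists2 l, (l <= n)%N & refl0 k ^ s i = refl0 l.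
Proof.
have vi (l : nat) : (l <= n)%N -> @inord n l = l :> nat by move=> ?; rewrite inordK.
have cj (x : W) : (x ^ s i) ^ s i = x by rewrite -conjgM s_sqr conjg1.
have far (j : I) l : (l.+1 < j)%N -> (l <= n)%N -> refl0 l ^ s j = refl0 l.
  elim: l => [|l IH] li ln.
    rewrite /= conjgE -s_comm ?mulKs ?s_inv ?mulKs //; first by rewrite -val_eqE /=; lia.
    by rewrite /=; lia.
  rewrite /= -conjgM s_comm; first by rewrite conjgM IH //; lia.
    by rewrite -val_eqE /= vi //; lia.
  by rewrite vi //; apply/negbTE; lia.
have near l : (0 < i)%N -> (i < l)%N -> (l <= n)%N -> refl0 l ^ s i = refl0 l.
  move=> i0 il ln; elim: l il ln => // l IH il ln.
  have [eil|nil] := eqVneq (i : nat) l; last first.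
    rewrite /= -conjgM s_comm; first by rewrite conjgM IH //; lia.
      by rewrite -val_eqE /= vi //; lia.
    by rewrite vi //; apply/negbTE; lia.
  case: l il ln eil IH => [|l] il ln eil IH; first by lia.
  have ei : i = inord l.+1 by apply: val_inj; rewrite /= vi //; lia.
  have e1 : i.+1 = @inord n l.+2 :> nat by rewrite vi // -eil.
  have i1 : i != ord0 by rewrite -val_eqE /=; lia.
  rewrite /= -ei -!conjgM mulgA s_braid // !conjgM.
  by rewrite far // ?vi //; lia.
have zero l : i = ord0 -> (l <= n)%N -> refl0 l ^ s i = refl0 l.
  move=> i0; elim: l => [|l IH] ln; first by rewrite /= i0 conjgE s_inv mulKs.
  case: l ln IH => [|l] ln IH.
    have v1 : @inord n 1 = 1%N :> nat by rewrite vi.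
    have := s_braid4 v1; rewrite /= i0 => b4; rewrite !conjgE !s_inv.
    by rewrite -!mulgA (mulgA _ _ (s ord0)) !mulgA b4 -!mulgA s_sqr mulg1.
  rewrite [refl0 l.+2]/= -conjgM i0 s_comm.
  - by rewrite conjgM -i0 IH //; lia.
  - by rewrite -val_eqE /= vi.
  by rewrite vi.
move=> kn; have ni := ltn_ord i.
have [i0|i0] := eqVneq i ord0; first by exists k => //; apply: zero.
have i1 : (0 < i)%N by move: i0; rewrite -val_eqE /=; lia.
have [lt|gt|eq] := ltngtP (i : nat) k.
- by exists k => //; apply: near.
- have [eq|ne] := eqVneq (i : nat) k.+1; last by exists k => //; apply: far => //; lia.
  exists k.+1; first by lia.
  by rewrite /=; congr (_ ^ s _); apply: val_inj; rewrite /= vi // -eq; lia.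
exists k.-1; first by lia.
case: k eq kn => [|k] eq kn; first by lia.
rewrite /= (_ : inord k.+1 = i) ?cj //; apply: val_inj; by rewrite /= vi.
Qed.

Lemma card_class_s0 : (#|s ord0 ^: [set: W]| <= n.+1)%N.
Proof.
have h w k : (k <= n)%N -> exists2 l, (l <= n)%N & refl0 k ^ w = refl0 l.
  have [t <-] := ex_word hW w; elim: t k => [|i t IH] k kn.
    by exists k; rewrite ?wp_nil ?conjg1.
  have [l ln e] := refl0_conj i kn; rewrite wp_cons conjgM e; exact: IH.
rewrite -[X in (_ <= X)%N]card_ord.
apply: leq_trans (_ : #|[set refl0 (k : 'I_n.+1) | k : 'I_n.+1]| <= _)%N; last exact: leq_imset_card.
apply/subset_leq_card/subsetP => x /imsetP[w _ ->].
have [l ln e] := h w 0%N (leq0n _); rewrite /= in e; rewrite e.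
by apply/imsetP; exists (Ordinal (ln : (l < n.+1)%N)).
Qed.

(** The letters 0 carry distinct conjugates of s 0, of which there are at most
    n + 1. At least one letter is 0, since s 0 is an inversion of w0 and
    occurs among the reflections of the word. *)
Lemma count_zero t : wp t = w0 -> size t = len w0 ->
  (0 < count_mem ord0 t <= n.+1)%N.
Proof.
move=> et st; have rt : len (wp t) = size t by rewrite et st.
rewrite (leq_trans (count_letter hW coxeter_B_diag ord0 rt)) ?card_class_s0 // andbT.
have r0 : s ord0 \in refl_seq s t.
  by rewrite -(inversion_mem hW coxeter_B_diag) // et -[s ord0]conjg1 (inversion_w0 hW).
have [k kt ek] := nthP 1 r0; rewrite size_refl_seq in kt.
have := refl_seq_class s ord0 kt; rewrite ek => /imsetP[x _ e].
have e0 : nth ord0 t k = ord0.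
  by apply: (class_s0 (x := x^-1)); rewrite e conjgK.
by rewrite -has_count; apply/hasP; exists (nth ord0 t k); rewrite ?mem_nth // e0 /=.
Qed.
End TypeB.

(** * Unique reduced words in type B *)

Section WordsB.
Local Open Scope group_scope.
Variables (n : nat) (hn : (1 <= n)%N) (W : finGroupType) (s : 'I_n.+1 -> W).
Hypothesis hW : coxeter_system (@coxeter_B n) s.
Local Notation m := (@coxeter_B n).
Local Notation I := 'I_n.+1.
Local Notation uniqw := (unique_word s).
Local Notation hd := (@coxeter_B_diag n).
Local Notation ho := (order_sB hn hW).
Local Notation hf := (@coxeter_B_off n).
Local Notation prefix' i j t := (prefix (alt_word i j (m i j).-1) (i :: t)).

Definition adj (i j : I) := (i.+1 == j) || (j.+1 == i).

Lemma coxeter_B_far (i j : I) : i != j -> ~~ adj i j -> m i j = 2.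
Proof. by rewrite /adj /coxeter_B => /negbTE -> /negbTE ->. Qed.

Lemma coxeter_B_3 (i j : I) : adj i j -> (0 < i)%N -> (0 < j)%N -> m i j = 3.
Proof.
rewrite /adj /coxeter_B => a i0 j0; rewrite a.
case: eqP => [e|_]; first by move: a; rewrite e; lia.
by have -> : (minn i j == 0)%N = false by lia.
Qed.

Lemma coxeter_B_4 (i j : I) : adj i j -> minn i j = 0%N -> m i j = 4.
Proof.
rewrite /adj /coxeter_B => a mn; rewrite a mn.
by case: eqP => // e; move: a; rewrite e; lia.
Qed.

Lemma adj_neq (i j : I) : adj i j -> i != j.
Proof. by rewrite /adj -val_eqE /=; lia. Qed.

Lemma uniqw_ii (i : I) t : ~ uniqw (i :: i :: t).
Proof.
case=> e _; have := length_min s t; move: e; rewrite !wp_cons (mulKs hW hd) /=; lia.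
Qed.

Lemma uniqw_adj (i j : I) t : uniqw (i :: j :: t) -> adj i j.
Proof.
move=> u; apply: contraT => na.
have [e|ne] := eqVneq i j; first by rewrite e in u; case: (uniqw_ii u).
have [] := @uniqw_braid _ _ _ _ hW hd ho hf i j [::] t ne.
by rewrite coxeter_B_far.
Qed.

Lemma uniqw_iji (i j : I) t : uniqw (i :: j :: i :: t) -> (0 < i)%N -> (0 < j)%N -> False.
Proof.
move=> u i0 j0; have a := uniqw_adj u; have ne := adj_neq a.
have [] := @uniqw_braid _ _ _ _ hW hd ho hf i j [::] t ne.
by rewrite coxeter_B_3.
Qed.

(** If neither letter is 0, already the factor i j i is impossible; otherwise
    the braid relation of length 4 applies. *)
Lemma uniqw_ijij (i j : I) t : uniqw (i :: j :: i :: j :: t) -> False.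
Proof.
move=> u; have a := uniqw_adj u; have ne := adj_neq a.
have [m0|m0] := eqVneq (minn i j) 0%N; last first.
  by apply: (uniqw_iji u); lia.
have [] := @uniqw_braid _ _ _ _ hW hd ho hf i j [::] t ne.
by rewrite coxeter_B_4.
Qed.

(** A word climbing among the letters above 0 never turns around, since
    turning would give a factor i j i. *)
Lemma uniqw_asc (i j : I) t : uniqw (i :: j :: t) -> (0 < i)%N -> j = i.+1 :> nat ->
  (j <= last j t)%N.
Proof.
elim: t i j => [|k t IH] i j u i0 ji //=.
have u' : uniqw (j :: k :: t) := uniqw_cons hW u.
have := uniqw_adj u'; rewrite /adj => /orP[/eqP jk|/eqP kj].
  by have := IH _ _ u' (_ : 0 < j)%N (esym jk); rewrite ji => /(_ isT); lia.
have e : k = i by apply: val_inj; rewrite /=; lia.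
by move: u; rewrite e => /uniqw_iji; case; lia.
Qed.

Definition o1 : I := inord 1.
Lemma o1E : o1 = 1%N :> nat.
Proof. by rewrite /o1 inordK. Qed.

Lemma asc1 (k : I) t : uniqw (o1 :: k :: t) -> 2 = k -> last k t != ord0 /\ last k t != o1.
Proof.
move=> u k2; have := uniqw_asc u; rewrite o1E -k2 => /(_ isT erefl).
by rewrite -!val_eqE /= o1E => h; split; lia.
Qed.

(** After 0 1 the word either keeps climbing, away from its first letter, or
    returns to 0, and then it must stop before a factor 0 1 0 1. *)
Lemma class00 t : uniqw (ord0 :: t) -> last ord0 t = ord0 -> t = [::] \/ t = [:: o1; ord0].
Proof.
case: t => [|j t] u; first by left.
have := uniqw_adj u; rewrite /adj orbF => /eqP j1; have {j1} ej : j = o1.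
  by apply: val_inj; rewrite /= o1E -j1.
rewrite {j}ej in u *; case: t u => [_ /= /(congr1 val)|k t u].
  by rewrite /= o1E.
have u' := uniqw_cons hW u; have := uniqw_adj u'; rewrite /adj o1E => /orP[/eqP k2|/eqP k0].
  by have [h _] := asc1 u' k2; move=> /= e; rewrite e eqxx in h.
have ek : k = ord0 by apply: val_inj => /=; lia.
rewrite ek in u *; case: t u {u'} => [|l t] u; first by right.
have := uniqw_adj (uniqw_cons hW (uniqw_cons hW u)); rewrite /adj orbF => /eqP l1.
have el : l = o1 by apply: val_inj; rewrite /= o1E -l1.
by rewrite el in u; case: (uniqw_ijij u).
Qed.

(** After 1 the word either keeps climbing or goes to 0 and back, and then it
    must stop before a factor 1 0 1 0. *)
Lemma class11 t : uniqw (o1 :: t) -> last o1 t = o1 -> t = [::] \/ t = [:: ord0; o1].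
Proof.
case: t => [|j t] u; first by left.
have := uniqw_adj u; rewrite /adj o1E => /orP[/eqP k2|/eqP k0].
  by have [_ h] := asc1 u k2; move=> /= e; rewrite e eqxx in h.
have ek : j = ord0 by apply: val_inj => /=; lia.
rewrite {j k0}ek in u *; case: t u => [_ /= /(congr1 val)|l t u]; first by rewrite /= o1E.
have u' := uniqw_cons hW u; have := uniqw_adj u'; rewrite /adj orbF => /eqP l1.
have el : l = o1 by apply: val_inj; rewrite /= o1E -l1.
rewrite {l l1}el in u u' *; case: t u u' => [|k t] u u'; first by right.
have u'' := uniqw_cons hW u'; have := uniqw_adj u''; rewrite /adj o1E => /orP[/eqP k2|/eqP k0].
  by have [_ h] := asc1 u'' k2; move=> /= e; rewrite e eqxx in h.
have ek : k = ord0 by apply: val_inj => /=; lia.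
by rewrite ek in u; case: (uniqw_ijij u).
Qed.

Lemma uniqw1 (i : I) : uniqw [:: i].
Proof.
split; first by rewrite wp1 (length_s hW hd).
case=> [|j []] // e _; congr [:: _]; apply: (gen_inj hW hd ho hf).
by rewrite -!wp1.
Qed.

Lemma adj01 : adj ord0 o1. Proof. by rewrite /adj o1E. Qed.
Lemma adj10 : adj o1 ord0. Proof. by rewrite /adj o1E. Qed.
Lemma m01 : m ord0 o1 = 4. Proof. by rewrite coxeter_B_4 ?adj01 ?min0n. Qed.
Lemma m10 : m o1 ord0 = 4. Proof. by rewrite coxeter_B_4 ?adj10 ?minn0. Qed.
Lemma o1_neq0 : o1 != ord0. Proof. by rewrite -val_eqE /= o1E. Qed.
Lemma o0_neq1 : ord0 != o1. Proof. by rewrite eq_sym o1_neq0. Qed.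

Local Notation addP := (uniqw_addP hW hd ho hf).

Lemma uniqw10 : uniqw [:: o1; ord0].
Proof. by apply: addP; [exact: uniqw1|exact: o1_neq0|rewrite m01]. Qed.
Lemma uniqw01 : uniqw [:: ord0; o1].
Proof. by apply: addP; [exact: uniqw1|exact: o0_neq1|rewrite m10 /= ?eqxx ?andbF]. Qed.
Lemma uniqw010 : uniqw [:: ord0; o1; ord0].
Proof. by apply: addP; [exact: uniqw10|exact: o0_neq1|rewrite m10 /= !eqxx]. Qed.
Lemma uniqw101 : uniqw [:: o1; ord0; o1].
Proof. by apply: addP; [exact: uniqw01|exact: o1_neq0|rewrite m01 /= !eqxx]. Qed.

Fixpoint desc_word k : seq I := if k is k'.+1 then inord k :: desc_word k' else [:: ord0].

Lemma uniqw_desc_word k : (k <= n)%N -> uniqw (desc_word k).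
Proof.
elim: k => [|[|k] IH] kn; [exact: uniqw1 | exact: uniqw10 |].
have v1 : @inord n k.+1 = k.+1 :> nat by rewrite inordK //; lia.
have v2 : @inord n k.+2 = k.+2 :> nat by rewrite inordK //; lia.
apply: addP; first by apply: IH; exact: ltnW.
  by rewrite -val_eqE /= v1 v2; lia.
rewrite coxeter_B_3 ?v1 ?v2 //; last by rewrite /adj v1 v2 eqxx.
rewrite /= eqxx /=; case: k v2 kn {IH v1} => [|k] v2 kn.
  by rewrite /= andbT -val_eqE /= v2.
rewrite /= prefix0s andbT -val_eqE /= v2 inordK; lia.
Qed.

Lemma far_prefix (i j : I) t : j != i -> ~~ adj i j -> prefix' i j t.
Proof. by move=> ji na; rewrite coxeter_B_far 1?eq_sym //= eqxx prefix0s. Qed.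

(** This lemma and the next ones find the letters that may be put in front of
    a word, that is, the summands in the multiplication rule for coefficients
    at unique reduced words. *)
Lemma letters0 (j : I) : (j != ord0) && ~~ prefix' ord0 j [::] = (j == o1).
Proof.
have [->|j1] := eqVneq j o1; first by rewrite o1_neq0 m01.
have [//|j0] := eqVneq j ord0; rewrite far_prefix //.
by apply: contra j1; rewrite /adj orbF => /eqP e; rewrite -val_eqE /= o1E -e.
Qed.

Lemma letters01 (j : I) : (j != ord0) && ~~ prefix' ord0 j [:: o1] = (j == o1).
Proof.
have [->|j1] := eqVneq j o1; first by rewrite o1_neq0 m01 /= !eqxx.
have [//|j0] := eqVneq j ord0; rewrite far_prefix //.
by apply: contra j1; rewrite /adj orbF => /eqP e; rewrite -val_eqE /= o1E -e.
Qed.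

Lemma letters010 (j : I) : (j != ord0) && ~~ prefix' ord0 j [:: o1; ord0] = false.
Proof.
have [->|j1] := eqVneq j o1; first by rewrite o1_neq0 m01 /= !eqxx.
have [//|j0] := eqVneq j ord0; rewrite far_prefix //.
by apply: contra j1; rewrite /adj orbF => /eqP e; rewrite -val_eqE /= o1E -e.
Qed.

Lemma rule_desc k (j : I) : (k.+2 <= n)%N ->
  (j != inord k.+2) && ~~ prefix' (inord k.+2) j (desc_word k.+1) = (j == k.+3 :> nat).
Proof.
move=> kn; set i := inord k.+2.
have vi : i = k.+2 :> nat by rewrite /i inordK //; lia.
have v1 : @inord n k.+1 = k.+1 :> nat by rewrite inordK //; lia.
have [eji|ji] := eqVneq j i; first by rewrite eji /= vi; lia.
case: (boolP (adj i j)) => [a|na]; last first.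
  rewrite far_prefix //=; apply/esym/negbTE; apply: contra na.
  by rewrite /adj vi => /eqP ->; rewrite eqxx.
have j0 : (0 < j)%N by move: a; rewrite /adj vi; lia.
rewrite coxeter_B_3 ?vi // /= eqxx prefix0s andbT /= -val_eqE /= v1.
by move: a; rewrite /adj vi; lia.
Qed.

Lemma letters10 (j : I) : (j != o1) && ~~ prefix' o1 j [:: ord0] =
  (j == ord0) || (j == 2%N :> nat).
Proof.
have [->|j0] := eqVneq j ord0; first by rewrite o0_neq1 m10 /= !eqxx.
have [->|j1] := eqVneq j o1; first by rewrite o1E.
have jp : (0 < j)%N by move: j0; rewrite -val_eqE /=; lia.
case: (boolP (adj o1 j)) => [a|na]; last first.
  rewrite far_prefix //=; apply/esym/negbTE; apply: contra na.
  by rewrite /adj o1E => /eqP ->.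
rewrite coxeter_B_3 ?o1E //= eqxx andbT (negbTE j0) /=.
by move: a; rewrite /adj o1E; lia.
Qed.

End WordsB.

(** * A recursion and a divisibility for polynomials *)

Section PolyLemmas.
Local Open Scope ring_scope.

(** Identities in Z[v, v^-1] become ring identities in two independent
    variables once the quotient by v v^-1 - 1 is supplied. *)
Lemma eq_mod_vV (x y q : laurent) : x - y = (v * vV - 1) * q -> x = y.
Proof. by rewrite mulvV subrr mul0r => /eqP; rewrite subr_eq0 => /eqP. Qed.

Lemma v_sub_vV_neq0 : v - vV != 0.
Proof.
apply/eqP => /(congr1 (fun t => t * v)); rewrite mul0r mulrBl [vV * _]mulrC mulvV.
rewrite -at_vX -[1](rmorph1 at_v) -rmorphM -rmorphB -[0](rmorph0 at_v) => /at_v_inj.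
by move/(congr1 (fun q : {poly int} => q`_0)); rewrite coefB coefMX !coefC.
Qed.

(** The recursion of the Chebyshev polynomials, solved backwards from the end
    where the sequence vanishes. *)
Lemma chebyshev_chain (y : nat -> laurent) n :
  (forall k, (k < n)%N -> (v + vV) * y k.+1 + y k + y k.+2 = 0) -> y n.+1 = 0 ->
  forall j, (j <= n)%N ->
    (v - vV) * y (n - j)%N = (-1) ^+ j * ((v ^+ j.+1 - vV ^+ j.+1) * y n).
Proof.
move=> rec yn j; elim/ltn_ind: j => -[|[|j]] IH jn.
- by rewrite subn0 expr0 mul1r !expr1.
- have := rec (n - 1)%N; rewrite subn1 prednK // => /(_ (leqnn _)); rewrite yn addr0.
  move/eqP; rewrite addrC addr_eq0 => /eqP ->; rewrite expr1 !expr2; ring.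
have := IH j.+1 (ltnSn _) (ltnW jn); have := IH j (ltnW (ltnSn _)) (ltnW (ltnW jn)).
set c := (n - j.+2)%N.
have -> : (n - j.+1 = c.+1)%N by rewrite /c; lia.
have -> : (n - j = c.+2)%N by rewrite /c; lia.
move=> h2 h1; have lc : (c < n)%N by rewrite /c; lia.
have -> : y c = - ((v + vV) * y c.+1 + y c.+2).
  by apply/eqP; rewrite -subr_eq0 -(rec c lc); apply/eqP; ring.
rewrite mulrN mulrDr mulrCA h1 h2 !exprS.
move: (v ^+ j) (vV ^+ j) ((-1) ^+ j) (y n) => a b e d.
by apply: (@eq_mod_vV _ _ (e * d * (a * v - b * vV))); ring.
Qed.

(** The lowest and the highest term of a nonzero multiple of X^a + 1 are at
    least a apart and have the coefficients of the lowest and of the highest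
    term of the cofactor. When only two terms at distance l <= a occur, the
    cofactor is a monomial. *)
Lemma poly_rigid (Q : {poly int}) a j l (d e : int) :
  d != 0 -> e != 0 -> (0 < l <= a)%N ->
  Q * ('X^a + 1) = d *: 'X^j + e *: 'X^(j + l)%N -> l = a /\ d = e.
Proof.
move=> d0 e0 /andP[l0 la] eQ.
have a0 : (0 < a)%N by lia.
have cL i : (Q * ('X^a + 1))`_i = (if (i < a)%N then 0 else Q`_(i - a)) + Q`_i.
  by rewrite mulrDr mulr1 coefD coefMXn.
have cR i : (Q * ('X^a + 1))`_i = d * (i == j)%:R + e * (i == j + l)%N%:R.
  by rewrite eQ coefD !coefZ !coefXn.
have cR0 i : i != j -> i != (j + l)%N -> (Q * ('X^a + 1))`_i = 0.
  by move=> /negbTE h1 /negbTE h2; rewrite cR h1 h2 !mulr0 addr0.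
have Q0 : Q != 0.
  apply: contraNneq d0 => Q0; have := cR j; rewrite Q0 mul0r coef0 eqxx mulr1.
  have -> : (j == j + l)%N = false by apply/eqP; lia.
  by rewrite mulr0 addr0 => <-.
have exi : exists i, Q`_i != 0.
  by exists (size Q).-1; rewrite -lead_coefE lead_coef_eq0.
pose i0 := ex_minn exi.
have [Qi0 mi0] : Q`_i0 != 0 /\ forall i, (i < i0)%N -> Q`_i = 0.
  rewrite /i0; case: ex_minnP => i Qi mi; split=> // k ki.
  by apply/eqP; apply: contraTT ki => /mi; rewrite -leqNgt.
have ci0 : (Q * ('X^a + 1))`_i0 = Q`_i0.
  rewrite cL; case: ltnP => [|h]; first by rewrite add0r.
  by rewrite mi0 ?add0r //; lia.
set k := (size Q).-1.
have Qk : Q`_k != 0 by rewrite /k -lead_coefE lead_coef_eq0.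
have big i : (k < i)%N -> Q`_i = 0.
  move=> h; apply: nth_default; have sQ : (0 < size Q)%N by rewrite size_poly_gt0.
  by rewrite -(prednK sQ).
have ck : (Q * ('X^a + 1))`_(k + a)%N = Q`_k.
  rewrite cL ltnNge leq_addl /= addnK (big (k + a)%N) ?addr0 //; lia.
have i0k : (i0 <= k)%N by rewrite leqNgt; apply: contra Qk => /mi0 ->.
have hi : i0 = j \/ i0 = (j + l)%N.
  have [->|n1] := eqVneq i0 j; first by left.
  have [->|n2] := eqVneq i0 (j + l)%N; first by right.
  by move: Qi0; rewrite -ci0 cR0 ?eqxx.
have hk : (k + a = j)%N \/ (k + a = j + l)%N.
  have [->|n1] := eqVneq (k + a)%N j; first by left.
  have [->|n2] := eqVneq (k + a)%N (j + l)%N; first by right.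
  by move: Qk; rewrite -ck cR0 ?eqxx.
have [ei ek] : i0 = j /\ k = j by case: hi; case: hk; lia.
have el : l = a by case: hk; lia.
split=> //; have := cR j; rewrite -{1}ei ci0 eqxx mulr1.
have -> : (j == j + l)%N = false by apply/eqP; lia.
rewrite mulr0 addr0 => <-; have := cR (k + a)%N; rewrite ck.
have -> : (k + a == j)%N = false by apply/eqP; lia.
by rewrite ek el eqxx mulr0 add0r mulr1 ei.
Qed.

End PolyLemmas.

(** * The matrix of H_w0 in type B *)

Section LongestElementB.
Local Open Scope ring_scope.
Variables (n : nat) (hn : (1 <= n)%N) (W : finGroupType) (s : 'I_n.+1 -> W).
Hypothesis hW : coxeter_system (@coxeter_B n) s.
Variables (A : algType laurent) (H : 'I_n.+1 -> A).
Hypothesis hA : hecke_algebra (@coxeter_B n) H.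
Variables (bar : {rmorphism A -> A}).
Hypothesis hbar : bar_involution H bar.
Variable (p : W -> W -> {poly int}).
Hypothesis hp : kl_polynomials s H bar p.

Local Notation m := (@coxeter_B n).
Local Notation I := 'I_n.+1.
Local Notation hd := (@coxeter_B_diag n).
Local Notation ho := (order_sB hn hW).
Local Notation hf := (@coxeter_B_off n).
Local Notation hc := (w0B_central hn hW).
Local Notation len := (length s).
Local Notation wp := (word_prod s).
Local Notation ldesc := (left_descent s).
Local Notation rdesc := (right_descent s).
Local Notation Hw := (standard_basis s H).
Local Notation C := (kl_element s H p).
Local Notation K := (kl_gen H).
Local Notation two := (v + vV).
Local Notation sp := (in_span hW hd ho hA).
Local Notation kap := (kl_coef hW hd ho hA hp).
Local Notation M := (w0_mx hW hd ho hA hp).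
Local Notation uniqw := (unique_word s).
Local Notation inU := (unique_elt s).
Local Notation w0 := (longest s).
Local Notation Z := (Hw w0).
Local Notation o0 := (ord0 : I).
Local Notation o1 := (o1 n).
Local Notation ldesc_uniqw := (ldesc_uniqw hW hd).
Local Notation M_ldesc := (M_ldesc hW hd ho hA hbar hp hc).
Local Notation M_inv := (M_inv hW hd ho hA hbar hp hc).
Local Notation s_inv := (s_inv hW hd).
Local Notation kapKw := (kapKw hf hbar hp).
Local Notation kap_step := (kap_step hW hd ho hf hA hbar hp hc).
Local Notation kapK_no := (kapK_no hbar hp).

Lemma sp_ZC u : sp (Z * C u).
Proof. by apply/sp_Z/(sp_C _ _ _ _ hp). Qed.

Lemma inUw t : uniqw t -> inU (wp t). Proof. by exists t. Qed.

Lemma M_e u i : ldesc i u -> M 1%g u = 0.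
Proof. by move=> d; apply: (M_ldesc d); rewrite (ldesc1 hW hd). Qed.

Lemma M_head i t u j : uniqw (i :: t) -> ldesc j u -> j != i -> M (wp (i :: t)) u = 0.
Proof. by move=> ut d ji; apply: (M_ldesc d); rewrite ldesc_uniqw. Qed.

Lemma ld1 (i : I) t : uniqw (i :: t) -> ldesc i (wp (i :: t)).
Proof. by move=> ut; rewrite ldesc_uniqw. Qed.

Lemma nld (i j : I) t : uniqw (i :: t) -> j != i -> ~~ ldesc j (wp (i :: t)).
Proof. by move=> ut ji; rewrite ldesc_uniqw. Qed.

Local Notation u0 := (uniqw1 hn hW o0).
Local Notation u1 := (uniqw1 hn hW o1).
Local Notation u10 := (uniqw10 hn hW).
Local Notation u01 := (uniqw01 hn hW).
Local Notation u010 := (uniqw010 hn hW).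
Local Notation u101 := (uniqw101 hn hW).
Local Notation n10 := (o1_neq0 hn).
Local Notation n01 := (o0_neq1 hn).

Local Notation w_0 := (wp [:: o0]).
Local Notation w_1 := (wp [:: o1]).
Local Notation w_10 := (wp [:: o1; o0]).
Local Notation w_01 := (wp [:: o0; o1]).
Local Notation w_010 := (wp [:: o0; o1; o0]).
Local Notation w_101 := (wp [:: o1; o0; o1]).

Lemma step_10 z : inU z -> kap z (K o1 * (Z * C w_0)) = M z w_10.
Proof.
have e : (s o0 * w_0 = 1)%g by rewrite wp1 (s_sqr hW hd).
move=> uz; rewrite (kap_step uz (ld1 u0) (nld u0 n10)) -wp_cons.
by rewrite e (ldesc1 hW hd) addr0.
Qed.

Lemma step_01 z : inU z -> kap z (K o0 * (Z * C w_1)) = M z w_01.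
Proof.
have e : (s o1 * w_1 = 1)%g by rewrite wp1 (s_sqr hW hd).
move=> uz; rewrite (kap_step uz (ld1 u1) (nld u1 n01)) -wp_cons.
by rewrite e (ldesc1 hW hd) addr0.
Qed.

Lemma step_101 z : inU z -> kap z (K o1 * (Z * C w_01)) = M z w_101 + M z w_1.
Proof.
move=> uz; rewrite (kap_step uz (ld1 u01) (nld u01 n10)) -wp_cons.
have -> : (s o0 * w_01 = w_1)%g by rewrite wp_cons (mulKs hW hd).
by rewrite ld1 //; exact: u1.
Qed.

Lemma step_010 z : inU z -> kap z (K o0 * (Z * C w_10)) = M z w_010 + M z w_0.
Proof.
move=> uz; rewrite (kap_step uz (ld1 u10) (nld u10 n01)) -wp_cons.
have -> : (s o1 * w_10 = w_0)%g by rewrite wp_cons (mulKs hW hd).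
by rewrite ld1 //; exact: u0.
Qed.

Lemma rule_0 a : sp a -> kap w_0 (K o0 * a) = two * kap w_0 a + kap 1%g a + kap w_10 a.
Proof.
move=> sa; rewrite kapKw ?wp_nil //; last exact: u0.
by rewrite (big_pred1 o1) // => j; rewrite (letters0 hn).
Qed.

Lemma rule_01 a : sp a -> kap w_01 (K o0 * a) = two * kap w_01 a + kap w_1 a + kap w_101 a.
Proof.
move=> sa; rewrite kapKw //; last exact: u01.
by rewrite (big_pred1 o1) // => j; rewrite (letters01 hn).
Qed.

Lemma rule_010 a : sp a -> kap w_010 (K o0 * a) = two * kap w_010 a + kap w_10 a.
Proof.
move=> sa; rewrite kapKw //; last exact: u010.
by rewrite big_pred0 ?addr0 // => j; rewrite (letters010 hn).
Qed.

Lemma rule_10 a : sp a -> kap w_10 (K o1 * a) = two * kap w_10 a + kap w_0 a + kap w_010 a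
  + \sum_(j : I | j == 2%N :> nat) kap (wp [:: j; o1; o0]) a.
Proof.
move=> sa; rewrite kapKw //; last exact: u10.
rewrite (bigD1 o0) /=; last by rewrite (letters10 hn).
rewrite -!addrA; do 3 congr (_ + _); apply: eq_bigl => j; rewrite (letters10 hn).
by case: eqP => [->|]; rewrite ?andbF ?andbT //=.
Qed.

Lemma uniq2 (j : I) : j == 2%N :> nat -> uniqw [:: j; o1; o0].
Proof.
move=> j2; apply: (uniqw_addP hW hd ho hf); first exact: u10.
  by rewrite -val_eqE /= o1E // (eqP j2).
by have := letters10 hn j; rewrite j2 orbT => /andP[].
Qed.

Local Notation a1 := (M w_1 w_1).
Local Notation b1 := (M w_101 w_1).
Local Notation a0 := (M w_0 w_0).
Local Notation b0 := (M w_010 w_0).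

(** The entry at (01, 01) in terms of the columns of s_1: use 01 = K_0 C_1 and
    move K_0 to the row side, where it acts on the coefficient at 01. *)
Lemma M0101 : M w_01 w_01 = a1 + b1.
Proof.
rewrite -step_01; last exact/inUw/u01.
rewrite rule_01; last exact: sp_ZC.
rewrite -[kap w_01 _]/(M w_01 w_1) -[kap w_1 _]/a1 -[kap w_101 _]/b1.
by rewrite (M_head u01 (ld1 u1) n10) mulr0 add0r.
Qed.

(** The same for 10 and the columns of s_0. *)
Lemma M1010 : M w_10 w_10 = a0 + b0.
Proof.
rewrite -step_10; last exact/inUw/u10.
rewrite rule_10; last exact: sp_ZC.
rewrite -[kap w_10 _]/(M w_10 w_0) -[kap w_0 _]/a0 -[kap w_010 _]/b0.
rewrite (M_head u10 (ld1 u0) n01) mulr0 add0r big1 ?addr0 // => j j2.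
rewrite -[kap _ _]/(M _ w_0); apply: (M_head (uniq2 j2) (ld1 u0)).
by rewrite -val_eqE /= (eqP j2).
Qed.

(** The two diagonal entries agree because inversion exchanges 01 and 10. *)
Lemma ab_link : a1 + b1 = a0 + b0.
Proof.
rewrite -M0101 -M1010 -M_inv; congr (M _ _); by rewrite !wp_cons wp_nil !mulg1 invMg !s_inv.
Qed.

(** Computed in the same way from 010 = K_0 C_10 - C_0; this is the symmetry
    of the block of H_w0 on 0 and 010. *)
Lemma M0_010 : M w_0 w_010 = b0.
Proof.
have h := step_010 (inUw u0); rewrite (rule_0 (sp_ZC _)) in h.
move: h; rewrite -[kap w_0 _]/(M w_0 w_10) -[kap 1%g _]/(M 1%g w_10) -[kap w_10 _]/(M w_10 w_10).
rewrite (M_head u0 (ld1 u10) n10) (M_e (ld1 u10)) mulr0 !add0r M1010 => h.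
by apply: (addIr a0); rewrite -h addrC.
Qed.

Lemma M1_101 : M w_1 w_101 = b1.
Proof.
have h := step_101 (inUw u1); rewrite (kapKw (sp_ZC _) u1) in h.
move: h; rewrite wp_nil -[kap w_1 _]/(M w_1 w_01) -[kap 1%g _]/(M 1%g w_01).
rewrite (M_head u1 (ld1 u01) n01) (M_e (ld1 u01)) mulr0 !add0r.
rewrite (bigD1 o0) /=; last by rewrite n01 m10 //= andbF.
rewrite -[kap (wp _) _]/(M w_01 w_01) M0101 big1 ?addr0 => [h|j /andP[/andP[j1 np] j0]].
  by apply: (addIr a1); rewrite -h addrC.
rewrite -[kap _ _]/(M _ w_01); apply: (@M_head j [:: o1] w_01 o0 _ (ld1 u01)); last by rewrite eq_sym.
by apply: (uniqw_addP hW hd ho hf) => //; exact: u1.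
Qed.

Lemma rdesc_uniqw i j t : uniqw (j :: t) -> rdesc i (wp (j :: t)) = (i == last j t).
Proof.
move=> ut; have := uniqw_rev hW hd ut.
rewrite (rdescE hW hd) -(wp_rev hW hd) lastI rev_rcons => ur.
by rewrite ldesc_uniqw.
Qed.

(** H_w0 preserves left and right descents, so only words that start and end
    with i contribute. *)
Lemma M_si_supp i z : inU z -> M z (s i) != 0 -> exists2 t, uniqw (i :: t) /\ last i t = i & z = wp (i :: t).
Proof.
move=> uz nz; have ui := uniqw1 hn hW i.
have z1 : z != 1%g.
  apply: contraNneq nz => ->; rewrite -(wp1 s i); apply/eqP; exact: (M_e (ld1 ui)).
have [j [t [ut ez]]] := inU_cons uz z1; rewrite ez in nz *.
have ij : i == j.
  apply: contraNT nz => ij; rewrite -(wp1 s i); apply/eqP; exact: (M_head ut (ld1 ui)).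
rewrite (eqP ij) in ui nz *; exists t => //; split=> //.
apply/eqP; rewrite eq_sym; rewrite -(rdesc_uniqw _ ut); apply: contraNT nz => nd.
apply/eqP; apply: (M_rdesc hW hd ho hA hbar hp hc _ nd).
by rewrite -(wp1 s j) rdesc_uniqw.
Qed.

Lemma M_s0_supp z : inU z -> M z w_0 != 0 -> z = w_0 \/ z = w_010.
Proof.
rewrite wp1 => uz /(M_si_supp uz)[t [ut lt] ->].
by case: (class00 hn hW ut lt) => ->; [left; rewrite wp1|right].
Qed.

Lemma M_s1_supp z : inU z -> M z w_1 != 0 -> z = w_1 \/ z = w_101.
Proof.
rewrite wp1 => uz /(M_si_supp uz)[t [ut lt] ->].
by case: (class11 hn hW ut lt) => ->; [left; rewrite wp1|right].
Qed.

Lemma w0_neq : w_0 != w_010.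
Proof.
apply/eqP => e; have [l1 _] := u0; have [l2 _] := u010.
by move: l1; rewrite e l2.
Qed.
Lemma w1_neq : w_1 != w_101.
Proof.
apply/eqP => e; have [l1 _] := u1; have [l2 _] := u101.
by move: l1; rewrite e l2.
Qed.

(** The diagonal entry of the relation between the matrix and its bar, when
    the column has two possibly nonzero entries. *)
Lemma norm_ab (i : I) (w w' : W) : uniqw [:: i] -> w = wp [:: i] -> inU w' -> w != w' ->
  (forall z, inU z -> M z w != 0 -> z = w \/ z = w') -> M w w' = M w' w ->
  M w w * barL (M w w) + M w' w * barL (M w' w) = 1.
Proof.
move=> ui ew uw' ne supp sym; have := M_bar hW hd ho hA hbar hp w w; rewrite eqxx mulr1n => <-.
rewrite (bigD1 w) //= (bigD1 w') 1?eq_sym //= sym big1 ?addr0 // => u /andP[uw uw2].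
have [uu|nu] := boolp.pselect (inU u); last first.
  rewrite (M_U hW hd ho hf hA hbar hp _ nu) ?mul0r //.
  by rewrite ew; apply: inUw.
have [->|nz] := eqVneq (M u w) 0; first by rewrite rmorph0 mulr0.
by case: (supp u uu nz) => e; rewrite e eqxx in uw uw2.
Qed.

(** Two Laurent polynomials whose norms add up to 1 are not both nonzero. *)
Lemma ab0 : a0 = 0 \/ b0 = 0.
Proof.
apply: bar_norm1; apply: (norm_ab u0) => //; last exact: M0_010.
- exact/inUw/u010.
- exact: w0_neq.
exact: M_s0_supp.
Qed.

Lemma ab1 : a1 = 0 \/ b1 = 0.
Proof.
apply: bar_norm1; apply: (norm_ab u1) => //; last exact: M1_101.
- exact/inUw/u101.
- exact: w1_neq.
exact: M_s1_supp.
Qed.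

(** On the kernel of the coefficient at the identity, this difference is an
    eigenvector of the Hecke algebra, for the character sending H_0 to v^-1
    and the other generators to -v. *)
Definition chi a := kap w_0 a - kap w_010 a.

Lemma chi_word t a : sp a -> kap 1%g a = 0 ->
  chi (Hword H t * a) = vV ^+ count_mem o0 t * (- v) ^+ (size t - count_mem o0 t) * chi a.
Proof.
move=> sa a1; have k1 u : kap 1%g (Hword H u * a) = 0.
  by rewrite (kap1_word hbar) // a1 mulr0.
elim: t => [|i t IH]; first by rewrite /Hword big_nil !mul1r.
have st : sp (Hword H t * a) by apply: sp_Hword.
rewrite /chi Hword_cons !(kapB hW hd ho hA hp) !(kapZ hW hd ho hA hp).
have [->|i0] := eqVneq i o0.
  rewrite rule_0 // rule_010 // k1.
  have -> : count_mem o0 (o0 :: t) = (count_mem o0 t).+1 by [].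
  rewrite -[size (o0 :: t)]/(size t).+1 subSS exprS -!mulrA [X in _ = vV * X]mulrA -IH.
  by rewrite /chi; ring.
rewrite !kapK_no ?(nld u0) ?(nld u010) //.
have -> : count_mem o0 (i :: t) = count_mem o0 t by rewrite /= (negbTE i0).
rewrite -[size (i :: t)]/(size t).+1 subSn ?count_size // exprS.
transitivity (- v * chi (Hword H t * a)); first by rewrite /chi; ring.
by rewrite IH /chi; ring.
Qed.

(** The value at H_w0 of the character of chi, with l0 the number of letters 0
    in a reduced word of w0. *)
Lemma xi_eq : exists2 l0 : nat, (0 < l0 <= n.+1)%N /\ (l0 <= len w0)%N &
  a0 - b0 = vV ^+ l0 * (- v) ^+ (len w0 - l0).
Proof.
have [t [et st eZ _]] := ex_w0word hW hd ho hA.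
exists (count_mem o0 t).
  by rewrite (count_zero hn hW et st) -st count_size.
have n1 : 1%g == w_0 = false by apply/negbTE; rewrite eq_sym (wp_uniqw_neq1 u0).
have n2 : w_010 == w_0 = false by apply/negbTE; rewrite eq_sym w0_neq.
rewrite -[LHS]/(chi (Z * C w_0)) eZ chi_word ?(kap_C hW hd ho hA hp) ?n1 //.
  by rewrite st /chi !(kap_C hW hd ho hA hp) eqxx n2 subr0 mulr1.
exact: (sp_C _ _ _ _ hp).
Qed.

(** * Coefficients of H_w0 along the Coxeter path *)

Local Notation N := (len w0).

Lemma sp_Z0 : sp Z. Proof. exact: sp_Hw. Qed.

Lemma C_s i : C (s i) = K i.
Proof.
have [_ k2] := kl_left_mul hW hd ho hA hbar hp 1%g.
have := k2 i; rewrite (C1 hW hd ho hA hbar hp) mulr1 mulg1 (ldesc1 hW hd) => -> //.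
by rewrite big_pred0 ?addr0 // => z; rewrite length1 ltn0 andbF.
Qed.

(** H_w0 is central and K_i is the Kazhdan-Lusztig element of s_i, so
    coefficients of K_i H_w0 are entries of the matrix. *)
Lemma KZ z i : kap z (K i * Z) = M z (s i).
Proof.
rewrite /w0_mx C_s; have := ZK hW hd ho hA hc i 1; rewrite !mulr1 => ->; by [].
Qed.

Lemma KZw z i : kap z (K i * Z) = M z (wp [:: i]).
Proof. by rewrite wp1 KZ. Qed.

Lemma z0_eq : two * kap w_0 Z + (- v) ^+ N + kap w_10 Z = a0.
Proof.
by rewrite -KZw (rule_0 sp_Z0) (kap1_Z hW hd ho hA hbar hp).
Qed.

Lemma z010_eq : two * kap w_010 Z + kap w_10 Z = b0.
Proof. by rewrite -KZw (rule_010 sp_Z0). Qed.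

(** The coefficients of H_w0 at the words k ... 0. At k = 0 the sum of the
    coefficients at 0 and 010 is taken, and beyond the end of the path the
    value is 0; with these conventions the sequence satisfies one recursion
    throughout. *)
Definition chain_coef k := if k is 0 then kap w_0 Z + kap w_010 Z
  else if (k <= n)%N then kap (wp (desc_word n k)) Z else 0.
Local Notation yy := chain_coef.

Lemma last_desc_word k x : last x (desc_word n k) = o0.
Proof. by elim: k x => //= k IH x. Qed.

(** The two words end with different letters, so their right descents
    differ. *)
Lemma M_desc_word k : (k < n)%N -> M (wp (desc_word n k.+1)) (wp [:: inord k.+1]) = 0.
Proof.
move=> kn; have u : uniqw (inord k.+1 :: desc_word n k) := uniqw_desc_word hn hW kn.
apply: (M_rdesc hW hd ho hA hbar hp hc (i := inord k.+1)).
  by rewrite rdesc_uniqw //; exact: uniqw1.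
rewrite rdesc_uniqw // last_desc_word -val_eqE /= inordK //; lia.
Qed.

(** The coefficient at k+1 ... 0 of K_(k+1) H_w0 vanishes by M_desc_word; the
    multiplication rule writes it through the neighbours in the chain. *)
Lemma chain_eq k : (k < n)%N -> two * yy k.+1 + yy k + yy k.+2 = 0.
Proof.
case: k => [|k] kn.
  have := M_desc_word kn; rewrite -KZw (rule_10 sp_Z0) => e.
  rewrite -[RHS]e /yy hn addrA; congr (_ + _).
  have [n2|n2] := leqP 2 n.
    have v2 : @inord n 2 = 2%N :> nat by rewrite inordK.
    rewrite (big_pred1 (inord 2)) // => j; by rewrite /= -val_eqE /= v2.
  rewrite big_pred0 // => j; apply/eqP; have := ltn_ord j; lia.
have u : uniqw (inord k.+2 :: desc_word n k.+1) := uniqw_desc_word hn hW kn.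
have := M_desc_word kn; rewrite -KZw (kapKw sp_Z0 u) => e.
rewrite -[RHS]e /yy (ltnW kn) kn; congr (_ + _).
rewrite (eq_bigl _ _ (fun j => rule_desc hn j kn)).
have [n2|n2] := leqP k.+3 n.
  have v2 : @inord n k.+3 = k.+3 :> nat by rewrite inordK.
  rewrite (big_pred1 (inord k.+3)) // => j; by rewrite /= -val_eqE /= v2.
rewrite big_pred0 // => j; apply/eqP; have := ltn_ord j; lia.
Qed.

Local Notation Y := (yy n).

Lemma yy1 : yy 1 = kap w_10 Z.
Proof. by rewrite /yy hn. Qed.

Lemma yyE k : (0 < k)%N -> (k <= n)%N -> yy k = kap (wp (desc_word n k)) Z.
Proof. by case: k => // k _ kn; rewrite /yy kn. Qed.

Lemma yy_end : yy n.+1 = 0.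
Proof. by rewrite /yy ltnn. Qed.

Lemma yy0E : (v - vV) * yy 0 = (-1) ^+ n * ((v ^+ n.+1 - vV ^+ n.+1) * Y).
Proof. by have := chebyshev_chain chain_eq yy_end (leqnn n); rewrite subnn. Qed.

Lemma yy1E : (v - vV) * yy 1 = - ((-1) ^+ n * ((v ^+ n - vV ^+ n) * Y)).
Proof.
have h := chebyshev_chain chain_eq yy_end (leq_pred n).
have e : (n - n.-1 = 1)%N by lia.
rewrite e prednK // in h; rewrite h -[in RHS](prednK hn) exprS prednK //; ring.
Qed.

(** The recursion expresses the first two members of the chain, hence the sum
    of z0_eq and z010_eq, by the last member. *)
Lemma zeta_eq : (v ^+ n.+1 + vV ^+ n.+1) * ((-1) ^+ n * Y) = a0 + b0 - (- v) ^+ N.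
Proof.
apply: (laurent_mulI v_sub_vV_neq0).
have -> : a0 + b0 - (- v) ^+ N = two * yy 0 + (yy 1 + yy 1).
  rewrite yy1 -z0_eq -z010_eq /yy; ring.
transitivity (two * ((v - vV) * yy 0) + 2%:R * ((v - vV) * yy 1)); last by ring.
rewrite yy0E yy1E !exprS.
move: (v ^+ n) (vV ^+ n) ((-1) ^+ n) Y => a b e d; symmetry.
apply: (@eq_mod_vV _ _ ((a - b) * (e * d) * 2%:R)); ring.
Qed.

(** Kazhdan-Lusztig inversion at the identity. *)
Lemma pE u : at_v (p 1%g (w0 * u)%g) = (-1) ^+ (len u + N) * kap u Z.
Proof.
by have := kl_inversion hW hd ho hA hbar hp hc 1%g u; rewrite mulg1.
Qed.

Lemma kap_at u : exists q : {poly int}, kap u Z = at_v q.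
Proof.
exists ((-1) ^+ (len u + N) * p 1%g (w0 * u)%g).
rewrite rmorphM /= pE rmorphXn rmorphN1 mulrA -exprMn mulrNN mulr1 expr1n mul1r //.
Qed.

(** The power v^(N - 2m) with m = n + 1. The entries of the matrix of H_w0 at
    unique reduced words other than the empty one turn out to be integral
    multiples of it. *)
Definition w0_power : laurent := vV ^+ n.+1 * v ^+ (N - n.+1).
Local Notation V := w0_power.

(** One of a0 and b0 vanishes, so a0 + b0 and a0 - b0 agree up to sign, with
    the value v^(N - 2 l0) up to sign found from the character chi. By
    zeta_eq, the sum minus (-v)^N is a multiple of v^m + v^-m by a polynomial
    in v; as 1 <= l0 <= m, poly_rigid leaves only l0 = m and one sign. *)
Lemma w0_power_eqs : [/\ (n.+1 <= N)%N, a0 + b0 = - (-1) ^+ N * V & a0 - b0 = (-1) ^+ (N - n.+1) * V].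
Proof.
have [l0 [/andP[l1 lm] lN] xi] := xi_eq.
have xi' : a0 - b0 = (-1) ^+ (N - l0) * (vV ^+ l0 * v ^+ (N - l0)).
  by rewrite xi -[- v]mulN1r exprMn; ring.
have [d d1 zd] : exists2 d : int, d ^+ 2 = 1 & a0 + b0 = d%:~R * (vV ^+ l0 * v ^+ (N - l0)).
  have [e|e] := ab0.
    exists (- (-1) ^+ (N - l0)); first by rewrite sqrrN -exprM mulnC exprM sqrrN expr1n.
    move: xi'; rewrite e !add0r => /(congr1 -%R); rewrite opprK => ->.
    by rewrite rmorphN rmorphXn rmorphN1 mulNr.
  exists ((-1) ^+ (N - l0)); first by rewrite -exprM mulnC exprM sqrrN expr1n.
  by move: xi'; rewrite e addr0 subr0 => ->; rewrite rmorphXn rmorphN1.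
have [y ey] := kap_at (wp (desc_word n n)).
have eY : Y = at_v y by rewrite -ey yyE.
have vl : vV ^+ l0 * v ^+ (N - l0) * v ^+ (2 * l0) = v ^+ N.
  rewrite mul2n -addnn exprD mulrACA vV_v_pow mul1r -exprD subnK //.
(* multiply by v^(n + 1 + 2 l0) to reach polynomials in v *)
have := congr1 (fun t => t * (v ^+ n.+1 * v ^+ (2 * l0))) zeta_eq.
have -> : (v ^+ n.+1 + vV ^+ n.+1) * ((-1) ^+ n * Y) * (v ^+ n.+1 * v ^+ (2 * l0)) =
   at_v ((-1) ^+ n * y * 'X^(2 * l0) * ('X^(2 * n.+1) + 1)).
  rewrite !rmorphM rmorphD !rmorphXn rmorphN1 rmorph1 /= at_vX -eY !mul2n -!addnn !exprD.
  transitivity ((-1) ^+ n * Y * (v ^+ l0 * v ^+ l0) * (v ^+ n.+1 * v ^+ n.+1 + vV ^+ n.+1 * v ^+ n.+1)); first by ring.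
  by rewrite vV_v_pow.
have -> : (a0 + b0 - (- v) ^+ N) * (v ^+ n.+1 * v ^+ (2 * l0)) =
   at_v (d *: 'X^(n.+1 + N) + (- (-1) ^+ N) *: 'X^(n.+1 + N + 2 * l0)%N).
  rewrite rmorphD -!mul_polyC !rmorphM /= !at_vC !at_vXn zd.
  transitivity (d%:~R * (vV ^+ l0 * v ^+ (N - l0) * v ^+ (2 * l0)) * v ^+ n.+1 - (- v) ^+ N * (v ^+ n.+1 * v ^+ (2 * l0))); first by ring.
  by rewrite vl rmorphN rmorphXn rmorphN1 -[- v]mulN1r exprMn !exprD; ring.
move/at_v_inj/poly_rigid; case.
- by apply: contra_eqN d1 => /eqP ->.
- by rewrite oppr_eq0 expf_neq0.
- by rewrite muln_gt0 l1 leq_mul2l lm.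
move=> e2 ed; have el : l0 = n.+1 by lia.
rewrite el in xi' zd lN; split=> //.
by rewrite zd ed rmorphN rmorphXn rmorphN1.
Qed.

Lemma V_v : V * v ^+ (2 * n.+1) = v ^+ N.
Proof.
have [lN _ _] := w0_power_eqs.
by rewrite /V mul2n -addnn exprD mulrACA vV_v_pow mul1r -exprD subnK.
Qed.

Lemma VN : v ^+ N + V = (v ^+ n.+1 + vV ^+ n.+1) * v ^+ (N - n.+1).
Proof.
have [lN _ _] := w0_power_eqs; rewrite mulrDl -exprD addnC subnK //.
Qed.

(** Divide zeta_eq by v^m + v^-m. *)
Lemma YE : (-1) ^+ n * Y = - (-1) ^+ N * v ^+ (N - n.+1).
Proof.
have [_ z _] := w0_power_eqs.
have vm : v ^+ n.+1 + vV ^+ n.+1 != 0.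
  apply/eqP => /(congr1 (fun t => t * v ^+ n.+1)); rewrite mul0r mulrDl vV_v_pow -exprD.
  rewrite -at_vXn -[1](rmorph1 at_v) -rmorphD -[0](rmorph0 at_v) => /at_v_inj.
  by move/(congr1 (fun q : {poly int} => q`_0)); rewrite coefD coefXn !coefC.
apply: (laurent_mulI vm); rewrite zeta_eq z.
transitivity (- (-1) ^+ N * (v ^+ N + V)); last by rewrite VN; ring.
by rewrite -[- v]mulN1r exprMn; ring.
Qed.

Lemma sumE : (v - vV) * yy 0 = - (-1) ^+ N * (v ^+ N - V).
Proof.
have [lN _ _] := w0_power_eqs.
rewrite yy0E mulrCA YE /V -[in v ^+ N](subnK lN) [v ^+ (_ + n.+1)]exprD; ring.
Qed.

Lemma diffE : two * (kap w_0 Z - kap w_010 Z) = (-1) ^+ (N - n.+1) * V - (-1) ^+ N * v ^+ N.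
Proof.
have [_ _ <-] := w0_power_eqs; rewrite -z0_eq -z010_eq -[- v]mulN1r exprMn; ring.
Qed.

Lemma p_w0 : at_v (p 1%g (w0 * w_0)%g) = - (-1) ^+ N * kap w_0 Z.
Proof.
rewrite (pE); have [-> _] := u0; by rewrite exprD expr1 mulN1r.
Qed.

Lemma p_u0 : at_v (p 1%g (w0 * w_010)%g) = - (-1) ^+ N * kap w_010 Z.
Proof.
rewrite (pE); have [-> _] := u010.
have e3 : (-1) ^+ 3 = -1 :> laurent by ring.
by rewrite exprD e3 mulN1r.
Qed.

(** The first member of the chain is the sum of the two coefficients;
    denominators are cleared to have an identity of polynomials. *)
Lemma kl_sum_eq : ('X^2 - 1) * (p 1%g (w0 * w_0)%g + p 1%g (w0 * w_010)%g) * 'X^(2 * n.+1)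
  = 'X^((N + 2 * n.+1).+1) - 'X^(N.+1).
Proof.
apply: at_v_inj; rewrite !rmorphM !rmorphB !rmorphD /= rmorph1 !at_vXn p_w0 p_u0.
have h := sumE; have hV := V_v.
have e2 : (-1) ^+ N * (-1) ^+ N = 1 :> laurent by rewrite -exprMn mulrNN mulr1 expr1n.
have {h} h : (v - vV) * (- (-1) ^+ N * (kap w_0 Z + kap w_010 Z)) = v ^+ N - V.
  transitivity (- (-1) ^+ N * ((v - vV) * yy 0)); first by rewrite /chain_coef; ring.
  by rewrite h mulrA mulrNN e2 mul1r.
transitivity (v * ((v - vV) * (- (-1) ^+ N * (kap w_0 Z + kap w_010 Z))) * v ^+ (2 * n.+1)).
  rewrite expr2; symmetry; apply: (@eq_mod_vV _ _ ((-1) ^+ N * (kap w_0 Z + kap w_010 Z) * v ^+ (2 * n.+1))); ring.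
rewrite h [v ^+ N.+1]exprS [v ^+ (N + _).+1]exprS exprD -hV; ring.
Qed.

(** The difference of z0_eq and z010_eq, with denominators cleared. *)
Lemma kl_diff_eq : ('X^2 + 1) * (p 1%g (w0 * w_0)%g - p 1%g (w0 * w_010)%g) * 'X^(2 * n.+1)
  = 'X^((N + 2 * n.+1).+1) - (-1) ^+ n.+1 * 'X^(N.+1).
Proof.
apply: at_v_inj; rewrite !rmorphM !rmorphB !rmorphD !rmorphM /= rmorph1 !at_vXn p_w0 p_u0.
have -> : at_v ((-1) ^+ n.+1) = (-1) ^+ n.+1 by rewrite rmorphXn rmorphN1.
have h := diffE; have hV := V_v.
have [lN _ _] := w0_power_eqs.
have e2 : (-1) ^+ N * (-1) ^+ N = 1 :> laurent by rewrite -exprMn mulrNN mulr1 expr1n.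
have e3 : (-1) ^+ N * (-1) ^+ (N - n.+1) = (-1) ^+ n.+1 :> laurent.
  rewrite -{1}(subnK lN) exprD mulrAC -exprMn mulrNN mulr1 expr1n mul1r //.
have {h} h : two * (- (-1) ^+ N * (kap w_0 Z - kap w_010 Z)) = v ^+ N - (-1) ^+ n.+1 * V.
  transitivity (- (-1) ^+ N * (two * (kap w_0 Z - kap w_010 Z))); first by ring.
  rewrite h -e3; transitivity ((-1) ^+ N * (-1) ^+ N * v ^+ N - (-1) ^+ N * (-1) ^+ (N - n.+1) * V); first by ring.
  by rewrite e2 mul1r.
transitivity (v * (two * (- (-1) ^+ N * (kap w_0 Z - kap w_010 Z))) * v ^+ (2 * n.+1)).
  by symmetry; apply: (@eq_mod_vV _ _ (- (-1) ^+ N * (kap w_0 Z - kap w_010 Z) * v ^+ (2 * n.+1))); rewrite ?at_vX ?expr2; ring.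
rewrite h [v ^+ N.+1]exprS [v ^+ (N + _).+1]exprS exprD -hV; ring.
Qed.

(** * The lower bound for the exponents *)

Definition isV (x : laurent) := exists c : int, x = c%:~R * V.
Lemma isV0 : isV 0. Proof. by exists 0; rewrite mul0r. Qed.
Lemma isVD x y : isV x -> isV y -> isV (x + y).
Proof. by move=> [c ->] [d ->]; exists (c + d); rewrite rmorphD mulrDl. Qed.
Lemma isVB x y : isV x -> isV y -> isV (x - y).
Proof. by move=> [c ->] [d ->]; exists (c - d); rewrite rmorphB mulrBl. Qed.
Lemma isV_sum (J : finType) (Q : pred J) (F : J -> laurent) :
  (forall i, Q i -> isV (F i)) -> isV (\sum_(i | Q i) F i).
Proof. by move=> h; elim/big_ind: _ => //; [exact: isV0 | exact: isVD]. Qed.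

Definition int_column u := forall z, inU z -> isV (M z u).

(** By the multiplication rule K_i maps integral columns to integral columns
    as soon as the multiple v + v^-1 of the entry itself does not occur, and
    it does not because the descent t of u differs from i. *)
Lemma int_column_step u t i z : int_column u -> ldesc t u -> ~~ ldesc i u -> inU z ->
  isV (kap z (K i * (Z * C u))).
Proof.
move=> hu dt di uz; have ti : t != i by apply: contraNneq di => <-.
have [->|z1] := eqVneq z 1%g.
  by rewrite (kapK1 hbar hp i (sp_ZC u)); exact: isV0.
have [j [r [ur ez]]] := inU_cons uz z1.
have [ij|ij] := eqVneq i j; last first.
  rewrite ez (kapK_no (sp_ZC u)) ?nld //; exact: isV0.
rewrite ez -ij in ur *; rewrite (kapKw (sp_ZC u) ur).
rewrite -[kap _ _]/(M _ u) (M_head ur dt ti) mulr0 add0r.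
apply: isVD; first by apply: hu; exists r => //; exact: (uniqw_cons hW ur).
apply: isV_sum => l /andP[li np]; apply: hu; apply: inUw.
exact: (uniqw_addP hW hd ho hf ur li np).
Qed.

Lemma isV_ab : isV (a0 + b0).
Proof. by have [_ -> _] := w0_power_eqs; exists (- (-1) ^+ N); rewrite rmorphN rmorphXn rmorphN1. Qed.

Lemma isV_pair x y : x + y = a0 + b0 -> x = 0 \/ y = 0 -> isV x /\ isV y.
Proof.
move=> e [x0|y0]; [rewrite x0 add0r in e | rewrite y0 addr0 in e]; rewrite ?x0 ?y0 e;
split; by [exact: isV0 | exact: isV_ab].
Qed.

Lemma int_column_s0 : int_column w_0.
Proof.
have [va vb] := isV_pair erefl (ab0).
move=> z uz; have [->|nz] := eqVneq (M z w_0) 0; first exact: isV0.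
by case: (M_s0_supp uz nz) => ->.
Qed.

Lemma int_column_s1 : int_column w_1.
Proof.
have [va vb] := isV_pair ab_link (ab1).
move=> z uz; have [->|nz] := eqVneq (M z w_1) 0; first exact: isV0.
by case: (M_s1_supp uz nz) => ->.
Qed.

(** Columns of generators, along the path: multiplying the column of s_(k+1)
    by K_(k+2) gives the column of the word (k+2)(k+1), its inverse gives the
    column of (k+1)(k+2), and multiplying again by K_(k+2) gives the column of
    s_(k+2), since the longer word has no unique reduced expression. *)
Lemma int_column_s k : (k <= n)%N -> int_column (wp [:: inord k]).
Proof.
elim: k => [|[|k] IH] kn.
- have -> : inord 0 = o0 by apply: val_inj; rewrite /= inordK.
  exact: int_column_s0.
- exact: int_column_s1.
have {}IH := IH (ltnW kn).
set i : I := inord k.+2; set j : I := inord k.+1.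
have vi : i = k.+2 :> nat by rewrite /i inordK.
have vj : j = k.+1 :> nat by rewrite /j inordK // ltnW.
have aij : adj i j by rewrite /adj vi vj eqxx orbT.
have aji : adj j i by rewrite /adj vi vj eqxx.
have ij := adj_neq hn aij; have ji := adj_neq hn aji.
have m3 : m i j = 3 by rewrite coxeter_B_3 ?vi ?vj.
have ui := uniqw1 hn hW i; have uj := uniqw1 hn hW j.
have uij : uniqw [:: i; j].
  by apply: (uniqw_addP hW hd ho hf) => //; rewrite coxeter_B_3 ?vi ?vj //= eqxx.
have uji : uniqw [:: j; i].
  by apply: (uniqw_addP hW hd ho hf) => //; rewrite coxeter_B_3 ?vi ?vj //= eqxx.
have I1 : int_column (wp [:: i; j]).
  move=> z uz; have := int_column_step IH (ld1 uj) (nld uj ij) uz.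
  rewrite (kap_step uz (ld1 uj) (nld uj ij)) -wp_cons.
  by rewrite wp1 (s_sqr hW hd) (ldesc1 hW hd) addr0.
have I2 : int_column (wp [:: j; i]).
  move=> z uz; rewrite -M_inv (_ : (wp [:: j; i])^-1%g = wp [:: i; j]).
    by apply: I1; apply: (inU_inv hW hd).
  by rewrite !wp_cons wp_nil !mulg1 invMg !s_inv.
move=> z uz; have := int_column_step I2 (ld1 uji) (nld uji ij) uz.
rewrite (kap_step uz (ld1 uji) (nld uji ij)).
have -> : (s j * wp [:: j; i] = wp [:: i])%g by rewrite wp_cons (mulKs hW hd).
rewrite (ld1 ui) -wp_cons (M_U hW hd ho hf hA hbar hp uz) ?add0r //.
move=> [t [e ut] et].
have l3 : len (wp [:: i; j; i]) = 3.
  by have := alt_reduced hW hd ho (leqnn (m i j)); rewrite m3.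
have b3 : wp [:: j; i; j] = wp [:: i; j; i].
  by have := wp_alt_braid hW hd ho i j; rewrite m3.
have st : size t = 3 by rewrite -e -et.
have e1 := ut [:: i; j; i] et (esym st).
have e2 := ut [:: j; i; j] (etrans b3 et) (esym st).
by move: e1; rewrite -e2 => -[/eqP]; rewrite (negbTE ij).
Qed.

(** Remove the first letter i of the word: K_i applied to the shorter column
    gives the wanted column plus possibly the column of the word without its
    first two letters. *)
Lemma int_column_word t : uniqw t -> t != [::] -> int_column (wp t).
Proof.
have [k] := ubnP (size t); elim: k t => // k IH [|i [|j t]] // st ut _.
  by have := int_column_s (ltn_ord i : (i <= n)%N); rewrite inord_val.
have uj := uniqw_cons hW ut; have ij := adj_neq hn (uniqw_adj hn hW ut).
have hj : int_column (wp (j :: t)) by apply: IH => //; rewrite ltnS in st; exact: leq_trans st.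
move=> z uz; have := int_column_step hj (ld1 uj) (nld uj ij) uz.
rewrite (kap_step uz (ld1 uj) (nld uj ij)) -wp_cons.
have -> : (s j * wp (j :: t) = wp t)%g by rewrite wp_cons (mulKs hW hd).
case: (boolP (ldesc i (wp t))) => [d|_]; last by rewrite addr0.
move=> h; rewrite -[M z _](addrK (M z (wp t))); apply: isVB => //.
apply: IH => //; [by move: st => /=; lia | exact: (uniqw_cons hW uj) |].
by apply: contraTneq d => ->; rewrite wp_nil (ldesc1 hW hd).
Qed.

(** In z_bar the matrix entries are multiples of v^(N - 2m) and the bars of
    the coefficients, multiplied by v^N, lie in v Z[v]. *)
Lemma kapZ_low u : inU u -> u != 1%g -> exists2 x, vZ x & kap u Z = V * x.
Proof.
move=> uu u_1; rewrite (z_bar hW hd ho hA hbar hp uu u_1) -[- v]mulN1r exprMn.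
have h : forall x : W, exists y, x != 1%g -> vZ y /\ M u x * (v ^+ N * barL (kap x Z)) = V * y.
  move=> x; have [->|x1] := eqVneq x 1%g; first by exists 0.
  have [[t ut ex]|nu] := boolp.pselect (inU x); last first.
    exists 0 => _; split; first exact: vZ0.
    by rewrite (M_U hW hd ho hf hA hbar hp uu nu) mul0r mulr0.
  have t0 : t != [::] by apply: contraNneq x1 => t0; rewrite ex t0 wp_nil.
  have [c] := int_column_word ut t0 uu; rewrite -ex => ->.
  exists (c%:~R * (v ^+ N * barL (kap x Z))) => _; split; last by rewrite mulrCA mulrA [c%:~R * V]mulrC; ring.
  rewrite -at_vC mulrC; apply/vZM/(barz_vZ hW hd ho hf hA hbar hp) => //.
  by exists t.
case: (boolp.choice h) => y hy.
exists (- (-1) ^+ N * \sum_(x | x != 1%g) y x).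
  rewrite (_ : - (-1) ^+ N = at_v (- (-1) ^+ N)); last by rewrite rmorphN rmorphXn rmorphN1.
  by rewrite mulrC; apply/vZM/vZ_sum => x /hy[].
set S := \sum_(_ | _) _; transitivity (- (-1) ^+ N * (v ^+ N * S)); first by ring.
rewrite [RHS]mulrCA; congr (_ * _); rewrite /S !mulr_sumr.
by apply: eq_bigr => x /hy[_ <-]; rewrite mulrCA.
Qed.

Lemma kl_low_degree u k : inU u -> u != 1%g -> (p 1%g (w0 * u)%g)`_k != 0 -> (N < k + 2 * n.+1)%N.
Proof.
move=> uu u_1; have [_ [q q0 ->] e] := kapZ_low uu u_1.
have hV := V_v.
have eq : p 1%g (w0 * u)%g * 'X^(2 * n.+1) = (-1) ^+ (len u + N) * ('X^N * q).
  apply: at_v_inj; rewrite !rmorphM /= !at_vXn rmorphXn rmorphN1 (pE) e.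
  by rewrite -hV; ring.
have := congr1 (fun r : {poly int} => r`_(k + 2 * n.+1)%N) eq.
rewrite coefMXn ltnNge leq_addl /= addnK => -> h.
rewrite ltnNge; apply: contra h => h.
have -> : (-1) ^+ (len u + N) = ((-1) ^+ (len u + N))%:P :> {poly int}.
  by rewrite rmorphXn /= rmorphN1.
rewrite coefCM mulrC [_ * q]mulrC coefMXn.
move: h; rewrite leq_eqVlt => /orP[/eqP->|->]; last by rewrite mul0r.
by rewrite ltnn subnn q0 mul0r.
Qed.

End LongestElementB.

(** * Closed formulas *)

Section Sums.
Local Open Scope ring_scope.

(** The powers in the formulas, for an arbitrary number m of exponents N - 1,
    N - 3, ..., N - 2m + 1: sumA takes every second exponent starting with the
    first and sumB the remaining ones. *)
Definition sumA N m : {poly int} := \sum_(k < uphalf m) 'X^(N - (4 * k + 1)).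
Definition sumB N m : {poly int} := \sum_(k < m./2) 'X^(N - (4 * k + 3)).

Lemma sumA_rec N m :
  sumA N m.+1 = sumA N m + (if odd m then 0 else 'X^(N - (2 * m + 1))).
Proof.
rewrite /sumA -[uphalf m.+1]/(m./2.+1) uphalf_half; case: ifP => o.
  by rewrite add1n addr0.
rewrite add0n big_ord_recr; congr (_ + 'X^(N - _)) => /=.
by rewrite -[in RHS](odd_double_half m) o; lia.
Qed.

Lemma sumB_rec N m :
  sumB N m.+1 = sumB N m + (if odd m then 'X^(N - (2 * m + 1)) else 0).
Proof.
rewrite /sumB -[m.+1./2]/(uphalf m) uphalf_half; case: ifP => o; last first.
  by rewrite add0n addr0.
rewrite add1n big_ord_recr; congr (_ + 'X^(N - _)) => /=.
by rewrite -[in RHS](odd_double_half m) o; lia.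
Qed.

Lemma sumA_last N m : (2 * m + 1 <= N)%N ->
  (sumA N m.+1)`_(N - (2 * m + 1)) = (~~ odd m)%:R.
Proof.
move=> h; rewrite sumA_rec coefD /sumA coef_sum big1 ?add0r => [|k _].
  by case: odd; rewrite ?coef0 // coefXn eqxx.
rewrite coefXn; case: eqP => // e; have := ltn_ord k; have := uphalf_half m; lia.
Qed.

Lemma sumB_last N m : (2 * m + 1 <= N)%N ->
  (sumB N m.+1)`_(N - (2 * m + 1)) = (odd m)%:R.
Proof.
move=> h; rewrite sumB_rec coefD /sumB coef_sum big1 ?add0r => [|k _].
  by case: odd; rewrite ?coef0 // coefXn eqxx.
rewrite coefXn; case: eqP => // e; have := ltn_ord k; lia.
Qed.

Lemma sumAB N m : sumA N m + sumB N m = \sum_(k < m) 'X^(N - (2 * k + 1)).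
Proof.
elim: m => [|m IH]; first by rewrite /sumA /sumB !big_ord0 addr0.
rewrite big_ord_recr -IH sumA_rec sumB_rec /=; case: odd; rewrite !addr0 ?addrA //.
by rewrite addrAC.
Qed.

Lemma telescope_sum N m : (2 * m <= N.+1)%N ->
  ('X^2 - 1) * (\sum_(k < m) 'X^(N - (2 * k + 1))) * 'X^(2 * m) =
  'X^((N + 2 * m).+1) - 'X^(N.+1) :> {poly int}.
Proof.
elim: m => [|m IH] h; first by rewrite big_ord0 mulr0 mul0r muln0 addn0 subrr.
have {}IH := IH ltac:(lia).
rewrite big_ord_recr /= mulrDr mulrDl mulnS exprD mulrA [_ * 'X^2]mulrC !mulrA.
transitivity ('X^2 * (('X^2 - 1) * (\sum_(k < m) 'X^(N - (2 * k + 1))) * 'X^(2 * m))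
   + ('X^2 - 1) * ('X^(N - (2 * m + 1)) * 'X^2 * 'X^(2 * m)) : {poly int}); first by ring.
rewrite IH -!exprD (_ : (N - (2 * m + 1) + 2 + 2 * m = N.+1)%N); last by lia.
rewrite mulrBr mulrBl mul1r -!exprD.
rewrite (_ : (2 + (N + 2 * m).+1 = (N + (2 + 2 * m)).+1)%N); last by lia.
ring.
Qed.

Lemma telescope_alt N m : (2 * m <= N.+1)%N ->
  ('X^2 + 1) * (sumA N m - sumB N m) * 'X^(2 * m) =
  'X^((N + 2 * m).+1) - (-1) ^+ m * 'X^(N.+1) :> {poly int}.
Proof.
elim: m => [|m IH] h.
  by rewrite /sumA /sumB !big_ord0 subr0 mulr0 mul0r muln0 addn0 mul1r subrr.
have {}IH := IH ltac:(lia).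
have -> : sumA N m.+1 - sumB N m.+1 = sumA N m - sumB N m + (-1) ^+ m * 'X^(N - (2 * m + 1)).
  by rewrite sumA_rec sumB_rec -signr_odd; case: odd; rewrite /= ?expr0 ?expr1; ring.
transitivity ('X^2 * (('X^2 + 1) * (sumA N m - sumB N m) * 'X^(2 * m))
   + ('X^2 + 1) * ((-1) ^+ m * ('X^(N - (2 * m + 1)) * 'X^2 * 'X^(2 * m)))).
  by rewrite mulnS exprD; ring.
rewrite IH -!exprD (_ : (N - (2 * m + 1) + 2 + 2 * m = N.+1)%N); last by lia.
rewrite mulrBr -exprD (_ : (2 + (N + 2 * m).+1 = (N + (2 * m.+1)).+1)%N); last by lia.
by rewrite [(-1) ^+ m.+1]exprS; ring.
Qed.

Lemma X2_neq0 (c : int) : 'X^2 + c%:P != 0 :> {poly int}.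
Proof.
apply/eqP => /(congr1 (fun q : {poly int} => q`_2)).
by rewrite coefD coefXn coefC coef0.
Qed.

(** The sum and the difference of the two sequences of powers are geometric,
    so that they solve the same two equations; the polynomials are found by
    cancelling the factors. *)
Lemma closed_forms (P R : {poly int}) N m :
  ('X^2 - 1) * (P + R) * 'X^(2 * m) = 'X^((N + 2 * m).+1) - 'X^(N.+1) ->
  ('X^2 + 1) * (P - R) * 'X^(2 * m) = 'X^((N + 2 * m).+1) - (-1) ^+ m * 'X^(N.+1) ->
  (0 < m)%N -> [/\ (2 * m <= N.+1)%N, P = sumA N m & R = sumB N m].
Proof.
move=> e1 e2 m0.
(* otherwise the coefficient of degree N + 1 is zero on the left side of e1
   and -1 on its right side *)
have le : (2 * m <= N.+1)%N.
  rewrite leqNgt; apply/negP => lt.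
  have := congr1 (fun q : {poly int} => q`_(N.+1)) e1.
  rewrite coefMXn lt coefB !coefXn eqxx.
  have -> : (N.+1 == (N + 2 * m).+1)%N = false by apply/eqP; lia.
  by [].
have Xn0 k : 'X^k != 0 :> {poly int} by rewrite monic_neq0 ?monicXn.
have s1 : P + R = sumA N m + sumB N m.
  have := telescope_sum le; rewrite -e1 -sumAB => /(mulIf (Xn0 _)).
  move/mulfI => -> //; have := X2_neq0 (-1); by rewrite rmorphN1.
have s2 : P - R = sumA N m - sumB N m.
  have := telescope_alt le; rewrite -e2 => /(mulIf (Xn0 _)).
  move/mulfI => -> //; exact: (X2_neq0 1).
have n2 : 2%:R != 0 :> {poly int} by rewrite -polyC_natr polyC_eq0.
split=> //; apply: (mulfI n2).
  transitivity ((P + R) + (P - R)); first by ring.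
  by rewrite s1 s2; ring.
transitivity ((P + R) - (P - R)); first by ring.
by rewrite s1 s2; ring.
Qed.

End Sums.

(** * The penultimate cell *)

Section Cell.
Local Open Scope group_scope.
Variables (n : nat) (hn : (1 <= n)%N) (W : finGroupType) (s : 'I_n.+1 -> W).
Hypothesis hW : coxeter_system (@coxeter_B n) s.
Local Notation hd := (@coxeter_B_diag n).
Local Notation hc := (w0B_central hn hW).
Local Notation I := 'I_n.+1.
Local Notation wp := (word_prod s).
Local Notation uniqw := (unique_word s).
Local Notation inU := (unique_elt s).
Local Notation ldesc := (left_descent s).
Local Notation rdesc := (right_descent s).
Local Notation w0 := (longest s).
Local Notation o0 := (ord0 : I).
Local Notation o1 := (o1 n).
Local Notation w_0 := (wp [:: o0]).
Local Notation w_010 := (wp [:: o0; o1; o0]).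

Lemma inU_card u : inU u <-> #|reduced_exprs s u| = 1%N.
Proof.
split=> [[t [e ut] eu]|/eqP/cards1P[t et]].
  have el : length s u = size t by rewrite eu.
  apply/eqP/cards1P; exists (tcast (esym el) (in_tuple t)).
  apply/setP => t'; rewrite !inE; apply/eqP/eqP => [et'|->].
    apply: val_inj; rewrite -[RHS]/(tval _) val_tcast /=; apply: ut; first by rewrite et' eu.
    by rewrite size_tuple.
  by rewrite val_tcast /= eu.
have : t \in reduced_exprs s u by rewrite et inE.
rewrite inE => /eqP wt; exists (val t); last by rewrite wt.
split; first by rewrite wt size_tuple.
move=> t' e; rewrite size_tuple => st'.
have : tcast st' (in_tuple t') \in reduced_exprs s u.
  by rewrite inE val_tcast /= e wt.
by rewrite et inE => /eqP <-; rewrite -[RHS]/(tval _) val_tcast.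
Qed.

Lemma cellP y : reflect (exists u, [/\ inU u, u != 1 & y = w0 * u])
  (y \in penultimate_cell s).
Proof.
apply: (iffP imsetP) => [[u]|[u [uu u1 ->]]].
  by rewrite inE => /andP[u1 /eqP/inU_card uu] ->; exists u.
by exists u => //; rewrite inE u1; apply/eqP/inU_card.
Qed.

Lemma w0_comm x : w0 * x = x * w0.
Proof.
have [t <-] := ex_word hW x; elim: t => [|i t IH]; first by rewrite wp_nil mulg1 mul1g.
by rewrite wp_cons mulgA hc -!mulgA IH.
Qed.

Lemma rdesc_w0 i x : rdesc i (w0 * x) = ~~ rdesc i x.
Proof. by rewrite !(rdescE hW hd) w0_comm invMg -(ldesc_w0 hW hd hc) (_ : w0^-1 = w0) //; apply/eqP; rewrite eq_invg_mul (w0w0 hW hd). Qed.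

(** Multiplication by w0 complements the descent sets, so the words in
    question are those that start and end with 0. *)
Lemma penultimate_H0 : penultimate_H s ord0 = [set w0 * w_0; w0 * w_010].
Proof.
have u0 := uniqw1 hn hW o0; have u010 := uniqw010 hn hW.
have desc0 t : uniqw (o0 :: t) -> last o0 t = o0 -> w0 * wp (o0 :: t) \in penultimate_H s ord0.
  move=> ut lt; rewrite inE; apply/andP; split.
    by apply/cellP; exists (wp (o0 :: t)); split; [exists (o0 :: t) | exact: wp_uniqw_neq1 |].
  apply/andP; split; apply/eqP/setP => i; rewrite !inE.
    by rewrite -/(ldesc i _) (ldesc_w0 hW hd hc) (ldesc_uniqw hW hd).
  by rewrite -/(rdesc i _) rdesc_w0 (rdesc_uniqw hW) // lt.
apply/setP => y; rewrite !inE; apply/idP/idP; last first.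
  by case/orP => /eqP ->; [have := desc0 [::] u0 erefl | have := desc0 [:: o1; o0] u010 erefl]; rewrite inE.
case/andP => /cellP[u [uu u1 ->]] /andP[/eqP Lu /eqP Ru].
have [j [t [ut eu]]] := inU_cons uu u1; rewrite {}eu in Lu Ru *.
have j0 : j = o0.
  have /setP/(_ j) := Lu; rewrite !inE -/(ldesc j _) (ldesc_w0 hW hd hc) (ldesc_uniqw hW hd) // eqxx.
  by case: eqP.
rewrite j0 in ut Lu Ru *.
have l0 : last o0 t = o0.
  have /setP/(_ (last o0 t)) := Ru; rewrite !inE -/(rdesc _ _) rdesc_w0 (rdesc_uniqw hW) // eqxx.
  by case: eqP.
by case: (class00 hn hW ut l0) => ->; rewrite eqxx ?orbT.
Qed.

End Cell.

Local Open Scope ring_scope.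

Theorem proposition5p9 (n : nat) (hn : (1 <= n)%N)
    (W : finGroupType) (s : 'I_n.+1 -> W)
    (hW : coxeter_system (@coxeter_B n) s)
    (A : algType laurent) (H : 'I_n.+1 -> A)
    (hA : hecke_algebra (@coxeter_B n) H)
    (bar : {rmorphism A -> A}) (hbar : bar_involution H bar)
    (p : W -> W -> {poly int}) (hp : kl_polynomials s H bar p) :
  let s0 := s ord0 in
  let s1 := s (inord 1) in
  let w0 := longest s in
  let N := length s w0 in
  let J := penultimate_cell s in
  let H00 := penultimate_H s ord0 in
  let w00 := (s0 * w0)%g in
  let u00 := (s0 * s1 * s0 * w0)%g in
  [/\ w00 != u00 /\ H00 = [set w00; u00],
      p 1%g w00 + p 1%g u00 = \sum_(k < n.+1) 'X^(N - (2 * k + 1)),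
      odd n.+1 ->
        [/\ forall y, y \in H00 -> (duflo p J y <-> y = w00),
            p 1%g w00 = \sum_(k < (n./2).+1) 'X^(N - (4 * k + 1))
          & p 1%g u00 = \sum_(k < n./2) 'X^(N - (4 * k + 3))]
    & ~~ odd n.+1 ->
        [/\ forall y, y \in H00 -> (duflo p J y <-> y = u00),
            p 1%g w00 = \sum_(k < n.+1./2) 'X^(N - (4 * k + 1))
          & p 1%g u00 = \sum_(k < n.+1./2) 'X^(N - (4 * k + 3))] ].
Proof.
move=> s0 s1 w0 N J H00 w00 u00.
pose hd := @coxeter_B_diag n; pose ho := order_sB hn hW; pose hc := w0B_central hn hW.
have ew : w00 = (w0 * word_prod s [:: ord0])%g by rewrite wp1 hc.
have eu : u00 = (w0 * word_prod s [:: ord0; o1 n; ord0])%g.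
  by rewrite (w0_comm hn hW) !wp_cons wp_nil mulg1 !mulgA.
have E1' := kl_sum_eq hn hW hA hbar hp; have E2' := kl_diff_eq hn hW hA hbar hp.
have E3' := kl_low_degree hn hW hA hbar hp.
rewrite -ew -eu -/w0 -/N in E1' E2'.
have [le eP eR] := closed_forms E1' E2' (ltn0Sn n).
have lN : (2 * n + 1 <= N)%N by lia.
have HE : H00 = [set w00; u00] by rewrite /H00 penultimate_H0 // -ew -eu.
have ne : w00 != u00.
  by rewrite ew eu (inj_eq (mulgI _)) w0_neq.
have inJ y : y \in H00 -> y \in J by rewrite inE => /andP[].
have jw : w00 \in J by apply: inJ; rewrite HE !inE eqxx.
have ju : u00 \in J by apply: inJ; rewrite HE !inE eqxx orbT.
(* the a-value is at least N - (2n + 1), and this exponent occurs in the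
   closed formulas *)
have low w k : w \in J -> (p 1%g w)`_k != 0 -> (N - (2 * n + 1) <= k)%N.
  case/cellP => u [uu u1 ->] /(E3' u k uu u1); rewrite -/w0 -/N; lia.
have a_at_low w : w \in J -> (p 1%g w)`_(N - (2 * n + 1)) != 0 -> a_value p J (N - (2 * n + 1)).
  by move=> wJ nz; split; [exists w | exact: low].
have dufloP x y : x \in J -> (p 1%g x)`_(N - (2 * n + 1)) != 0 -> y \in J ->
    (p 1%g y)`_(N - (2 * n + 1)) = 0 -> H00 = [set x; y] ->
    forall z, z \in H00 -> (duflo p J z <-> z = x).
  move=> xJ nx yJ ny eH z; rewrite eH !inE => hz; split=> [[_ [a [[w wJ wa] am] za]]|->].
    have ea : a = (N - (2 * n + 1))%N.
      by apply/eqP; rewrite eqn_leq (low w) // andbT (am x).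
    by case/orP: hz => /eqP // zy; move: za; rewrite ea zy ny eqxx.
  by split=> //; exists (N - (2 * n + 1))%N => //; apply: (a_at_low x).
have cA := sumA_last lN; have cB := sumB_last lN.
rewrite -eP in cA; rewrite -eR in cB.
split.
- by split.
- by rewrite eP eR sumAB.
- rewrite /= => on; rewrite on in cA; rewrite (negbTE on) in cB.
  split.
  + by apply: (dufloP w00 u00) => //; rewrite cA.
  + by rewrite eP /sumA (_ : uphalf n.+1 = n./2.+1).
  + by rewrite eR /sumB (_ : n.+1./2 = n./2) //= uphalf_half (negbTE on).
rewrite /= negbK => on; rewrite on in cA cB.
split.
- by apply: (dufloP u00 w00) => //; [rewrite cB | rewrite HE setUC].
- by rewrite eP /sumA (_ : uphalf n.+1 = uphalf n) //= uphalf_half on.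
by rewrite eR.
Qed.
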